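(* Consider the MIMO multiway relay channel $(M,N,K)$ with pairwise data exchange described in the context, with $K=3$ users. For all positive integers $M,N$, the per-user DoF capacity equals $$d_{\mathrm{user}}=\begin{cases} M, & \frac{M}{N}<\frac{2}{3},\\[2pt] \frac{2N}{3}, & \frac{M}{N}\ge \frac{2}{3},\end{cases}$$ and this value is achievable.
   Context: MIMO multiway relay channel (mRC) $(M,N,K)$ with pairwise data exchange: $K$ users, each with $M$ antennas, communicate via a single relay with $N$ antennas ($M,N$ positive integers); there are no direct user-to-user links. Communication uses two phases of $T$ channel uses each. Uplink: the relay receives $\mathbf{Y}_R=\sum_{k=1}^K\mathbf{H}_k\mathbf{X}_k+\mathbf{Z}_R$, where $\mathbf{H}_k\in\mathbb{C}^{N\times M}$, $\mathbf{X}_k\in\mathbb{C}^{M\times T}$ is user $k$'s transmit signal with $\frac1T\mathrm{tr}(\mathbf{X}_k\mathbf{X}_k^H)\le P$, and $\mathbf{Z}_R$ has i.i.d. $\mathcal{CN}(0,\sigma^2)$ entries. Downlink: the relay transmits $\mathbf{X}_R\in\mathbb{C}^{N\times T}$, a function of $\mathbf{Y}_R$, with $\frac1T\mathrm{tr}(\mathbf{X}_R\mathbf{X}_R^H)\le P$; user $k$ receives $\mathbf{Y}_k=\mathbf{G}_k\mathbf{X}_R+\mathbf{Z}_k$ with $\mathbf{G}_k\in\mathbb{C}^{M\times N}$ and $\mathbf{Z}_k$ having i.i.d. $\mathcal{CN}(0,\sigma^2)$ entries. The entries of all channel matrices $\mathbf{H}_k,\mathbf{G}_k$ are drawn from a continuous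 distribution and are perfectly known at all nodes. Pairwise data exchange: for every ordered pair $k\neq k'$, user $k$ has an independent message $W^{(k,k')}$ of rate $R^{(k,k')}$ intended for user $k'$, who decodes it from $\mathbf{Y}_{k'}$ and its own messages; rates are achievable if all decoding error probabilities tend to $0$ as $T\to\infty$. Let $\mathrm{SNR}=P/\sigma^2$ and $C_k(\mathrm{SNR})=\sum_{k'\neq k}R^{(k,k')}$. The total DoF of a family of achievable rates is $d_{\mathrm{sum}}=\lim_{\mathrm{SNR}\to\infty}\frac{\sum_{k=1}^K C_k(\mathrm{SNR})}{\log \mathrm{SNR}}$ and the per-user DoF is $d_{\mathrm{user}}=d_{\mathrm{sum}}/K$. A DoF value is achievable if it is attained by some transmission scheme (possibly using symbol extensions over several channel uses) for almost all channel realizations; the per-user DoF capacity is the supremum of achievable per-user DoF values. *)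

(* Defs.v *)
From HB Require Import structures.
From mathcomp Require Import all_boot all_order all_algebra.
From mathcomp Require Import all_classical all_reals all_analysis.
From mathcomp Require Import complex.
Set Implicit Arguments. Unset Strict Implicit. Unset Printing Implicit Defensive.
Import Order.TTheory GRing.Theory Num.Theory.
Import numFieldNormedType.Exports.
Local Open Scope classical_set_scope.
Local Open Scope ring_scope.

Definition msg (K : nat) (n : 'I_K -> 'I_K -> nat) :=
  {dffun forall p : 'I_K * 'I_K, 'I_(n p.1 p.2)}.

(* Average transmit power (1/T) tr(X X^H), as an element of R[i]
   (it is real and nonnegative). *)
Definition avg_power (R : realType) (m T : nat) (X : 'M[R[i]]_(m, T)) : R[i] :=
  (T%:R)^-1 * \tr (X *m (map_mx conjc X)^T).

Record code (R : realType) (K M N T : nat) (n : 'I_K -> 'I_K -> nat) := Code {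
  (* user k's encoder (may only depend on user k's own messages) *)
  enc : 'I_K -> msg n -> 'M[R[i]]_(M, T);
  relay : 'M[R[i]]_(N, T) -> 'M[R[i]]_(N, T);
  (* user k''s decoder: from Y_k' and its own messages, an estimate of the
     message tuple (only the entries (k,k') are relevant) *)
  dec : 'I_K -> 'M[R[i]]_(M, T) -> msg n -> msg n }.

Definition code_valid (R : realType) (K M N T : nat) (n : 'I_K -> 'I_K -> nat)
    (P : R) (c : @code R K M N T n) : Prop :=
  [/\ (forall k (w w' : msg n), (forall k', w (k, k') = w' (k, k')) ->
          enc c k w = enc c k w'),
      (forall k' Y (w w' : msg n), (forall k, w (k', k) = w' (k', k)) ->
          dec c k' Y w = dec c k' Y w'),
      (forall k w, avg_power (enc c k w) <= (P%:C)%C),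
      (forall Y, avg_power (relay c Y) <= (P%:C)%C) &
      (* no message for a user to itself: trivial message sets *)
      (forall k, n k k = 1%N)].

(* Index set of the real scalar noise components:
   relay noise entries (i,t), user noise entries (k,i,t), real/imag part. *)
Definition noise_idx (K M N T : nat) : finType :=
  ((('I_N * 'I_T) + ('I_K * 'I_M * 'I_T)) * bool)%type.

Definition cpart (R : realType) (b : bool) (z : R[i]) : R :=
  if b then complex.Im z else complex.Re z.

Definition noise_comp (R : realType) (K M N T : nat) (Omega : Type)
    (ZR : Omega -> 'M[R[i]]_(N, T)) (Z : 'I_K -> Omega -> 'M[R[i]]_(M, T))
    (j : noise_idx K M N T) (o : Omega) : R :=
  match j with
  | (inl (i, t), b) => cpart b (ZR o i t)
  | (inr (k, i, t), b) => cpart b (Z k o i t)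
  end.

(* Gaussian noise model: all entries of Z_R and of the Z_k are i.i.d.
   CN(0, sigma2), i.e. all real and imaginary parts are mutually
   independent N(0, sigma2/2) real random variables. *)
Definition gaussian_noise (R : realType) (K M N T : nat) (sigma2 : R)
    (d : measure_display) (Omega : measurableType d) (Pr : probability Omega R)
    (ZR : Omega -> 'M[R[i]]_(N, T)) (Z : 'I_K -> Omega -> 'M[R[i]]_(M, T)) : Prop :=
  (forall j, measurable_fun setT (noise_comp ZR Z j)) /\
  (forall B : noise_idx K M N T -> set R, (forall j, measurable (B j)) ->
     fine (Pr [set o | forall j, B j (noise_comp ZR Z j o)]) =
     \prod_(j : noise_idx K M N T)
        fine (normal_prob 0 (Num.sqrt (sigma2 / 2)) (B j))).

Definition relay_rx (R : realType) (K M N T : nat) (n : 'I_K -> 'I_K -> nat)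
    (H : 'I_K -> 'M[R[i]]_(N, M)) (c : @code R K M N T n) (w : msg n)
    (ZRo : 'M[R[i]]_(N, T)) : 'M[R[i]]_(N, T) :=
  \sum_(k < K) (H k *m enc c k w) + ZRo.

Definition user_rx (R : realType) (K M N T : nat) (n : 'I_K -> 'I_K -> nat)
    (H : 'I_K -> 'M[R[i]]_(N, M)) (G : 'I_K -> 'M[R[i]]_(M, N))
    (c : @code R K M N T n) (w : msg n) (ZRo : 'M[R[i]]_(N, T))
    (k' : 'I_K) (Zko : 'M[R[i]]_(M, T)) : 'M[R[i]]_(M, T) :=
  G k' *m relay c (relay_rx H c w ZRo) + Zko.

Definition err_event (R : realType) (K M N T : nat) (n : 'I_K -> 'I_K -> nat)
    (H : 'I_K -> 'M[R[i]]_(N, M)) (G : 'I_K -> 'M[R[i]]_(M, N))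
    (c : @code R K M N T n) (Omega : Type)
    (ZR : Omega -> 'M[R[i]]_(N, T)) (Z : 'I_K -> Omega -> 'M[R[i]]_(M, T))
    (k k' : 'I_K) (w : msg n) : set Omega :=
  [set o | dec c k' (user_rx H G c w (ZR o) k' (Z k' o)) w (k, k') != w (k, k')].

Definition err_prob (R : realType) (K M N T : nat) (n : 'I_K -> 'I_K -> nat)
    (H : 'I_K -> 'M[R[i]]_(N, M)) (G : 'I_K -> 'M[R[i]]_(M, N))
    (c : @code R K M N T n)
    (d : measure_display) (Omega : measurableType d) (Pr : probability Omega R)
    (ZR : Omega -> 'M[R[i]]_(N, T)) (Z : 'I_K -> Omega -> 'M[R[i]]_(M, T))
    (k k' : 'I_K) : R :=
  (#|{: msg n}|%:R)^-1 *
    \sum_(w : msg n) fine (Pr (err_event H G c ZR Z k k' w)).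

Definition achievable (R : realType) (K M N : nat)
    (H : 'I_K -> 'M[R[i]]_(N, M)) (G : 'I_K -> 'M[R[i]]_(M, N))
    (P sigma2 : R) (Rt : 'I_K -> 'I_K -> R) : Prop :=
  forall eps : R, 0 < eps -> exists T0 : nat, forall T : nat, (T0 <= T)%N ->
  exists (n : 'I_K -> 'I_K -> nat) (c : @code R K M N T n),
    code_valid P c /\
    (forall k k', k != k' -> expR (T%:R * Rt k k') <= (n k k')%:R) /\
    (forall (d : measure_display) (Omega : measurableType d)
            (Pr : probability Omega R)
            (ZR : Omega -> 'M[R[i]]_(N, T)) (Z : 'I_K -> Omega -> 'M[R[i]]_(M, T)),
       gaussian_noise sigma2 Pr ZR Z ->
       forall k k', k != k' ->
         (forall w, measurable (err_event H G c ZR Z k k' w)) /\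
         err_prob H G c Pr ZR Z k k' <= eps).

Definition sum_rate (R : realType) (K : nat) (Rt : 'I_K -> 'I_K -> R) : R :=
  \sum_(k < K) \sum_(k' < K | k' != k) Rt k k'.

Definition dof_user_achievable (R : realType) (K M N : nat)
    (H : 'I_K -> 'M[R[i]]_(N, M)) (G : 'I_K -> 'M[R[i]]_(M, N))
    (sigma2 : R) (d : R) : Prop :=
  exists Rt : R -> 'I_K -> 'I_K -> R,
    (forall snr, 0 < snr ->
       (forall k k', 0 <= Rt snr k k') /\
       achievable H G (snr * sigma2) sigma2 (Rt snr)) /\
    (fun snr => sum_rate (Rt snr) / (K%:R * ln snr)) x @[x --> +oo] --> d.

Definition lebesgue_null (R : realType) (I : finType) (A : set (I -> R)) : Prop :=
  forall eps : R, 0 < eps -> exists a b : nat -> I -> R,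
    [/\ (forall m i, a m i <= b m i),
        (forall m, \sum_(q < m) \prod_(i : I) (b q i - a q i) <= eps) &
        A `<=` \bigcup_m [set x | forall i, a m i <= x i <= b m i]].

(* Real coordinates of a channel realisation:
   (false, k, i, j, b) : part b of H_k(i,j), i : 'I_N, j : 'I_M;
   (true,  k, i, j, b) : part b of G_k(j,i). *)
Definition chan_idx (K M N : nat) : finType :=
  (bool * 'I_K * 'I_N * 'I_M * bool)%type.

Definition chanH (R : realType) (K M N : nat) (x : chan_idx K M N -> R)
    : 'I_K -> 'M[R[i]]_(N, M) :=
  fun k => \matrix_(i < N, j < M) (x (false, k, i, j, false) +i* x (false, k, i, j, true))%C.

Definition chanG (R : realType) (K M N : nat) (x : chan_idx K M N -> R)
    : 'I_K -> 'M[R[i]]_(M, N) :=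
  fun k => \matrix_(j < M, i < N) (x (true, k, i, j, false) +i* x (true, k, i, j, true))%C.

Definition dstar (R : realType) (M N : nat) : R :=
  if (3 * M < 2 * N)%N then M%:R else (2 * N)%:R / 3.

(* Main.v *)
(* Converse.  A signal whose power is [SNR] times the noise variance shifts a
   Gaussian, and replacing the shifted Gaussian by a centered one of variance
   enlarged by [1 + SNR] costs a factor [sqrt (1 + SNR)] per real dimension.  As
   decoding regions are disjoint, summing over the messages bounds their number.
   With the [M] antennas of a user this applies to all the messages intended for
   it.  With the [N] antennas of the relay it applies to three messages out of
   six: a user [i] decodes [j -> i] and [l -> i], and, given the messages of
   [j], can then also decode [l -> j]; two such triples cover the six messages.

   Achievability.  The streams are arranged in groups, each with one stream for
   every edge of a directed cycle on two or three users.  The users of a group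
   choose transmit (and, dually, receive) directions whose images at the relay
   sum to zero, so that a group of [m] streams occupies [m - 1] relay dimensions.
   The relay inverts this representation and forwards a combination of the
   signals from which every user obtains each of its streams up to its own
   signal.  Each stream carries a QAM alphabet protected by a Gilbert-Varshamov
   code against the few noise samples that are too large.

   Genericity.  The alignment equations are solved by polynomials in the channel
   coefficients (Cramer's rule), so one channel at which the construction works
   suffices: the zero set of a nonzero polynomial is null, because each of its
   points is a simple zero, in some coordinate, of a polynomial, and such zeros
   locally form a Lipschitz graph. *)

Require Import Defs.
From HB Require Import structures.
From mathcomp Require Import all_boot all_order all_algebra.
From mathcomp Require Import all_classical all_reals all_analysis.
From mathcomp Require Import complex.
From mathcomp Require Import measurable_realfun ring lra zify.
Set Implicit Arguments. Unset Strict Implicit. Unset Printing Implicit Defensive.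
Import Order.TTheory GRing.Theory Num.Theory.
Import numFieldNormedType.Exports.
Local Open Scope classical_set_scope.
Local Open Scope ring_scope.

(** * Product measures and shifted Gaussians *)

(** Achievability quantifies over every Gaussian noise model and every block length beyond a
    threshold. A converse may therefore pick one concrete product space and one block length;
    comparing densities there replaces mutual information, and the bound obtained is uniform in the
    length. The direct part faces an arbitrary model, of which it uses the independence of the noise
    components and their tails.

    At a fixed SNR the error probability has to vanish with the length while the rate loss stays
    negligible against [ln snr]. A noise level [B] that does not depend on the SNR makes the
    fraction of bad channel uses as small as desired, so crude factors such as [2 ^ T] in ball or
    union bounds are harmless.

    The optimal total is the smaller of [3 * M] and [2 * N], an integer, so whole streams suffice
    and no symbol extension occurs. Groups of two alone would miss [3 * M] for odd [M]; this is why
    groups of three enter. *)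

Section TupleMeasure.
Context {d : measure_display} {T : measurableType d} {R : realType}.

Definition tcons n (z : T * n.-tuple T) : n.+1.-tuple T := cons_tuple z.1 z.2.

Lemma measurable_tcons n : measurable_fun setT (@tcons n).
Proof. by apply: measurable_cons. Qed.

HB.instance Definition _ n :=
  isMeasurableFun.Build _ _ _ _ (@tcons n) (@measurable_tcons n).

(** The coordinates may have different laws because the comparison of Gaussians enlarges only some
    of the variances. The recursion lets proofs integrate out the head coordinate. *)
Fixpoint tprob n (p : nat -> probability T R) : probability (n.-tuple T) R :=
  match n with
  | 0 => dirac [tuple]
  | m.+1 => distribution (p 0%N \x tprob m (p \o S))%E (@tcons m)
  end.

Lemma measurable_tcons_section n (x : T) (A : set (n.+1.-tuple T)) :
  measurable A -> measurable [set t | A (cons_tuple x t)].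
Proof.
move=> mA; rewrite -[X in measurable X]setTI.
by apply: (measurable_cons (f := cst x) (g := id)).
Qed.

Lemma tprobS n p (A : set (n.+1.-tuple T)) :
  tprob n.+1 p A =
    (\int[p 0%N]_x tprob n (p \o S) [set t | A (cons_tuple x t)])%E.
Proof.
rewrite /= /distribution /pushforward /product_measure1.
by apply: eq_integral => x _ /=; congr (tprob _ _ _); apply/seteqP; split => t;
   rewrite /xsection /= ?inE.
Qed.

Lemma measurable_tprob_section n p (A : set (n.+1.-tuple T)) : measurable A ->
  measurable_fun [set: T]
    ((fun x => tprob n p [set t | A (cons_tuple x t)]) : T -> \bar R).
Proof.
move=> mA.
have mA' : measurable (@tcons n @^-1` A).
  by rewrite -[X in measurable X]setTI; apply: measurable_tcons.
have := measurable_fun_xsection (tprob n p) mA'.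
apply: eq_measurable_fun => x _ /=.
by congr (tprob _ _ _); apply/seteqP; split => t; rewrite /xsection /= ?inE.
Qed.

Lemma tprob_rect n p (B : nat -> set T) : (forall i, measurable (B i)) ->
  tprob n p [set t | forall i : 'I_n, B i (tnth t i)] = (\prod_(i < n) p i (B i))%E.
Proof.
elim: n p B => [|n IH] p B mB.
  by rewrite big_ord0 /= diracE mem_set//; move=> [].
rewrite tprobS big_ord_recl /=.
transitivity (\int[p 0%N]_x ((\1_(B 0%N) x)%:E * \prod_(i < n) p i.+1 (B i.+1)))%E.
  apply: eq_integral => x _; rewrite indicE.
  have [Bx|Bx] := boolP (x \in B 0%N).
    have /= <- := IH (p \o S) (B \o S) (fun i => mB i.+1).
    rewrite mul1e; congr (tprob _ _ _).
    apply/seteqP; split => t /= h i.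
      by have := h (lift ord0 i); rewrite tnthS.
    have [->|[j ->]] : i = ord0 \/ exists j, i = lift ord0 j.
      by case: (unliftP ord0 i) => [j|]; [right; exists j|left].
    - by rewrite tnth0; rewrite inE in Bx.
    - by rewrite tnthS; apply: h.
  rewrite mul0e (_ : [set t | _] = set0) ?measure0//.
  apply/seteqP; split => t //= /(_ ord0); rewrite tnth0 => h.
  by move: Bx; rewrite notin_setE.
have P0 : (0 <= \prod_(i < n) p i.+1 (B i.+1))%E by exact: prode_ge0.
rewrite ge0_integralZr //=.
- by rewrite integral_indic// setIT.
- by apply/measurable_EFinP/measurable_indicP.
Qed.

Lemma measurable_tuple_map n (f : nat -> T -> T) (A : set (n.-tuple T)) :
  (forall i, measurable_fun setT (f i)) -> measurable A ->
  measurable [set t : n.-tuple T | A [tuple f i (tnth t i) | i < n]].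
Proof.
move=> mf mA; rewrite -[X in measurable X]setTI.
apply: (_ : measurable_fun setT (fun t : n.-tuple T => [tuple f i (tnth t i) | i < n])) => //.
apply/measurable_fun_tnthP => i.
rewrite (_ : _ \o _ = f i \o (@tnth _ T ^~ i)).
  by apply: measurableT_comp => //; exact: measurable_tnth.
by apply/funext => t /=; rewrite tnth_mktuple.
Qed.

(* A pointwise density bound tensorizes; [f i] need not be injective. *)
Lemma tprob_dominated n (p q : nat -> probability T R) (f : nat -> T -> T)
    (k : nat -> R) (A : set (n.-tuple T)) :
  (forall i, measurable_fun setT (f i)) -> (forall i, 0 <= k i) ->
  (forall i B, measurable B -> (p i (f i @^-1` B) <= (k i)%:E * q i B)%E) ->
  measurable A ->
  (tprob n p [set t | A [tuple f i (tnth t i) | i < n]] <=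
    (\prod_(i < n) k i)%:E * tprob n q A)%E.
Proof.
elim: n p q f k A => [|n IH] p q f k A mf k0 pq mA.
  have E (t : 0.-tuple T) : [tuple f i (tnth t i) | i < 0] = t.
    by rewrite [LHS]tuple0 [RHS]tuple0.
  rewrite big_ord0 mul1e (_ : [set t | _] = A)//.
  by apply/seteqP; split=> t /=; rewrite E.
rewrite !tprobS big_ord_recl.
pose h x := tprob n (q \o S) [set t | A (cons_tuple x t)].
have mh : measurable_fun setT (h : T -> \bar R) by exact: measurable_tprob_section.
pose K := \prod_(i < n) k (lift ord0 i).
have K0 : 0 <= K by apply: prodr_ge0.
apply: (@le_trans _ _ (\int[p 0%N]_x (K%:E * h (f 0%N x)))%E).
  apply: ge0_le_integral => //.
  - apply: measurable_tprob_section.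
    apply: (measurable_tuple_map mf mA).
  - by apply: measurable_funeM; exact: measurableT_comp.
  - move=> x _.
    have := IH (p \o S) (q \o S) (f \o S) (k \o S) [set t | A (cons_tuple (f 0%N x) t)].
    move=> /(_ (fun i => mf i.+1) (fun i => k0 i.+1) (fun i => pq i.+1)).
    move=> /(_ (measurable_tcons_section _ mA)); apply: le_trans.
    rewrite le_eqVlt; apply/orP; left; apply/eqP; congr (tprob _ _ _).
    have E (t : n.-tuple T) : [tuple f i (tnth (cons_tuple x t) i) | i < n.+1] =
        cons_tuple (f 0%N x) [tuple f i.+1 (tnth t i) | i < n].
      apply: eq_from_tnth => i; rewrite tnth_mktuple.
      by case: (unliftP ord0 i) => [j|] ->; rewrite ?tnth0 ?tnthS ?tnth_mktuple.
    by apply/seteqP; split => t /=; rewrite E.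
rewrite ge0_integralZl//; last exact: measurableT_comp.
rewrite mulrC EFinM -muleA; apply: lee_pmul => //.
  by apply: integral_ge0.
(* For the head coordinate, the image of [p 0] under [f 0] is a measure below [k 0] times [q 0], so
   integrals of nonnegative functions compare as well. *)
rewrite -(ge0_integral_pushforward (mf 0%N) (p 0%N) (f := h) measurableT)//.
have k00 : (0 <= k 0%N) by [].
apply: (@le_trans _ _ (\int[mscale (NngNum k00) (q 0%N)]_x h x)%E).
  apply: ge0_le_measure_integral => //.
  move=> B mB. exact: pq.
by rewrite ge0_integral_mscale.
Qed.
End TupleMeasure.

(** * Shifted Gaussians against centered ones of larger variance *)

Section GaussShift.
Context {R : realType}.
Local Notation T := (measurableTypeR R).
Local Notation mu := (@lebesgue_measure R).

Definition shift (x : R) : T -> T := fun z => z + x.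

Lemma measurable_shift (x : R) : measurable_fun setT (shift x).
Proof. exact: measurable_funD. Qed.

HB.instance Definition _ x :=
  isMeasurableFun.Build _ _ _ _ (shift x) (measurable_shift x).

Lemma lebesgue_measure_shift (x : R) (B : set T) : measurable B ->
  mu B = pushforward mu (shift x) B.
Proof.
apply: lebesgue_measure_unique => X [[a b] /= _ <-]; rewrite /pushforward /=.
have -> : shift x @^-1` `]a, b]%classic = `](a - x), (b - x)]%classic.
  by apply/seteqP; split => z /=; rewrite /shift !in_itv /= ltrBlDr lerBrDr.
rewrite !lebesgue_measure_itv /= !lte_fin ltrD2r -!EFinB.
by rewrite opprD opprK addrACA addNr addr0.
Qed.

(** Once the normalizations cancel, the exponents differ by the square [((1 + v) * x - v * y) ^+ 2]
    over [2 * v * s ^+ 2 * (1 + v)]. It vanishes for some [y], so the factor is the best one uniform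
    in [y]. *)
Lemma normal_pdf_shift_le (s v x y : R) : 0 < s -> 0 < v ->
  normal_pdf 0 s (y - x) <=
  Num.sqrt (1 + v) * expR (x ^+ 2 / (2 * (v * s ^+ 2))) *
  normal_pdf 0 (s * Num.sqrt (1 + v)) y.
Proof.
move=> s0 v0; have v1 : 0 < 1 + v by rewrite ltr_wpDl.
have s1 : s != 0 by rewrite gt_eqF.
have s2 : s * Num.sqrt (1 + v) != 0 by rewrite mulf_neq0// gt_eqF// sqrtr_gt0.
rewrite !normal_pdfE// /normal_peak /normal_fun !subr0.
have -> : Num.sqrt ((s * Num.sqrt (1 + v)) ^+ 2 * pi *+ 2) =
    Num.sqrt (1 + v) * Num.sqrt (s ^+ 2 * pi *+ 2).
  by rewrite -sqrtrM ?(ltW v1)// exprMn sqr_sqrtr ?(ltW v1)//; congr Num.sqrt; rewrite !mulrnAr; ring.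
rewrite -[leRHS]mulrA [X in _ <= X](_ : _ = (Num.sqrt (s ^+ 2 * pi *+ 2))^-1 *
  (expR (x ^+ 2 / (2 * (v * s ^+ 2))) * expR (- y ^+ 2 / ((s * Num.sqrt (1 + v)) ^+ 2 *+ 2)))); last first.
  by field; rewrite !gt_eqF// ?sqrtr_gt0// pmulrn_lgt0// mulr_gt0 ?pi_gt0 ?exprn_gt0.
rewrite ler_wpM2l// -expRD ler_expR exprMn sqr_sqrtr ?(ltW v1)//.
rewrite -subr_ge0 [leRHS](_ : _ = ((1 + v) * x - v * y) ^+ 2 / (2 * v * s ^+ 2 * (1 + v))).
  by rewrite mulr_ge0 ?sqr_ge0// invr_ge0 !mulr_ge0 ?sqr_ge0// ltW.
by field; rewrite ?gt_eqF.
Qed.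

Lemma normal_prob_shift_le (s v x : R) (B : set T) :
  0 < s -> 0 < v -> measurable B ->
  (normal_prob 0 s (shift x @^-1` B) <=
   (Num.sqrt (1 + v) * expR (x ^+ 2 / (2 * (v * s ^+ 2))))%:E *
   normal_prob 0 (s * Num.sqrt (1 + v)) B)%E.
Proof.
move=> s0 v0 mB; rewrite /normal_prob.
pose f (y : T) := (normal_pdf 0 s (y - x))%:E.
have mf : measurable_fun [set: T] f.
  apply/measurable_EFinP; apply: (measurableT_comp (measurable_normal_pdf 0 s)).
  exact: measurable_funB.
have mg : measurable_fun [set: T] (fun y => (normal_pdf 0 (s * Num.sqrt (1 + v)) y)%:E).
  by apply/measurable_EFinP; apply: measurable_normal_pdf.
have -> : (\int[mu]_(z in shift x @^-1` B) (normal_pdf 0 s z)%:E =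
  \int[mu]_(y in B) f y)%E.
  transitivity (\int[pushforward mu (shift x)]_(y in B) f y)%E.
    have f0 : {in B, forall y, (0 <= f y)%E}.
      by move=> y _; rewrite lee_fin normal_pdf_ge0.
    apply: etrans (esym (ge0_integral_pushforward
      (measurable_shift x) mu mB (measurable_funTS mf) f0)).
    by apply: eq_integral => z _; rewrite /f /shift /= addrK.
  apply: eq_measure_integral => A mA _; exact: (esym (lebesgue_measure_shift x mA)).
have k0 : 0 <= Num.sqrt (1 + v) * expR (x ^+ 2 / (2 * (v * s ^+ 2))).
  by rewrite mulr_ge0 ?sqrtr_ge0 ?expR_ge0.
rewrite -ge0_integralZl//; last 2 first.
- exact: measurable_funTS.
- by move=> y _; rewrite lee_fin normal_pdf_ge0.
apply: ge0_le_integral => //.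
- by move=> y _; rewrite lee_fin normal_pdf_ge0.
- exact: measurable_funTS.
- by apply: measurable_funeM; exact: measurable_funTS.
- by move=> y _; rewrite -EFinM lee_fin normal_pdf_shift_le.
Qed.
End GaussShift.

Section DisjointSums.
Context {d : measure_display} {X : measurableType d} {R : realType}.

Lemma sum_measure_disjoint (q : {measure set X -> \bar R}) (W : choiceType) (s : seq W)
    (D : W -> set X) : uniq s -> {in s, forall w, measurable (D w)} ->
  {in s &, forall w w' x, D w x -> D w' x -> w = w'} ->
  (\sum_(w <- s) q (D w) = q (\big[setU/set0]_(w <- s) D w))%E.
Proof.
elim: s => [|w s IH] /=; first by rewrite !big_nil measure0.
move=> /andP[ws us] mD dD; rewrite !big_cons measureU.
- rewrite IH// => [v vs|v v' vs vs' x].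
    by apply: mD; rewrite inE vs orbT.
  by apply: dD; rewrite inE ?vs ?vs' orbT.
- by apply: mD; rewrite inE eqxx.
- rewrite big_seq; apply: bigsetU_measurable => v vs.
  by apply: mD; rewrite inE vs orbT.
- apply/seteqP; split => x //= [Dw]. rewrite -bigcup_seq => -[v /= vs Dv].
  move: ws; rewrite (dD w v _ _ x Dw Dv) ?vs//; first by rewrite inE eqxx.
  by rewrite inE vs orbT.
Qed.

Lemma sum_probability_disjoint_le1 (q : probability X R) (W : finType) (P : pred W)
    (D : W -> set X) : (forall w, P w -> measurable (D w)) ->
  (forall w w' x, P w -> P w' -> D w x -> D w' x -> w = w') ->
  (\sum_(w | P w) q (D w) <= 1)%E.
Proof.
move=> mD dD; rewrite -big_filter sum_measure_disjoint.
- by apply: probability_le1; rewrite big_seq; apply: bigsetU_measurable => w;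
    rewrite mem_filter => /andP[Pw _]; exact: mD.
- by rewrite filter_uniq// index_enum_uniq.
- by move=> w; rewrite mem_filter => /andP[Pw _]; exact: mD.
- by move=> w w'; rewrite !mem_filter => /andP[Pw _] /andP[Pw' _] x; exact: dD.
Qed.
End DisjointSums.

Section SumSections.
Context {d1 d2 : measure_display} {X1 : measurableType d1} {X2 : measurableType d2}.
Context {R : realType} (P1 : probability X1 R) (P2 : probability X2 R).

Lemma product_measure_ysection (A : set (X1 * X2)) : measurable A ->
  ((P1 \x P2) A = \int[P2]_y P1 (ysection A y))%E.
Proof.
move=> mA; rewrite (@product_measure_unique _ _ _ _ _ P1 P2 (P1 \x^ P2)%E)//.
by move=> B C mB mC /=; rewrite product_measure2E.
Qed.

(** Allows one noise component to be frozen: the downlink bound freezes the relay noise, and the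
    uplink bound freezes the users' noise by the symmetric statement. *)
Lemma sum_product_le_xsection (W : finType) (P : pred W) (C : W -> set (X1 * X2)) (k : R) :
  (forall w, P w -> measurable (C w)) ->
  (forall x, \sum_(w | P w) P2 (xsection (C w) x) <= k%:E)%E ->
  (\sum_(w | P w) (P1 \x P2) (C w) <= k%:E)%E.
Proof.
(* Padding with the empty set makes every member of the family measurable, as exchanging sum and
   integral requires. *)
move=> mC Ck; pose D w := if P w then C w else set0.
have mD w : measurable (D w) by rewrite /D; case: ifPn => // /mC.
rewrite (eq_bigr (fun w => \int[P1]_x P2 (xsection (D w) x))%E); last first.
  by move=> w Pw; rewrite /D Pw.
rewrite -big_filter -ge0_integral_sum//; last first.
  by move=> w; apply: measurable_fun_xsection.
apply: (@le_trans _ _ (\int[P1]_x k%:E)%E).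
  apply: ge0_le_integral => //.
  - by move=> x _; apply: sume_ge0.
  - by apply: emeasurable_sum => w; apply: measurable_fun_xsection.
  - move=> x _; rewrite big_filter /=.
    by rewrite (eq_bigr (fun w => P2 (xsection (C w) x)))// => w Pw; rewrite /D Pw.
by rewrite integral_cst//= [P1 _]probability_setT mule1.
Qed.

Lemma sum_product_le_ysection (W : finType) (P : pred W) (C : W -> set (X1 * X2)) (k : R) :
  (forall w, P w -> measurable (C w)) ->
  (forall y, \sum_(w | P w) P1 (ysection (C w) y) <= k%:E)%E ->
  (\sum_(w | P w) (P1 \x P2) (C w) <= k%:E)%E.
Proof.
move=> mC Ck; pose D w := if P w then C w else set0.
have mD w : measurable (D w) by rewrite /D; case: ifPn => // /mC.
rewrite (eq_bigr (fun w => \int[P2]_y P1 (ysection (D w) y))%E); last first.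
  by move=> w Pw; rewrite /D Pw product_measure_ysection//; exact: mC.
rewrite -big_filter -ge0_integral_sum//; last first.
  by move=> w; apply: measurable_fun_ysection.
apply: (@le_trans _ _ (\int[P2]_y k%:E)%E).
  apply: ge0_le_integral => //.
  - by move=> x _; apply: sume_ge0.
  - by apply: emeasurable_sum => w; apply: measurable_fun_ysection.
  - move=> x _; rewrite big_filter /=.
    by rewrite (eq_bigr (fun w => P1 (ysection (C w) x)))// => w Pw; rewrite /D Pw.
by rewrite integral_cst//= [P2 _]probability_setT mule1.
Qed.
End SumSections.

Section ShiftedGaussian.
Context {R : realType}.
Local Notation T := (measurableTypeR R).

Definition tshift n (x : nat -> R) (t : n.-tuple T) : n.-tuple T :=
  [tuple shift (x i) (tnth t i) | i < n].

(* The variance is enlarged only along the coordinates in [a], so that the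
   others do not enter the constant. *)
Lemma sum_gauss_shift_le n (s v E : R) (W : finType) (P : pred W)
    (C D : W -> set (n.-tuple T)) (x : W -> nat -> R) (a : pred nat) :
  0 < s -> 0 < v ->
  (forall w, P w -> measurable (C w)) ->
  (forall w t, P w -> C w t <-> D w (tshift (x w) t)) ->
  (forall w w' t, P w -> P w' -> D w t -> D w' t -> w = w') ->
  (forall w i, P w -> ~~ a i -> x w i = 0) ->
  (forall w, P w -> \sum_(i < n) x w i ^+ 2 <= E) ->
  (\sum_(w | P w) tprob n (fun=> normal_prob 0 s) (C w) <=
    (Num.sqrt (1 + v) ^+ #|[pred i : 'I_n | a i]| *
     expR (E / (2 * (v * s ^+ 2))))%:E)%E.
Proof.
move=> s0 v0 mC CD dD x0 xE.
(* A shift is invertible, so [D w] is the preimage of [C w] under the opposite shift. *)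
have mD w : P w -> measurable (D w).
  move=> Pw; rewrite (_ : D w = [set t | C w (tshift (fun i => - x w i) t)]).
    apply: (measurable_tuple_map (f := fun i => shift (- x w i))) (mC _ Pw) => i.
    exact: measurable_shift.
  apply/seteqP; split => t /=; rewrite CD// (_ : tshift _ _ = t)//;
    by apply: eq_from_tnth => i; rewrite !tnth_mktuple /shift subrK.
pose q (i : nat) : probability T R :=
  normal_prob 0 (if a i then s * Num.sqrt (1 + v) else s).
set K := Num.sqrt (1 + v) ^+ _ * _.
have K0 : 0 <= K by rewrite mulr_ge0 ?exprn_ge0 ?sqrtr_ge0 ?expR_ge0.
(* The dominating law [q] is the same for all [w], so the disjoint sets [D w] have total mass at
   most 1 under it. *)
apply: (@le_trans _ _ (\sum_(w | P w) K%:E * tprob n q (D w))%E); last first.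
  rewrite -ge0_sume_distrr//.
  rewrite -[leRHS]mule1; apply: lee_wpmul2l => //.
  exact: sum_probability_disjoint_le1.
apply: lee_sum => w Pw.
pose k i := (if a i then Num.sqrt (1 + v) else 1) *
  expR (x w i ^+ 2 / (2 * (v * s ^+ 2))).
have k0 i : 0 <= k i by rewrite mulr_ge0 ?expR_ge0//; case: ifP; rewrite ?sqrtr_ge0.
have hk i B : measurable B ->
    (normal_prob 0 s (shift (x w i) @^-1` B) <= (k i)%:E * q i B)%E.
  move=> mB; rewrite /k /q; case: ifPn => ai; first exact: normal_prob_shift_le.
  rewrite (x0 w i)// expr0n /= mul0r expR0 mulr1 mul1e.
  by rewrite (_ : _ @^-1` B = B)//; apply/seteqP; split => y /=; rewrite /shift addr0.
have := @tprob_dominated _ T R n (fun=> normal_prob 0 s) q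
  (fun i => shift (x w i)) k (D w) (fun i => measurable_shift (x w i)) k0 hk (mD _ Pw).
move=> h; apply: (@le_trans _ _ ((\prod_(i < n) k i)%:E * tprob n q (D w))%E).
  apply: le_trans h; rewrite (_ : C w = [set t | D w (tshift (x w) t)])//.
  by apply/seteqP; split => t /=; rewrite CD.
apply: lee_wpmul2r => //; rewrite lee_fin /k /K big_split /=.
rewrite -big_mkcond /= prodr_const.
rewrite ler_wpM2l ?exprn_ge0 ?sqrtr_ge0// -expR_sum ler_expR -mulr_suml.
by rewrite ler_wpM2r ?xE// invr_ge0 !mulr_ge0 ?sqr_ge0// ltW.
Qed.
End ShiftedGaussian.

(** * Energies of signals *)

Section Energy.
Context {R : realType}.
Local Notation C := R[i].

(** Squared modulus and, next, squared Frobenius norm, both with values in [R]: [avg_power] lives in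
    [R[i]], whose order is only partial. *)
Definition nsq (z : C) : R := complex.Re z ^+ 2 + complex.Im z ^+ 2.
Definition fro m n (A : 'M[C]_(m, n)) : R := \sum_(i < m) \sum_(j < n) nsq (A i j).

Lemma nsq_ge0 z : 0 <= nsq z.
Proof. by rewrite addr_ge0 ?sqr_ge0. Qed.

Lemma nsqM y z : nsq (y * z) = nsq y * nsq z.
Proof. by case: y z => [a b] [c e]; rewrite /nsq /=; ring. Qed.

Lemma sqr_sum_le (J : finType) (x : J -> R) :
  (\sum_j x j) ^+ 2 <= #|J|%:R * \sum_j x j ^+ 2.
Proof.
have : 0 <= \sum_i \sum_j (x i - x j) ^+ 2.
  by apply: sumr_ge0 => i _; apply: sumr_ge0 => j _; exact: sqr_ge0.
have -> : \sum_i \sum_j (x i - x j) ^+ 2 =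
    2 * (#|J|%:R * \sum_j x j ^+ 2) - 2 * (\sum_j x j) ^+ 2.
  transitivity (\sum_i (#|J|%:R * x i ^+ 2 + \sum_j x j ^+ 2 - 2 * x i * \sum_j x j)).
    apply: eq_bigr => i _; rewrite mulr_sumr mulr_natl -sumr_const -big_split -sumrB /=.
    by apply: eq_bigr => j _; ring.
  rewrite sumrB big_split /= -mulr_sumr sumr_const -mulr_suml -mulr_sumr -[_ *+ #|J|]mulr_natl.
  by ring.
by lra.
Qed.

Lemma nsq_sum_le (J : finType) (z : J -> C) :
  nsq (\sum_j z j) <= #|J|%:R * \sum_j nsq (z j).
Proof.
have ReS (s : seq J) : complex.Re (\sum_(j <- s) z j) = \sum_(j <- s) complex.Re (z j).
  by elim: s => [|j s IH]; rewrite ?big_nil// !big_cons -IH; case: (z j) (\sum_(j <- s) _) => [a b] [].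
have ImS (s : seq J) : complex.Im (\sum_(j <- s) z j) = \sum_(j <- s) complex.Im (z j).
  by elim: s => [|j s IH]; rewrite ?big_nil// !big_cons -IH; case: (z j) (\sum_(j <- s) _) => [a b] [].
by rewrite /nsq ReS ImS big_split mulrDr lerD// sqr_sum_le.
Qed.

Lemma fro_ge0 m n (A : 'M[C]_(m, n)) : 0 <= fro A.
Proof. by apply: sumr_ge0 => i _; apply: sumr_ge0 => j _; exact: nsq_ge0. Qed.

(** The factor [n] is wasteful, but factors independent of the SNR do not affect degrees of
    freedom. *)
Lemma fro_mulmx m n p (A : 'M[C]_(m, n)) (B : 'M[C]_(n, p)) :
  fro (A *m B) <= n%:R * fro A * fro B.
Proof.
pose a j := \sum_(i < m) nsq (A i j); pose b j := \sum_(t < p) nsq (B j t).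
have b0 j : 0 <= b j by apply: sumr_ge0 => i _; exact: nsq_ge0.
apply: (@le_trans _ _ (n%:R * \sum_(j < n) a j * b j)).
  have -> : \sum_(j < n) a j * b j = \sum_(i < m) \sum_(t < p) \sum_(j < n) nsq (A i j) * nsq (B j t).
    under eq_bigr do rewrite mulr_suml.
    rewrite exchange_big /=; apply: eq_bigr => i _; rewrite exchange_big /=.
    by apply: eq_bigr => j _; rewrite /b mulr_sumr.
  rewrite mulr_sumr; apply: ler_sum => i _; rewrite mulr_sumr; apply: ler_sum => t _.
  rewrite mxE; apply: le_trans (nsq_sum_le _) _; rewrite card_ord.
  by rewrite ler_wpM2l// ler_sum// => j _; rewrite nsqM.
rewrite -mulrA ler_wpM2l// [X in X * _](_ : fro A = \sum_(j < n) a j) ?mulr_suml; last first.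
  by rewrite /fro exchange_big.
apply: ler_sum => j _; rewrite ler_wpM2l//; first by apply: sumr_ge0 => i _; exact: nsq_ge0.
rewrite /fro (bigD1 j)//= lerDl; apply: sumr_ge0 => i _.
by apply: sumr_ge0 => t _; exact: nsq_ge0.
Qed.

Lemma fro_sum_le m n (J : finType) (A : J -> 'M[C]_(m, n)) :
  fro (\sum_j A j) <= #|J|%:R * \sum_j fro (A j).
Proof.
rewrite mulr_sumr /fro.
have -> : \sum_j #|J|%:R * (\sum_(i < m) \sum_(t < n) nsq (A j i t)) =
    \sum_(i < m) \sum_(t < n) #|J|%:R * \sum_j nsq (A j i t).
  under eq_bigr do rewrite mulr_sumr; rewrite exchange_big /=; apply: eq_bigr => i _.
  under eq_bigr do rewrite mulr_sumr; rewrite exchange_big /=; apply: eq_bigr => t _.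
  by rewrite mulr_sumr.
by apply: ler_sum => i _; apply: ler_sum => t _; rewrite summxE; exact: nsq_sum_le.
Qed.

Lemma avg_powerE m T (X : 'M[C]_(m, T)) : avg_power X = ((T%:R^-1 * fro X)%:C)%C.
Proof.
rewrite /avg_power rmorphM /= fmorphV /= rmorph_nat; congr (_ * _).
rewrite /mxtrace /fro rmorph_sum; apply: eq_bigr => i _.
rewrite mxE rmorph_sum; apply: eq_bigr => j _; rewrite !mxE.
case: (X i j) => a b; rewrite /nsq /=; apply/eqP; rewrite eq_complex /=.
by apply/andP; split; apply/eqP; ring.
Qed.

Lemma avg_power_le m T (X : 'M[C]_(m, T)) (P : R) : (0 < T)%N ->
  (avg_power X <= (P%:C)%C) = (fro X <= T%:R * P).
Proof.
by move=> T0; rewrite avg_powerE lecR mulrC ler_pdivrMr ?ltr0n// mulrC.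
Qed.
End Energy.

Section IndexedTuples.
Context {R : realType} {J : finType}.
Local Notation X := (measurableTypeR R).

(** Tuple measures and shifts take families indexed by [nat]; a family over [J] is transported along
    the enumeration of [J] and padded with 0. *)
Definition ext_rank (g : J -> R) (i : nat) : R :=
  if insub i is Some r then g (enum_val (r : 'I_#|J|)) else 0.

Definition ext_rank_pred (a : pred J) (i : nat) : bool :=
  if insub i is Some r then a (enum_val (r : 'I_#|J|)) else false.

Lemma ext_rankE g (r : 'I_#|J|) : ext_rank g r = g (enum_val r).
Proof. by rewrite /ext_rank valK. Qed.

Lemma tnth_tshift_rank g (t : #|J|.-tuple X) j :
  tnth (tshift (ext_rank g) t) (enum_rank j) = tnth t (enum_rank j) + g j.
Proof. by rewrite tnth_mktuple /shift ext_rankE enum_rankK. Qed.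

Lemma sum_ext_rank g (h : R -> R) :
  \sum_(i < #|J|) h (ext_rank g i) = \sum_j h (g j).
Proof.
rewrite [RHS](reindex (fun i : 'I_#|J| => enum_val i)) /=; last first.
  by apply: onW_bij; exact: enum_val_bij.
by apply: eq_bigr => i _; rewrite ext_rankE.
Qed.

Lemma card_ext_rank_pred (a : pred J) :
  #|[pred i : 'I_#|J| | ext_rank_pred a i]| = #|a|.
Proof.
rewrite -[LHS]sum1_card -[RHS]sum1_card [RHS](reindex (fun i : 'I_#|J| => enum_val i)) /=; last first.
  by apply: onW_bij; exact: enum_val_bij.
by apply: eq_bigl => i; rewrite inE /ext_rank_pred valK.
Qed.

Lemma prod_rank (V : pointedType) (f : set V -> R) (B : J -> set V) :
  \prod_(i < #|J|) f ((if insub (val i) is Some r then B (enum_val (r : 'I_#|J|)) else setT))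
  = \prod_j f (B j).
Proof.
rewrite [RHS](reindex (fun i : 'I_#|J| => enum_val i)) /=; last first.
  by apply: onW_bij; exact: enum_val_bij.
by apply: eq_bigr => i _; rewrite valK.
Qed.

End IndexedTuples.

(** * A concrete Gaussian noise model *)

Section CanonicalNoise.
Context {R : realType} (K M N T : nat) (sigma2 : R).
Local Notation X := (measurableTypeR R).

Definition relay_idx : finType := ('I_N * 'I_T * bool)%type.
Definition user_idx : finType := ('I_K * 'I_M * 'I_T * bool)%type.

Definition matR (t : #|relay_idx|.-tuple X) : 'M[R[i]]_(N, T) :=
  \matrix_(i < N, j < T) (tnth t (enum_rank ((i, j, false) : relay_idx)) +i*
                          tnth t (enum_rank ((i, j, true) : relay_idx)))%C.
Definition matZ (k : 'I_K) (t : #|user_idx|.-tuple X) : 'M[R[i]]_(M, T) :=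
  \matrix_(i < M, j < T) (tnth t (enum_rank ((k, i, j, false) : user_idx)) +i*
                          tnth t (enum_rank ((k, i, j, true) : user_idx)))%C.

(** Relay noise and users' noise form two separate factors, so that either can be frozen. *)
Definition noise_space := (#|relay_idx|.-tuple X * #|user_idx|.-tuple X)%type.

Let sd := Num.sqrt (sigma2 / 2).
Definition gaussT n : probability (n.-tuple X) R := tprob n (fun=> normal_prob 0 sd).
Definition canonical_prob : probability noise_space R :=
  (gaussT #|relay_idx| \x gaussT #|user_idx|)%E.

Lemma gaussT_rect (J : finType) (B : J -> set X) : (forall j, measurable (B j)) ->
  fine (gaussT #|J| [set t | forall j, B j (tnth t (enum_rank j))]) =
  \prod_j fine (normal_prob 0 sd (B j)).
Proof.
move=> mB; pose B' (i : nat) : set X :=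
  if insub i is Some r then B (enum_val (r : 'I_#|J|)) else setT.
have mB' i : measurable (B' i) by rewrite /B'; case: insub => [r|]//; exact: mB.
rewrite (_ : [set t | _] = [set t | forall i : 'I_#|J|, B' i (tnth t i)]).
  rewrite /gaussT (tprob_rect _ (fun=> normal_prob 0 sd) mB') -(prod_rank (fine \o normal_prob 0 sd)).
  rewrite (eq_bigr (fun i : 'I_#|J| => (fine (normal_prob 0 sd (B' i)))%:E)).
    by rewrite prodEFin.
  by move=> i _; rewrite fineK//; apply: fin_num_measure.
apply/seteqP; split => t /= h i.
  by rewrite /B' valK; have := h (enum_val i); rewrite enum_valK.
by have := h (enum_rank i); rewrite /B' valK enum_rankK.
Qed.

(** Supplies the noise model at which the hypothesis of achievability is instantiated in the
    converse. *)
Lemma canonical_gaussian :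
  gaussian_noise sigma2 canonical_prob (matR \o fst) (fun k => matZ k \o snd).
Proof.
split.
  move=> [[[i j]|[[k i] j]] b] /=.
  - rewrite (_ : noise_comp _ _ _ = (fun t => tnth t (enum_rank ((i, j, b) : relay_idx))) \o fst).
      apply: (@measurableT_comp _ _ _ _ _ X (fun t : #|relay_idx|.-tuple X => tnth t _)) => //.
      exact: measurable_tnth.
    by apply/funext => o; rewrite /noise_comp /= !mxE; case: b.
  - rewrite (_ : noise_comp _ _ _ = (fun t => tnth t (enum_rank ((k, i, j, b) : user_idx))) \o snd).
      apply: (@measurableT_comp _ _ _ _ _ X (fun t : #|user_idx|.-tuple X => tnth t _)) => //.
      exact: measurable_tnth.
    by apply/funext => o; rewrite /noise_comp /= !mxE; case: b.
move=> B mB.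
pose B1 (j : relay_idx) := B (inl j.1, j.2).
pose B2 (j : user_idx) := B (inr j.1, j.2).
pose A1 := [set t | forall j, B1 j (tnth t (enum_rank j))].
pose A2 := [set t | forall j, B2 j (tnth t (enum_rank j))].
have mA (J : finType) (B' : J -> set X) : (forall j, measurable (B' j)) ->
    measurable [set t : #|J|.-tuple X | forall j, B' j (tnth t (enum_rank j))].
  move=> mB'; rewrite [X in measurable X](_ : _ =
    \bigcap_(j in [set: J]) [set t : #|J|.-tuple X | B' j (tnth t (enum_rank j))]); last first.
    by apply/seteqP; split => [t h j _|t h j]; [exact: h|exact: (h j I)].
  apply: fin_bigcap_measurable => // j _.
  by rewrite -[X in measurable X]setTI; apply: measurable_tnth.
rewrite (_ : [set o | _] = A1 `*` A2); last first.
  apply/seteqP; split => o /=.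
    move=> h; split => [[[i j] b]|[[[k i] j] b]].
      by have := h (inl (i, j), b); rewrite /noise_comp /= mxE /B1 /=; case: b.
    by have := h (inr (k, i, j), b); rewrite /noise_comp /= mxE /B2 /=; case: b.
  move=> [h1 h2] [[[i j]|[[k i] j]] b].
    by have := h1 (i, j, b); rewrite /noise_comp /= mxE /B1 /=; case: b.
  by have := h2 (k, i, j, b); rewrite /noise_comp /= mxE /B2 /=; case: b.
have mB1 j : measurable (B1 j) by exact: mB.
have mB2 j : measurable (B2 j) by exact: mB.
have -> : canonical_prob (A1 `*` A2) = (gaussT _ A1 * gaussT _ A2)%E.
  by apply: product_measure1E; exact: mA.
rewrite fineM ?fin_num_measure//; [|exact: mA|exact: mA].
rewrite !gaussT_rect//.
rewrite [RHS](eq_bigr (fun j : noise_idx K M N T => fine (normal_prob 0 sd (B (j.1, j.2))))); last by case.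
rewrite -(pair_bigA _ (fun a b => fine (normal_prob 0 sd (B (a, b))))) /= big_sumType /=.
by rewrite !pair_bigA.
Qed.

Lemma matR_shift (A : 'M[R[i]]_(N, T)) t :
  matR (tshift (ext_rank (fun j : relay_idx => cpart j.2 (A j.1.1 j.1.2))) t) = A + matR t.
Proof.
apply/matrixP => i j; rewrite !mxE !tnth_tshift_rank /=.
by case: (A i j) => a b; rewrite addrC; apply/eqP; rewrite eq_complex /= !eqxx.
Qed.

(** The shift is supported on the coordinates of user [k], so only its [M] antennas are charged for
    the enlarged variance. *)
Lemma matZ_shift k (A : 'M[R[i]]_(M, T)) t :
  matZ k (tshift (ext_rank (fun j : user_idx =>
    if j.1.1.1 == k then cpart j.2 (A j.1.1.2 j.1.2) else 0)) t) = A + matZ k t.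
Proof.
apply/matrixP => i j; rewrite !mxE !tnth_tshift_rank /= eqxx.
by case: (A i j) => a b; rewrite addrC; apply/eqP; rewrite eq_complex /= !eqxx.
Qed.

Lemma energy_relay (A : 'M[R[i]]_(N, T)) :
  \sum_(i < #|relay_idx|) ext_rank (fun j : relay_idx => cpart j.2 (A j.1.1 j.1.2)) i ^+ 2 = fro A.
Proof.
rewrite (sum_ext_rank _ (fun y => y ^+ 2)).
rewrite -(pair_bigA _ (fun p b => cpart b (A p.1 p.2) ^+ 2)) /=.
rewrite -(pair_bigA _ (fun i j => \sum_b cpart b (A i j) ^+ 2)) /=.
by apply: eq_bigr => i _; apply: eq_bigr => j _; rewrite big_bool /= addrC.
Qed.

Lemma energy_user k (A : 'M[R[i]]_(M, T)) :
  \sum_(i < #|user_idx|) ext_rank (fun j : user_idx =>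
    if j.1.1.1 == k then cpart j.2 (A j.1.1.2 j.1.2) else 0) i ^+ 2 = fro A.
Proof.
rewrite (sum_ext_rank _ (fun y => y ^+ 2)).
rewrite -(pair_bigA _ (fun p b => (if p.1.1 == k then cpart b (A p.1.2 p.2) else 0) ^+ 2)) /=.
rewrite -(pair_bigA _ (fun p j => \sum_b (if p.1 == k then cpart b (A p.2 j) else 0) ^+ 2)) /=.
rewrite -(pair_bigA _ (fun k' i => \sum_j \sum_b (if k' == k then cpart b (A i j) else 0) ^+ 2)) /=.
rewrite (bigD1 k)//= [X in _ + X]big1 ?addr0; last first.
  move=> k' /negPf ->; rewrite big1// => i _; rewrite big1// => j _.
  by rewrite big_bool /= expr0n /= addr0.
apply: eq_bigr => i _; apply: eq_bigr => j _.
by rewrite big_bool /= eqxx addrC.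
Qed.
End CanonicalNoise.

(** * Upper bounds on achievable rates *)

Section MessageCounting.
Context {R : realType} {K : nat} (n : 'I_K -> 'I_K -> nat).
Hypothesis n_gt0 : forall p : 'I_K * 'I_K, (0 < n p.1 p.2)%N.

Lemma card_msg_split (S : pred ('I_K * 'I_K)) :
  #|{: msg n}| = (\prod_(p | S p) n p.1 p.2 * \prod_(p | ~~ S p) n p.1 p.2)%N.
Proof.
rewrite card_dep_ffun foldrE big_map big_enum /= (bigID S) /=.
by congr (_ * _)%N; apply: eq_bigr => p _; rewrite card_ord.
Qed.

(** Tuples are sorted by their components outside [S], with [proj] choosing a representative of each
    class; the number of classes is the product of the alphabet sizes outside [S]. *)
Lemma sum_msg_classes_le (S : pred ('I_K * 'I_K)) (f : msg n -> R) (kappa : R) :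
  (forall P : pred (msg n),
     (forall w w', P w -> P w' -> forall p, ~~ S p -> w p = w' p) ->
     \sum_(w | P w) f w <= kappa) ->
  \sum_w f w <= kappa * (\prod_(p | ~~ S p) n p.1 p.2)%N%:R.
Proof.
move=> fk; pose w0 p : 'I_(n p.1 p.2) := Ordinal (n_gt0 p).
pose proj (w : msg n) : msg n := finfun (fun p => if S p then w0 p else w p).
pose F p : pred 'I_(n p.1 p.2) := if S p then pred1 (w0 p) else predT.
pose Q : pred (msg n) := fun a => a \in family F.
rewrite (partition_big proj Q) /=; last first.
  by move=> w _; apply/(@familyP _ _ _ F) => p; rewrite ffunE /F unfold_in; case: (S p) => //=.
apply: (@le_trans _ _ (\sum_(a | Q a) kappa)).
  apply: ler_sum => a _; apply: fk => w w' /eqP <- /eqP e p /negPf Sp.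
  by have := congr1 (fun g : msg n => g p) e; rewrite /proj !ffunE Sp.
rewrite sumr_const (_ : #|Q| = (\prod_(p | ~~ S p) n p.1 p.2)%N) ?mulr_natr//.
rewrite (card_family F : #|Q| = _) foldrE big_map big_enum /= [RHS]big_mkcond /=.
apply: eq_bigr => p _; rewrite /F; case: (S p) => /=; first exact: card1.
by rewrite cardT -cardE card_ord.
Qed.

(** By the union bound all of [S] is decoded with average probability at least 1/2. Half the number
    of tuples is thus at most [kappa] times the number of classes, and the alphabets outside [S]
    cancel. *)
Lemma prod_decoded_le (S : pred ('I_K * 'I_K)) (f : msg n -> R)
    (e : 'I_K * 'I_K -> msg n -> R) (eps kappa : R) :
  (forall w, 1 - \sum_(p | S p) e p w <= f w) ->
  (forall p, S p -> #|{: msg n}|%:R^-1 * \sum_w e p w <= eps) ->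
  #|S|%:R * eps <= 1 / 2 ->
  (forall P : pred (msg n),
     (forall w w', P w -> P w' -> forall p, ~~ S p -> w p = w' p) ->
     \sum_(w | P w) f w <= kappa) ->
  (\prod_(p | S p) n p.1 p.2)%N%:R <= 2 * kappa.
Proof.
move=> ef eeps Seps fk; have /= sf := sum_msg_classes_le fk.
have cm := card_msg_split S.
set a := (\prod_(p | S p) n p.1 p.2)%N in cm *.
set b := (\prod_(p | ~~ S p) n p.1 p.2)%N in cm sf *.
have b0 : 0 < b%:R :> R by rewrite ltr0n; apply: prodn_gt0 => p; exact: n_gt0.
have a0 : 0 < a%:R :> R by rewrite ltr0n; apply: prodn_gt0 => p; exact: n_gt0.
rewrite -(ler_pM2r b0) -mulrA; apply: le_trans (ler_wpM2l _ sf); last by [].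
have mE : #|{: msg n}|%:R = a%:R * b%:R :> R by rewrite cm natrM.
have m0 : 0 < #|{: msg n}|%:R :> R by rewrite mE mulr_gt0.
apply: (@le_trans _ _ (2 * \sum_w (1 - \sum_(p | S p) e p w))); last first.
  by rewrite ler_wpM2l// ler_sum.
rewrite sumrB sumr_const exchange_big /=.
have : \sum_(p | S p) \sum_w e p w <= \sum_(p | S p) eps * #|{: msg n}|%:R.
  apply: ler_sum => p Sp; have := eeps p Sp.
  by rewrite mulrC ler_pdivrMr.
rewrite sumr_const -[X in _ <= X]mulr_natl mulrA => h.
have h2 : #|S|%:R * eps * #|{: msg n}|%:R <= 1 / 2 * #|{: msg n}|%:R by rewrite ler_pM2r.
rewrite -mE; have := le_trans h h2; lra.
Qed.
End MessageCounting.

Section UnionBound.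
Context {d : measure_display} {X : measurableType d} {R : realType}.
Variable Pr : probability X R.

Lemma probability_bigsetU_le (I : Type) (s : seq I) (S : pred I) (E : I -> set X) :
  (forall i, S i -> measurable (E i)) ->
  (Pr (\big[setU/set0]_(i <- s | S i) E i) <= \sum_(i <- s | S i) Pr (E i))%E.
Proof.
move=> mE; elim: s => [|i s IH]; first by rewrite !big_nil measure0.
rewrite !big_cons; case: ifPn => // Si.
apply: le_trans (measureU2 _ _ _) _.
- exact: mE.
- exact: bigsetU_measurable.
- exact: leeD2l.
Qed.

Lemma probability_setC_bigsetU_ge (I : finType) (S : pred I) (E : I -> set X) :
  (forall i, S i -> measurable (E i)) ->
  1 - \sum_(i | S i) fine (Pr (E i)) <= fine (Pr (~` \big[setU/set0]_(i | S i) E i)).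
Proof.
move=> mE; have mU := bigsetU_measurable (index_enum I) mE.
rewrite probability_setC// fineB ?fin_num_measure//= lerD2l lerN2.
rewrite -lee_fin fineK ?fin_num_measure// (le_trans (probability_bigsetU_le _ mE))//.
rewrite -sumEFin; apply: lee_sum => i Si; rewrite fineK// fin_num_measure//; exact: mE.
Qed.
End UnionBound.

(** * Counting bounds for a single code *)

Section CodeBounds.
Context {R : realType} {K M N T : nat} {n : 'I_K -> 'I_K -> nat}.
Context (H : 'I_K -> 'M[R[i]]_(N, M)) (G : 'I_K -> 'M[R[i]]_(M, N)).
Context (sigma2 snr eps : R) (c : @Defs.code R K M N T n).
Hypotheses (sigma2_gt0 : 0 < sigma2) (snr_gt0 : 0 < snr) (T_gt0 : (0 < T)%N).
Hypothesis cP : code_valid (snr * sigma2) c.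
Hypothesis n_gt0 : forall p : 'I_K * 'I_K, (0 < n p.1 p.2)%N.

Local Notation Pr := (@canonical_prob R K M N T sigma2).
Local Notation ZR := (@matR R N T \o fst : noise_space K M N T -> _).
Local Notation Z := ((fun k => @matZ R K M T k \o snd) : 'I_K -> noise_space K M N T -> _).
Local Notation err p w := (err_event H G c ZR Z p.1 p.2 w).

Definition correct (S : pred ('I_K * 'I_K)) w := ~` \big[setU/set0]_(p | S p) err p w.

Lemma correctP S w o : correct S w o <-> forall p, S p ->
  dec c p.2 (user_rx H G c w (ZR o) p.2 (Z p.2 o)) w p = w p.
Proof.
rewrite /correct -bigcup_pred; split=> [h p Sp|h [[k k'] /= Sp]].
  by apply/eqP; apply: contra_notT h => hp; exists p => //; case: p Sp hp.
by apply/negP; rewrite negbK; apply/eqP; exact: (h _ Sp).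
Qed.

Section DecodedSet.
Variable S : pred ('I_K * 'I_K).
Hypothesis S_meas : forall p w, S p -> measurable (err p w).
Hypothesis S_err : forall p, S p -> err_prob H G c Pr ZR Z p.1 p.2 <= eps.
Hypothesis S_eps : #|S|%:R * eps <= 1 / 2.

Lemma measurable_correct w : measurable (correct S w).
Proof. by apply: measurableC; apply: bigsetU_measurable => p; exact: S_meas. Qed.

Lemma decoded_prod_le (kappa : R) :
  (forall P : pred (msg n),
     (forall w w', P w -> P w' -> forall p, ~~ S p -> w p = w' p) ->
     (\sum_(w | P w) Pr (correct S w) <= kappa%:E)%E) ->
  (\prod_(p | S p) n p.1 p.2)%N%:R <= 2 * kappa.
Proof.
move=> h; have mok := measurable_correct.
apply: (prod_decoded_le n_gt0 (f := fun w => fine (Pr (correct S w)))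
  (e := fun p w => fine (Pr (err p w))) _ S_err S_eps).
  by move=> w; apply: probability_setC_bigsetU_ge => p; exact: S_meas.
move=> P PS; rewrite -lee_fin -sumEFin.
rewrite (eq_bigr (fun w => Pr (correct S w))); first exact: h.
by move=> w _; rewrite fineK// fin_num_measure.
Qed.

(** With the relay noise and the messages outside [S] frozen, user [k'] sees its own noise shifted
    by a vector depending on the message. No pair with source [k'] lies in [S], so its side
    information is constant on a class and the decoding regions are disjoint. *)
Lemma downlink_prod_le (k' : 'I_K) :
  S =1 (fun p => (p.2 == k') && (p.1 != k')) ->
  (\prod_(p | S p) n p.1 p.2)%N%:R <=
    2 * (Num.sqrt (1 + snr) ^+ (M * T * 2) * expR (N%:R * fro (G k') * T%:R)).
Proof.
move=> SE; have s0 : 0 < Num.sqrt (sigma2 / 2) by rewrite sqrtr_gt0 divr_gt0.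
apply: decoded_prod_le => P PS.
apply: sum_product_le_xsection => [w _|t1]; first exact: measurable_correct.
pose A w := G k' *m relay c (relay_rx H c w (matR t1)).
pose x w := ext_rank (fun j : user_idx K M T =>
    if j.1.1.1 == k' then cpart j.2 (A w j.1.1.2 j.1.2) else 0).
pose a := ext_rank_pred (fun j : user_idx K M T => j.1.1.1 == k').
pose D w : set (#|user_idx K M T|.-tuple (measurableTypeR R)) :=
  [set t | forall p, S p -> dec c k' (matZ k' t) w p = w p].
have := @sum_gauss_shift_le R _ (Num.sqrt (sigma2 / 2)) snr
  (N%:R * fro (G k') * (T%:R * (snr * sigma2))) _ P
  (fun w => xsection (correct S w) t1) D x a s0 snr_gt0.
rewrite card_ext_rank_pred (_ : #|_| = (M * T * 2)%N); last first.
  transitivity #|[set (k', i.1.1, i.1.2, i.2) | i : 'I_M * 'I_T * bool]|.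
    apply: eq_card => -[[[k i] j] b]; rewrite unfold_in /=.
    apply/eqP/imsetP => [->|[[[i' j'] b'] _ /= [-> _ _ _]]//].
    by exists (i, j, b).
  rewrite card_imset ?card_prod ?card_ord ?card_bool// => -[[i j] b] [[i' j'] b'] /=.
  by case=> -> -> ->.
(* This is the reason for the enlargement [v = snr]: [2 * v * s ^+ 2] equals [snr * sigma2], so the
   SNR drops out of the exponent. *)
rewrite (_ : N%:R * fro (G k') * _ / _ = N%:R * fro (G k') * T%:R); last first.
  rewrite sqr_sqrtr ?divr_ge0 ?ltW//; field.
  by rewrite !gt_eqF.
apply.
- by move=> w _; apply: measurable_xsection; exact: measurable_correct.
- move=> w t Pw; rewrite /xsection /= inE; rewrite correctP /D /= matZ_shift.
  split=> h [k q] Sp; have := h _ Sp; move: (Sp); rewrite SE /= => /andP[/eqP q2 _];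
    by subst q.
- move=> w w' t Pw Pw' Dw Dw'; apply/ffunP => p.
  have [Sp|nSp] := boolP (S p); last exact: PS.
  rewrite -Dw// -Dw'//; case: cP => _ hdec _ _ _.
  rewrite (hdec k' (matZ k' t) w w')// => k.
  by apply: PS => //; rewrite SE /= eqxx andbF.
- move=> w i _; rewrite /a /x /ext_rank_pred /ext_rank.
  by case: insub => // r /negPf ->.
- move=> w _; rewrite /x energy_user.
  apply: le_trans (fro_mulmx _ _) _; rewrite ler_wpM2l ?mulr_ge0 ?fro_ge0//.
  by case: cP => _ _ _ + _; move=> /(_ (relay_rx H c w (matR t1))); rewrite avg_power_le.
Qed.

(** Once the users' noise is frozen, every received signal is a function of what the relay receives.
    The decoders of [i] and [j] can then be run on the same data, however few antennas a user
    has. *)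
Lemma uplink_prod_le (i j l : 'I_K) : i != j -> i != l -> j != l ->
  S =1 (fun p => p \in [:: (j, i); (l, i); (l, j)]) ->
  (\prod_(p | S p) n p.1 p.2)%N%:R <=
    2 * (Num.sqrt (1 + snr) ^+ (N * T * 2) *
      expR (K%:R * M%:R * (\sum_k fro (H k)) * T%:R)).
Proof.
move=> ij il jl SE; have s0 : 0 < Num.sqrt (sigma2 / 2) by rewrite sqrtr_gt0 divr_gt0.
apply: decoded_prod_le => P PS.
apply: sum_product_le_ysection => [w _|t2]; first exact: measurable_correct.
pose A w := \sum_(k < K) (H k *m enc c k w).
pose x w := ext_rank (fun j : relay_idx N T => cpart j.2 (A w j.1.1 j.1.2)).
pose D w : set (#|relay_idx N T|.-tuple (measurableTypeR R)) :=
  [set t | forall p, S p -> dec c p.2 (G p.2 *m relay c (matR t) + matZ p.2 t2) w p = w p].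
have := @sum_gauss_shift_le R _ (Num.sqrt (sigma2 / 2)) snr
  (K%:R * M%:R * (\sum_k fro (H k)) * (T%:R * (snr * sigma2))) _ P
  (fun w => ysection (correct S w) t2) D x (ext_rank_pred (fun r : relay_idx N T => r == r)) s0 snr_gt0.
rewrite card_ext_rank_pred.
have -> : #|(fun r : relay_idx N T => r == r)| = (N * T * 2)%N.
  transitivity #|{: relay_idx N T}|; first by apply: eq_card => r; rewrite unfold_in /= eqxx.
  by rewrite !card_prod !card_ord card_bool.
rewrite (_ : _ * _ / _ = K%:R * M%:R * (\sum_k fro (H k)) * T%:R); last first.
  rewrite sqr_sqrtr ?divr_ge0 ?ltW//; field.
  by rewrite !gt_eqF.
apply.
- by move=> w _; apply: measurable_ysection; exact: measurable_correct.
- by move=> w t Pw; rewrite /ysection /= inE; rewrite correctP /D /= matR_shift.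
- move=> w w' t Pw Pw' Dw Dw'; case: cP => _ hdec _ _ _.
  have Si k : S (i, k) = false.
    by rewrite SE !inE !xpair_eqE (negPf ij) (negPf il).
  have Sj k : S (j, k) = (k == i).
    by rewrite SE !inE !xpair_eqE eqxx (negPf jl) /= !orbF.
  have toi k : S (k, i) -> w (k, i) = w' (k, i).
    move=> Sk; have /= <- := Dw _ Sk; have /= <- := Dw' _ Sk.
    rewrite (hdec i _ w w')// => k1; apply: PS => //; by rewrite Si.
  (* The only message of [j] in [S] is the one for [i], which has just been recovered. The side
     information of [j] is therefore known, and its decoder can be applied in turn. *)
  have own_j k : w (j, k) = w' (j, k).
    have [->|ki] := eqVneq k i; first by apply: toi; rewrite Sj.
    by apply: PS => //; rewrite Sj (negPf ki).
  have toj k : S (k, j) -> w (k, j) = w' (k, j).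
    move=> Sk; have /= <- := Dw _ Sk; have /= <- := Dw' _ Sk.
    by rewrite (hdec j _ w w').
  apply/ffunP => -[k k'].
  have [Sp|nSp] := boolP (S (k, k')); last exact: PS.
  have : S (k, k') by []; rewrite SE !inE !xpair_eqE => /or3P[] /andP[_ /eqP E];
    move: Sp; rewrite E; [exact: toi|exact: toi|exact: toj].
- by move=> w i' _; rewrite /x /ext_rank_pred /ext_rank; case: insub => // r; rewrite eqxx.
- move=> w _; rewrite /x energy_relay.
  apply: le_trans (fro_sum_le _) _; rewrite card_ord -!mulrA ler_wpM2l// mulr_suml mulr_sumr.
  apply: ler_sum => k _; apply: le_trans (fro_mulmx _ _) _; rewrite -!mulrA ler_wpM2l//.
  rewrite ler_wpM2l ?fro_ge0//.
  by case: cP => _ _ + _ _; move=> /(_ k w); rewrite avg_power_le.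
Qed.
End DecodedSet.
End CodeBounds.

(** * From counting bounds to rates and degrees of freedom *)

Section RateBounds.
Context {R : realType}.

(** The two real parts of a complex dimension turn [Num.sqrt (1 + snr)] into [1 + snr]; the final
    [1] absorbs the factor 2, which is below [expR 1]. *)
Lemma rate_le_of_expR_le (r snr c : R) (dim T : nat) : 0 < snr -> (0 < T)%N ->
  expR (T%:R * r) <= 2 * (Num.sqrt (1 + snr) ^+ (dim * T * 2) * expR (c * T%:R)) ->
  r <= dim%:R * ln (1 + snr) + c + 1.
Proof.
move=> snr0 T0; have s1 : 0 < 1 + snr by rewrite addr_gt0.
have -> : Num.sqrt (1 + snr) ^+ (dim * T * 2) = expR ((dim * T)%:R * ln (1 + snr)).
  by rewrite exprM exprAC sqr_sqrtr ?ltW// expRM_natl lnK.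
rewrite -expRD => h.
have T1 : 1 <= T%:R :> R by rewrite ler1n.
have : T%:R * r <= 1 + ((dim * T)%:R * ln (1 + snr) + c * T%:R).
  rewrite -ler_expR expRD; apply: le_trans h _; rewrite ler_wpM2r ?expR_ge0//.
  by have := @expR_ge1Dx R 1; lra.
move=> h'; rewrite -(ler_pM2l (x := T%:R)) ?ltr0n//; rewrite natrM in h'.
nra.
Qed.

Context {K M N : nat} (H : 'I_K -> 'M[R[i]]_(N, M)) (G : 'I_K -> 'M[R[i]]_(M, N)).
Context (sigma2 snr : R) (Rt : 'I_K -> 'I_K -> R).
Hypotheses (sigma2_gt0 : 0 < sigma2) (snr_gt0 : 0 < snr).
Hypothesis ach : achievable H G (snr * sigma2) sigma2 Rt.

(** One block length, [T0.+1], and one error level small enough for a union bound over [S] suffice,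
    since the counting bounds hold at every positive length. *)
Lemma achievable_bound (S : pred ('I_K * 'I_K)) (dim : nat) (c : R) :
  (forall p, S p -> p.1 != p.2) ->
  (forall T n (cd : @Defs.code R K M N T n) eps, (0 < T)%N ->
     code_valid (snr * sigma2) cd -> (forall p, (0 < n p.1 p.2)%N) ->
     (forall p w, S p -> measurable (err_event H G cd (@matR R N T \o fst)
        (fun k => @matZ R K M T k \o snd) p.1 p.2 w)) ->
     (forall p, S p -> err_prob H G cd (@canonical_prob R K M N T sigma2)
       (@matR R N T \o fst) (fun k => @matZ R K M T k \o snd) p.1 p.2 <= eps) ->
     #|S|%:R * eps <= 1 / 2 ->
     (\prod_(p | S p) n p.1 p.2)%N%:R <=
       2 * (Num.sqrt (1 + snr) ^+ (dim * T * 2) * expR (c * T%:R))) ->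
  \sum_(p | S p) Rt p.1 p.2 <= dim%:R * ln (1 + snr) + c + 1.
Proof.
move=> Sd bound.
pose eps : R := (2 * (#|S|.+1)%:R)^-1.
have eps0 : 0 < eps by rewrite invr_gt0 mulr_gt0.
have [T0 /(_ T0.+1 (leqnSn _))[n [cd [cdP [rn perf]]]]] := ach eps0.
have n0 p : (0 < n p.1 p.2)%N.
  case: (eqVneq p.1 p.2) => [<-|p12]; first by case: cdP => _ _ _ _ ->.
  by rewrite -(ltr0n R); apply: lt_le_trans (expR_gt0 _) (rn _ _ p12).
have pf p (Sp : S p) := perf _ _ _ _ _ (@canonical_gaussian R K M N T0.+1 sigma2) p.1 p.2 (Sd p Sp).
apply: (@rate_le_of_expR_le _ snr c dim T0.+1) => //.
apply: le_trans (bound _ n cd eps _ cdP n0 _ _ _) => //.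
- rewrite mulr_sumr expR_sum natr_prod; apply: ler_prod => p Sp.
  by rewrite expR_ge0 /= rn// Sd.
- by move=> p w Sp; have [+ _] := pf p Sp; apply.
- by move=> p Sp; have [_ +] := pf p Sp; apply.
- rewrite /eps invfM mulrCA mul1r ler_piMr// ler_pdivrMr ?ltr0n// mul1r ler_nat.
  exact: leqnSn.
Qed.

Lemma achievable_downlink_le k' :
  \sum_(k | k != k') Rt k k' <=
    M%:R * ln (1 + snr) + N%:R * fro (G k') + 1.
Proof.
have /= := @achievable_bound (fun p => (p.2 == k') && (p.1 != k')) M (N%:R * fro (G k')).
rewrite (_ : \sum_(p | _) _ = \sum_(k | k != k') Rt k k'); last first.
  rewrite (reindex_onto (fun k => (k, k')) (fun p => p.1)) /=; last first.
    by move=> [k q] /= /andP[/eqP -> _].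
  by apply: eq_bigl => k; rewrite !eqxx /= andbT.
apply; first by move=> p /andP[/eqP -> ].
move=> T n cd eps T0 cdP n0 mE eE Se.
exact: (downlink_prod_le sigma2_gt0 snr_gt0 T0 cdP n0 mE eE Se (fun=> erefl)).
Qed.

Lemma achievable_uplink_le i j l : i != j -> i != l -> j != l ->
  Rt j i + Rt l i + Rt l j <=
    N%:R * ln (1 + snr) + K%:R * M%:R * (\sum_k fro (H k)) + 1.
Proof.
move=> ij il jl.
have /= := @achievable_bound (fun p => p \in [:: (j, i); (l, i); (l, j)]) N
  (K%:R * M%:R * (\sum_k fro (H k))).
rewrite (_ : \sum_(p in [:: (j, i); (l, i); (l, j)]) _ = Rt j i + Rt l i + Rt l j); last first.
  rewrite -big_uniq /=; first by rewrite !big_cons big_nil /= addr0 addrA.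
  by rewrite !inE !xpair_eqE (negPf ij) (negPf jl) !andbF.
apply; first by move=> p; rewrite !inE => /or3P[] /eqP -> /=; rewrite eq_sym.
move=> T n cd eps T0 cdP n0 mE eE Se.
exact: (uplink_prod_le sigma2_gt0 snr_gt0 T0 cdP n0 mE eE Se ij il jl (fun=> erefl)).
Qed.
End RateBounds.

Lemma dof_le_of_log_bound (R : realType) (K : nat) (a b d : R) (s : R -> R) :
  (0 < K)%N -> (forall snr, 0 < snr -> s snr <= a * ln (1 + snr) + b) -> 0 <= a ->
  s snr / (K%:R * ln snr) @[snr --> +oo] --> d -> d <= a / K%:R.
Proof.
move=> K0 sb a0 sd; rewrite leNgt; apply/negP => ad.
pose e := (d - a / K%:R) / 2.
have e0 : 0 < e by rewrite divr_gt0// subr_gt0.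
have KR : 0 < K%:R :> R by rewrite ltr0n.
have /cvgrPdist_lt/(_ _ e0) [M0 [_ hM]] := sd.
(* Since [ln (1 + x) <= ln 2 + ln x] for [1 <= x], the excess [e * K%:R * ln x] beats all constants
   as soon as [ln x] exceeds [L]. *)
pose L := (a * ln 2 + `|b| + 1) / (e * K%:R).
have L0 : 0 <= L.
  apply: divr_ge0; last by rewrite ltW// mulr_gt0.
  by rewrite !addr_ge0// mulr_ge0// ln_ge0// ler1n.
pose x := Num.max (M0 + 1) (expR (L + 1)).
have xM : M0 < x by rewrite /x lt_max ltrDl ltr01.
have xL : expR (L + 1) <= x by rewrite /x le_max lexx orbT.
have x1 : 1 <= x by apply: le_trans xL; have := @expR_ge1Dx R (L + 1); lra.
have x0 : 0 < x by apply: lt_le_trans x1.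
have lx : L + 1 <= ln x by rewrite -ler_expR lnK.
have lx0 : 0 < ln x by apply: lt_le_trans lx; rewrite ltr_wpDl.
have {}h : a / K%:R + e < s x / (K%:R * ln x).
  have := hM x xM; rewrite /= => /ltr_normlP[]; rewrite /e; lra.
rewrite ltr_pdivlMr ?mulr_gt0// in h.
have := sb x x0.
have : ln (1 + x) <= ln 2 + ln x.
  by rewrite -lnM ?posrE//; rewrite ler_ln ?posrE ?mulr_gt0 ?addr_gt0//; lra.
move=> h1 h2.
have h3 : (a / K%:R + e) * (K%:R * ln x) = a * ln x + e * K%:R * ln x.
  by field; rewrite gt_eqF.
have h4 : e * K%:R * (L + 1) <= e * K%:R * ln x by rewrite ler_wpM2l// mulr_ge0 ?ltW.
have h5 : e * K%:R * L = a * ln 2 + `|b| + 1 by rewrite /L; field; rewrite !gt_eqF.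
have h6 : a * ln (1 + x) <= a * (ln 2 + ln x) by rewrite ler_wpM2l.
have h7 := ler_norm b.
have h8 : 0 < e * K%:R by rewrite mulr_gt0.
rewrite h3 in h; lra.
Qed.

Section DofConverse.
Context {R : realType} {M N : nat} (H : 'I_3 -> 'M[R[i]]_(N, M)) (G : 'I_3 -> 'M[R[i]]_(M, N)).
Context (sigma2 d : R).
Hypotheses (sigma2_gt0 : 0 < sigma2) (ach : dof_user_achievable H G sigma2 d).

Lemma dof_le_user_antennas : d <= M%:R.
Proof.
case: ach => Rt [Rach Rlim].
have := @dof_le_of_log_bound R 3 (3 * M%:R)
  (\sum_(k' < 3) (N%:R * fro (G k') + 1)) d _ isT _ _ Rlim.
rewrite mulrAC divff// mul1r; apply; last by rewrite mulr_ge0.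
move=> snr snr0; rewrite /sum_rate.
rewrite (exchange_big_dep predT) //=.
have -> : 3 * M%:R * ln (1 + snr) = \sum_(k' < 3) M%:R * ln (1 + snr).
  by rewrite sumr_const card_ord -mulrA mulr_natl.
rewrite -big_split /=; apply: ler_sum => k' _.
have [_ a] := Rach _ snr0; have := achievable_downlink_le sigma2_gt0 snr0 a k'.
rewrite -addrA; apply: le_trans; rewrite le_eqVlt; apply/orP; left; apply/eqP.
by apply: eq_bigl => k; rewrite eq_sym.
Qed.

Lemma dof_le_relay_antennas : d <= (2 * N)%:R / 3.
Proof.
case: ach => Rt [Rach Rlim].
have := @dof_le_of_log_bound R 3 (2 * N)%:R
  (2 * (3 * M%:R * (\sum_k fro (H k)) + 1)) d _ isT _ _ Rlim; apply => //.
move=> snr snr0; have [_ a] := Rach _ snr0.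
have := @achievable_uplink_le _ _ _ _ _ _ _ _ _ sigma2_gt0 snr0 a.
(* A triple consists of the messages sent downwards in a linear order of the users; the reversed
   order gives the complementary triple. *)
move=> u; have u1 := u (inord 0) (inord 1) (inord 2); have u2 := u (inord 2) (inord 1) (inord 0).
have E (p q : nat) : (p < 3)%N -> (q < 3)%N -> (inord p == inord q :> 'I_3) = (p == q).
  by move=> p3 q3; rewrite -val_eqE /= !inordK.
rewrite !E// in u1 u2; have {}u1 := u1 isT isT isT; have {}u2 := u2 isT isT isT.
have e0 : ord0 = inord 0 :> 'I_3 by apply/val_inj; rewrite /= inordK.
have e1 : lift ord0 ord0 = inord 1 :> 'I_3 by apply/val_inj; rewrite /= inordK.
have e2 : lift ord0 (lift ord0 ord0) = inord 2 :> 'I_3 by apply/val_inj; rewrite /= inordK.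
set F := \sum_k fro _ in u1 u2 *.
rewrite /sum_rate; under eq_bigr do rewrite big_mkcond.
rewrite !big_ord_recl !big_ord0 e2 e1 e0 !E//=.
rewrite natrM; lra.
Qed.
End DofConverse.

(** * Codes and decoding for zero-forcing relays *)

Section GilbertVarshamov.
Local Close Scope classical_set_scope.
Context {A : finType} (T D : nat).
Local Notation word := {ffun 'I_T -> A}.

Definition hdist (x y : word) : nat := #|[set t : 'I_T | x t != y t]|.

Lemma hdistC x y : hdist x y = hdist y x.
Proof. by apply: eq_card => t; rewrite !inE eq_sym. Qed.

Lemma hdistxx x : hdist x x = 0%N.
Proof.
rewrite /hdist (_ : [set t | _] = finset.set0) ?cards0//.
by apply/setP => t; rewrite !inE eqxx.
Qed.

(** A word of the ball agrees with [c] off some set of at most [D] positions. Counting these sets by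
    [2 ^ T] costs [ln 2] per channel use, which is negligible against [ln snr]. *)
Lemma card_hball_le (c : word) : (0 < #|A|)%N ->
  (#|[set x | (hdist c x <= D)%N]| <= 2 ^ T * #|A| ^ D)%N.
Proof.
move=> A0.
pose E (B : {set 'I_T}) : {set word} :=
  [set x | x \in family (fun t => if t \in B then predT else pred1 (c t))].
have cE B : #|E B| = (#|A| ^ #|B|)%N.
  rewrite cardsE (card_family (fun t => if t \in B then predT else pred1 (c t))).
  rewrite foldrE big_map big_enum /= -prod_nat_const [RHS]big_mkcond /=.
  by apply: eq_bigr => t _; case: ifP => _; rewrite ?card1// eq_cardT.
have sub : [set x | (hdist c x <= D)%N] \subset
    \bigcup_(B : {set 'I_T} | (#|B| <= D)%N) E B.
  apply/fintype.subsetP => x; rewrite inE => cx.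
  apply/bigcupP; exists [set t | c t != x t] => //; rewrite inE.
  apply/familyP => t; rewrite inE; case: eqVneq => //= <-.
  by rewrite inE.
apply: leq_trans (subset_leq_card sub) _.
have U (s : seq {set 'I_T}) (P : pred {set 'I_T}) :
    (#|\bigcup_(B <- s | P B) E B| <= \sum_(B <- s | P B) #|E B|)%N.
  elim/big_ind2: _ => [|x1 x2 y1 y2 h1 h2|//]; first by rewrite cards0.
  by apply: leq_trans (leq_add h1 h2); rewrite cardsU leq_subr.
apply: leq_trans (U _ _) _.
apply: (@leq_trans (\sum_(B : {set 'I_T} | (#|B| <= D)%N) #|A| ^ D)).
  by apply: leq_sum => B BD; rewrite cE leq_pexp2l.
rewrite sum_nat_const leq_mul2r; apply/orP; right.
apply: leq_trans (max_card _) _.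
by rewrite -[X in (X <= _)%N]cardsT -powersetT card_powerset cardsT card_ord.
Qed.

(** A maximal set of words at pairwise distance above [D] is covering: a word far from all its
    elements could be added. Hence the balls around it exhaust the space. *)
Lemma gilbert_varshamov : (0 < #|A|)%N ->
  exists (m : nat) (cw : 'I_m.+1 -> word),
    (forall i j, (hdist (cw i) (cw j) <= D)%N -> i = j) /\
    (#|A| ^ T <= m.+1 * (2 ^ T * #|A| ^ D))%N.
Proof.
move=> A0.
pose sep (C : {set word}) :=
  [forall x in C, forall y in C, (hdist x y <= D)%N ==> (x == y)].
have [C /maxsetP[sC mC] _] : {C : {set word} | maxset sep C & finset.set0 \subset C}.
  by apply: maxset_exists; apply/forall_inP => x; rewrite inE.
have cover x : exists2 c, c \in C & (hdist c x <= D)%N.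
  have [xC|xC] := boolP (x \in C); first by exists x; rewrite ?hdistxx.
  apply/exists_inP; apply: contraT; rewrite negb_exists_in => /forall_inP nC.
  suff sx : sep (x |: C).
    by move: xC; rewrite -(mC _ sx (finset.subsetUr _ _)) !inE eqxx.
  apply/forall_inP => y yC; apply/forall_inP => z zC; apply/implyP => yz.
  move: yC zC yz; rewrite !inE.
  have nc c : c \in C -> (hdist c x <= D)%N = false by move=> /nC /negPf.
  move=> /orP[/eqP ->|yC] /orP[/eqP ->|zC] yz; rewrite ?eqxx//.
  - by rewrite hdistC nc in yz.
  - by rewrite nc in yz.
  - by move/forall_inP: sC => /(_ _ yC) /forall_inP /(_ _ zC) /implyP /(_ yz).
have [f0 Cf0] : exists f0, f0 \in C.
  have /card_gt0P[a _] := A0; have [c cC _] := cover [ffun=> a]; by exists c.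
have C0 : (0 < #|C|)%N by apply/card_gt0P; exists f0.
exists #|C|.-1, (fun i => enum_val (cast_ord (prednK C0) i)); split.
  move=> i j ij; move/forall_inP: sC => /(_ _ (enum_valP (cast_ord (prednK C0) i))).
  move=> /forall_inP /(_ _ (enum_valP (cast_ord (prednK C0) j))) /implyP /(_ ij) /eqP.
  by move=> /enum_val_inj /cast_ord_inj.
have cw : #|[set: word]| = (#|A| ^ T)%N by rewrite cardsT card_ffun card_ord.
rewrite prednK// -cw.
have sub : [set: word] \subset \bigcup_(c in C) [set x | (hdist c x <= D)%N].
  apply/fintype.subsetP => x _; have [c cC cx] := cover x.
  by apply/bigcupP; exists c => //; rewrite inE.
apply: leq_trans (subset_leq_card sub) _.
have U (s : seq word) (P : pred word) (E : word -> {set word}) :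
    (#|\bigcup_(B <- s | P B) E B| <= \sum_(B <- s | P B) #|E B|)%N.
  elim/big_ind2: _ => [|x1 x2 y1 y2 h1 h2|//]; first by rewrite cards0.
  by apply: leq_trans (leq_add h1 h2); rewrite cardsU leq_subr.
apply: leq_trans (U _ _ _) _; rewrite -sum_nat_const; apply: leq_sum => c _.
exact: card_hball_le.
Qed.
End GilbertVarshamov.

(** * Large noise samples are rare *)

Section NoiseTail.
Context {R : realType}.

Definition big_abs (B : R) : set R := [set x | B < `|x|].

Lemma measurable_big_abs B : measurable (big_abs B).
Proof.
rewrite (_ : big_abs B = (@Num.norm _ R) @^-1` `]B, +oo[%classic).
  by rewrite -[X in measurable X]setTI; exact: normr_measurable.
by apply/seteqP; split => x /=; rewrite in_itv /= andbT.
Qed.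

Lemma normal_tail (s e : R) : 0 < e ->
  exists2 B : R, 0 < B & fine (normal_prob 0 s (big_abs B)) <= e.
Proof.
move=> e0.
have : normal_prob 0 s (big_abs m%:R) @[m --> \oo] -->
    normal_prob 0 s (\bigcap_m big_abs m%:R).
  apply: nonincreasing_cvg_mu.
  - by rewrite ltey_eq fin_num_measure//; exact: measurable_big_abs.
  - by move=> m; exact: measurable_big_abs.
  - by apply: bigcapT_measurable => m; exact: measurable_big_abs.
  - move=> m n mn; apply/subsetPset => x /=; rewrite /big_abs /=.
    by apply: le_lt_trans; rewrite ler_nat.
rewrite (_ : \bigcap_m big_abs m%:R = set0) ?measure0; last first.
  apply/seteqP; split => x //= h.
  have := h (Num.truncn `|x|).+1 I; rewrite /big_abs /= => /lt_trans.
  by move=> /(_ _ (truncnS_gt _)); rewrite ltxx.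
move=> /fine_cvgP[_] /cvgrPdist_le /(_ _ e0) [m _ hm].
exists m.+1%:R => //.
by have := hm m.+1 (leqnSn _); rewrite /= sub0r normrN ger0_norm// fine_ge0.
Qed.

Context {K M N T : nat} (sigma2 : R) {d : measure_display}.
Context {Omega : measurableType d} (Pr : probability Omega R).
Context (ZR : Omega -> 'M[R[i]]_(N, T)) (Z : 'I_K -> Omega -> 'M[R[i]]_(M, T)).
Hypothesis gauss : gaussian_noise sigma2 Pr ZR Z.
Local Notation J := (noise_idx K M N T).

Definition many_big (B : R) (D : nat) : set Omega :=
  [set o | (D < #|[pred j : J | (B < `|noise_comp ZR Z j o|)%R]|)%N].

Let all_big B (V : {set J}) : set Omega :=
  [set o | forall j, (if j \in V then big_abs B else setT) (noise_comp ZR Z j o)].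

Let measurable_all_big B V : measurable (all_big B V).
Proof.
rewrite [X in measurable X](_ : _ = \bigcap_(j in [set: J])
  (noise_comp ZR Z j @^-1` (if j \in V then big_abs B else setT))).
  apply: fin_bigcap_measurable => // j _.
  rewrite -[X in measurable X]setTI; apply: (gauss.1 j) => //.
  by case: ifP => _ //; exact: measurable_big_abs.
by apply/seteqP; split => [w h j _|w h j]; [exact: h|exact: (h j I)].
Qed.

Let many_bigE B D :
  many_big B D = \big[setU/set0]_(V : {set J} | #|V| == D.+1) all_big B V.
Proof.
rewrite -(bigcup_pred (fun V : {set J} => #|V| == D.+1)); apply/seteqP; split => o.
  rewrite /many_big /= => h.
  set X := [pred j | _] in h.
  have sX : size (take D.+1 (enum X)) = D.+1 by rewrite size_takel// -cardE.
  exists (finset (fun j => j \in take D.+1 (enum X))) => /=.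
    by rewrite unfold_in /= cardsE (card_uniqP _) ?sX// take_uniq// enum_uniq.
  move=> j; rewrite inE; case: ifP => // /mem_take.
  by rewrite mem_enum.
move=> [V /= VD h]; rewrite /many_big /=.
rewrite unfold_in /= in VD; move/eqP: VD => <-.
apply: subset_leq_card; apply/fintype.subsetP => j jV.
by have := h j; rewrite jV.
Qed.

Lemma measurable_many_big B D : measurable (many_big B D).
Proof.
by rewrite many_bigE; apply: bigsetU_measurable => V _; exact: measurable_all_big.
Qed.

(** Union bound over the sets of [D.+1] components, at most [2 ^+ #|J|] of them; by independence the
    components of one such set are all large with probability the corresponding power. *)
Lemma many_big_le B D :
  fine (Pr (many_big B D)) <=
    2 ^+ #|J| * fine (normal_prob 0 (Num.sqrt (sigma2 / 2)) (big_abs B)) ^+ D.+1.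
Proof.
set p := fine (normal_prob _ _ _).
rewrite -lee_fin fineK ?fin_num_measure//; last exact: measurable_many_big.
rewrite many_bigE; apply: le_trans (probability_bigsetU_le _ _ _) _ => //.
have p0 : 0 <= p by rewrite fine_ge0.
rewrite (eq_bigr (fun _ => (p ^+ D.+1)%:E)); last first.
  move=> V /eqP cV; rewrite -[LHS]fineK ?fin_num_measure//; congr EFin.
  have mB j : measurable (if j \in V then big_abs B else setT).
    by case: ifP => // _; exact: measurable_big_abs.
  apply: (etrans (gauss.2 _ mB)).
  rewrite (bigID (mem V)) /= [X in _ * X]big1 ?mulr1; last first.
    by move=> j /negPf ->; rewrite [normal_prob _ _ _]probability_setT.
  by rewrite (eq_bigr (fun=> p)) ?prodr_const ?cV// => j ->.
rewrite sumEFin lee_fin sumr_const -[X in X <= _]mulr_natl ler_wpM2r ?exprn_ge0//.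
rewrite -natrX ler_nat; apply: leq_trans (max_card _) _.
by rewrite -cardsT -powersetT card_powerset cardsT.
Qed.
End NoiseTail.

Section ColumnLemmas.
Context {R : realType}.
Local Notation C := R[i].

Lemma col_mulmx m n p (A : 'M[C]_(m, n)) (B : 'M[C]_(n, p)) t :
  col t (A *m B) = A *m col t B.
Proof. by apply/matrixP => i j; rewrite !mxE; apply: eq_bigr => k _; rewrite mxE. Qed.

Lemma nsqN (z : C) : nsq (- z) = nsq z.
Proof. by case: z => a b; rewrite /nsq /=; ring. Qed.

Lemma nsqD_le (y z : C) : nsq (y + z) <= 2 * (nsq y + nsq z).
Proof.
case: y z => [a b] [c e]; rewrite /nsq /=.
have := sqr_ge0 (a - c); have := sqr_ge0 (b - e); rewrite !sqrrB; nra.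
Qed.

Lemma nsqB_le (x y z : C) : nsq (y - z) <= 2 * (nsq (x - y) + nsq (x - z)).
Proof.
have -> : y - z = - (x - y) + (x - z) by rewrite opprB addrA subrK.
by rewrite -[nsq (x - y)]nsqN; exact: nsqD_le.
Qed.

Lemma nsq_real (r : R) : nsq (r%:C)%C = r ^+ 2.
Proof. by rewrite /nsq /= expr0n addr0. Qed.

Lemma froD_le m n (A B : 'M[C]_(m, n)) : fro (A + B) <= 2 * (fro A + fro B).
Proof.
rewrite mulrDr /fro !mulr_sumr -big_split; apply: ler_sum => i _ /=.
rewrite !mulr_sumr -big_split; apply: ler_sum => j _ /=.
by rewrite mxE -mulrDr; exact: nsqD_le.
Qed.

Lemma froZ m n (z : C) (A : 'M[C]_(m, n)) : fro (z *: A) = nsq z * fro A.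
Proof.
rewrite /fro mulr_sumr; apply: eq_bigr => i _; rewrite mulr_sumr.
by apply: eq_bigr => j _; rewrite mxE nsqM.
Qed.

Lemma fro0 m n : fro (0 : 'M[C]_(m, n)) = 0.
Proof. by rewrite /fro big1// => i _; rewrite big1// => j _; rewrite mxE /nsq /= expr0n addr0. Qed.

Lemma fro11 (A : 'M[C]_1) : fro A = nsq (A 0 0).
Proof. by rewrite /fro !big_ord1. Qed.

Lemma fro_cols m n (A : 'M[C]_(m, n)) : fro A = \sum_(t < n) fro (col t A).
Proof.
rewrite /fro exchange_big /=; apply: eq_bigr => t _; apply: eq_bigr => i _.
by rewrite big_ord1 mxE.
Qed.

Lemma fro_col_le m (z : 'cV[C]_m) (B : R) :
  (forall i, `|complex.Re (z i 0)| <= B) -> (forall i, `|complex.Im (z i 0)| <= B) ->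
  fro z <= m%:R * (2 * B ^+ 2).
Proof.
move=> hr hi; rewrite /fro -[m in m%:R]card_ord mulr_natl -sumr_const.
apply: ler_sum => i _; rewrite big_ord1 /nsq.
have B2 (x : R) : `|x| <= B -> x ^+ 2 <= B ^+ 2.
  by move=> xB; rewrite -[x ^+ 2]real_normK ?num_real// ler_pXn2r ?nnegrE// (le_trans _ xB).
by have := B2 _ (hr i); have := B2 _ (hi i); lra.
Qed.
End ColumnLemmas.

(** * Linear relaying and threshold decoding *)

Section LinearScheme.
Context {R : realType} {K M N : nat}.
Context (H : 'I_K -> 'M[R[i]]_(N, M)) (G : 'I_K -> 'M[R[i]]_(M, N)).
Context {S : finType} (src dst : S -> 'I_K).
Context (v : S -> 'cV[R[i]]_M) (u : S -> 'rV[R[i]]_M) (F : 'M[R[i]]_N).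

Definition streams (i j : 'I_K) := {s : S | (src s == i) && (dst s == j)}.

Context (T Q D : nat) (a thr P gam : R) (m : 'I_K -> 'I_K -> nat).
Context (cw : forall i j, 'I_(m i j).+1 ->
  {ffun 'I_T -> {ffun streams i j -> 'I_Q.+1 * 'I_Q.+1}}).

Let n i j := (m i j).+1.

(** The square grid of spacing [a] sits in the first quadrant; not centering it costs a constant
    factor of power. *)
Definition qam (x : 'I_Q.+1 * 'I_Q.+1) : R[i] := (a * x.1%:R +i* (a * x.2%:R))%C.

Definition msg_sym i j (mu : 'I_(m i j).+1) (s : streams i j) t : R[i] := qam (cw mu t s).

Lemma stream_self s : (src s == src s) && (dst s == dst s).
Proof. by rewrite !eqxx. Qed.

Definition stream_of s : streams (src s) (dst s) := Sub s (stream_self s).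

Definition sym (w : msg n) s t : R[i] := msg_sym (w (src s, dst s)) (stream_of s) t.

Lemma symE w i j (s : streams i j) t : sym w (val s) t = msg_sym (w (i, j)) s t.
Proof.
case: s => s /= p; case/andP: (p) => /eqP si /eqP sj; subst i j.
by rewrite /sym (_ : stream_of s = Sub s p)//; apply/val_inj.
Qed.

Definition lin_enc (k : 'I_K) (w : msg n) : 'M[R[i]]_(M, T) :=
  \matrix_(i < M, t < T) \sum_(s | src s == k) sym w s t * v s i 0.

(** The relay must respect its power for every received signal, however large the noise, so it stays
    silent in a channel use that would violate the constraint. *)
Definition clip (x : 'cV[R[i]]_N) : 'cV[R[i]]_N := if fro x <= P then x else 0.

Definition lin_relay (Y : 'M[R[i]]_(N, T)) : 'M[R[i]]_(N, T) :=
  \matrix_(i < N, t < T) clip ((gam%:C)%C *: (F *m col t Y)) i 0.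

(* Received stream [s] minus the contribution of the user's own signal. *)
Definition est k' (Y : 'M[R[i]]_(M, T)) (w : msg n) s t : R[i] :=
  (gam^-1%:C)%C * (u s *m col t Y) 0 0 -
  (u s *m G k' *m F *m H k' *m col t (lin_enc k' w)) 0 0.

(** Up to [D] channel uses may contradict a candidate, which leaves room for those spoiled by large
    noise. *)
Definition test k' i j Y w (mu : 'I_(m i j).+1) : bool :=
  (#|[pred t | [exists s : streams i j,
      thr < nsq (est k' Y w (val s) t - msg_sym mu s t)]%R]| <= D)%N.

Definition lin_dec k' (Y : 'M[R[i]]_(M, T)) (w : msg n) : msg n :=
  finfun (fun p : 'I_K * 'I_K =>
    odflt ord0 [pick mu : 'I_(n p.1 p.2) | test k' Y w mu]).

Definition lin_code : Defs.code R M N T n := Defs.Code lin_enc lin_relay lin_dec.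

Lemma col_lin_enc k w t :
  col t (lin_enc k w) = \sum_(s | src s == k) sym w s t *: v s.
Proof.
apply/matrixP => i j; rewrite !mxE summxE; apply: eq_bigr => s _.
by rewrite !mxE ord1.
Qed.

Lemma lin_enc_own k (w w' : msg n) :
  (forall k', w (k, k') = w' (k, k')) -> lin_enc k w = lin_enc k w'.
Proof.
move=> ww; apply/matrixP => i t; rewrite !mxE; apply: eq_bigr => s /eqP sk.
by subst k; rewrite /sym ww.
Qed.

Hypotheses (P_ge0 : 0 <= P) (T_gt0 : (0 < T)%N).
Hypothesis enc_power : forall k w t, fro (col t (lin_enc k w)) <= P.

Lemma fro_clip_le x : fro (clip x) <= P.
Proof. by rewrite /clip; case: ifP; rewrite ?fro0. Qed.

Lemma col_lin_relay Y t : col t (lin_relay Y) = clip ((gam%:C)%C *: (F *m col t Y)).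
Proof. by apply/matrixP => i j; rewrite !mxE ord1. Qed.

Lemma lin_code_valid : (forall k, m k k = 0%N) -> code_valid P lin_code.
Proof.
move=> mkk; split => /=.
- exact: lin_enc_own.
- move=> k' Y w w' ww; have E : est k' Y w = est k' Y w'.
    by rewrite /est (lin_enc_own ww).
  by rewrite /lin_dec /test E.
- move=> k w; rewrite avg_power_le// fro_cols.
  apply: le_trans (ler_sum _ (fun t _ => enc_power k w t)) _.
  by rewrite sumr_const card_ord mulr_natl.
- move=> Y; rewrite avg_power_le// fro_cols.
  apply: (@le_trans _ _ (\sum_(t < T) P)); last by rewrite sumr_const card_ord mulr_natl.
  by apply: ler_sum => t _; rewrite col_lin_relay fro_clip_le.
- by move=> k; rewrite /n mkk.
Qed.

Hypothesis src_dst : forall s, src s != dst s.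
Hypothesis zero_forcing : forall s t, src t != dst s ->
  (u s *m G (dst s) *m F *m H (src t) *m v t) 0 0 = (s == t)%:R.

(** Zero forcing constrains only the streams sent by other users; what remains besides the wanted
    symbol is a multiple of the user's own signal, which [est] subtracts. *)
Lemma zero_forced_sum w s t :
  (u s *m G (dst s) *m F *m (\sum_(k < K) H k *m col t (lin_enc k w))) 0 0 =
  (u s *m G (dst s) *m F *m H (dst s) *m col t (lin_enc (dst s) w)) 0 0 + sym w s t.
Proof.
rewrite mulmx_sumr summxE (bigD1 (dst s))//= mulmxA; congr (_ + _).
transitivity (\sum_(k < K | k != dst s) \sum_(s' | (src s' != dst s) && (src s' == k))
    sym w s' t * (s == s')%:R).
  apply: eq_bigr => k ks; rewrite mulmxA col_lin_enc mulmx_sumr summxE.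
  apply: eq_big => [s'|s' /eqP sk].
    by case: eqVneq => [->|]; rewrite ?ks ?andbF.
  by rewrite -scalemxAr mxE -zero_forcing ?sk.
rewrite -(partition_big src (fun k => k != dst s))//= (bigD1 s)//= eqxx mulr1.
by rewrite big1 ?addr0// => s' /andP[_ /negPf]; rewrite eq_sym => ->; rewrite mulr0.
Qed.

Context (ZR : 'M[R[i]]_(N, T)) (Z : 'I_K -> 'M[R[i]]_(M, T)) (B : R).

Definition good_time t :=
  [/\ (forall i, `|complex.Re (ZR i t)| <= B), (forall i, `|complex.Im (ZR i t)| <= B),
      (forall k i, `|complex.Re (Z k i t)| <= B) & (forall k i, `|complex.Im (Z k i t)| <= B)].

Hypothesis gam_gt0 : 0 < gam.
Hypothesis no_clip : gam ^+ 2 * (N%:R * fro F * (2 * (K%:R *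
  (\sum_(k < K) M%:R * fro (H k) * P) + N%:R * (2 * B ^+ 2)))) <= P.
Hypothesis noise_thr : forall s, 2 * (N%:R * fro (u s *m G (dst s) *m F) * (N%:R * (2 * B ^+ 2)) +
  (gam^-1) ^+ 2 * (M%:R * fro (u s) * (M%:R * (2 * B ^+ 2)))) <= thr.

(** At a good time the relay does not clip, and the error of the estimate is the relay noise
    filtered by [u s *m G (dst s) *m F] plus the user's noise divided by the gain [gam]. *)
Lemma est_close w s t : good_time t ->
  nsq (est (dst s) (user_rx H G lin_code w ZR (dst s) (Z (dst s))) w s t - sym w s t) <= thr.
Proof.
move=> [zr1 zr2 z1 z2].
have fzr : fro (col t ZR) <= N%:R * (2 * B ^+ 2) by apply: fro_col_le => i; rewrite mxE.
have fz : fro (col t (Z (dst s))) <= M%:R * (2 * B ^+ 2) by apply: fro_col_le => i; rewrite mxE.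
pose X : 'cV[R[i]]_N := \sum_(k < K) H k *m col t (lin_enc k w).
have colR : col t (relay_rx H lin_code w ZR) = X + col t ZR.
  rewrite /relay_rx /= raddfD raddf_sum /=; congr (_ + _).
  by apply: eq_bigr => k _; exact: col_mulmx.
have fX : fro X <= K%:R * (\sum_(k < K) M%:R * fro (H k) * P).
  apply: le_trans (fro_sum_le _) _; rewrite card_ord ler_wpM2l//; apply: ler_sum => k _.
  apply: le_trans (fro_mulmx _ _) _; rewrite ler_wpM2l ?mulr_ge0 ?fro_ge0//.
have nc : fro ((gam%:C)%C *: (F *m (X + col t ZR))) <= P.
  rewrite froZ nsq_real; apply: le_trans no_clip; rewrite ler_wpM2l ?sqr_ge0//.
  apply: le_trans (fro_mulmx _ _) _; rewrite ler_wpM2l ?mulr_ge0 ?fro_ge0//.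
  by apply: le_trans (froD_le _ _) _; rewrite ler_wpM2l// lerD.
rewrite /est /user_rx /= raddfD /= col_mulmx col_lin_relay colR /clip nc.
have -> : (u s *m (G (dst s) *m ((gam%:C)%C *: (F *m (X + col t ZR))) +
      col t (Z (dst s)))) 0 0 =
    (gam%:C)%C * ((u s *m G (dst s) *m F *m X) 0 0 + (u s *m G (dst s) *m F *m col t ZR) 0 0) +
    (u s *m col t (Z (dst s))) 0 0.
  rewrite mulmxDr [LHS]mxE; congr (_ + _).
  rewrite -!scalemxAr [LHS]mxE; congr (_ * _).
  by rewrite !mulmxA mulmxDr [LHS]mxE.
rewrite zero_forced_sum.
set A1 := (_ *m col t (lin_enc (dst s) w)) 0 0; set A2 := (_ *m col t ZR) 0 0.
set A3 := (u s *m col t (Z (dst s))) 0 0.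
have g1 : (gam^-1%:C * gam%:C)%C = 1 :> R[i].
  by rewrite -rmorphM /= mulVf ?gt_eqF.
have -> : (gam^-1%:C)%C * ((gam%:C)%C * (A1 + sym w s t + A2) + A3) - A1 - sym w s t =
   A2 + (gam^-1%:C)%C * A3.
  by rewrite mulrDr mulrA g1 mul1r; ring.
apply: le_trans (noise_thr s); apply: le_trans (nsqD_le _ _) _.
rewrite ler_wpM2l// nsqM nsq_real lerD//.
  rewrite -fro11; apply: le_trans (fro_mulmx _ _) _.
  by rewrite ler_wpM2l ?mulr_ge0 ?fro_ge0.
rewrite ler_wpM2l ?sqr_ge0// -fro11; apply: le_trans (fro_mulmx _ _) _.
by rewrite ler_wpM2l ?mulr_ge0 ?fro_ge0.
Qed.

Hypothesis cw_dist : forall i j mu mu',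
  (hdist (cw mu : {ffun 'I_T -> {ffun streams i j -> _}}) (cw mu') <= 2 * D)%N -> mu = mu'.
Hypotheses (a_gt0 : 0 < a) (thr_spacing : 4 * thr < a ^+ 2).

Lemma qam_inj x y : nsq (qam x - qam y) <= 4 * thr -> x = y.
Proof.
move=> /le_lt_trans /(_ thr_spacing).
case: x y => [x1 x2] [y1 y2]; rewrite /nsq /= -!mulrBr !exprMn -mulrDr gtr_pMr ?exprn_gt0//.
have sq1 (p q : 'I_Q.+1) : p <> q -> 1 <= (p%:R - q%:R : R) ^+ 2.
  move=> pq; wlog : p q pq / (p < q)%N => [wl|lt_pq].
    have [|/wl h|/val_inj//] := ltngtP p q; first exact: wl.
    by rewrite -sqrrN opprB; apply: h => /esym.
  rewrite -sqrrN opprB -natrB ?(ltnW lt_pq)// -natrX (ler_nat _ 1) expn_gt0 subn_gt0.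
  by rewrite lt_pq.
move=> h; congr pair; apply/eqP; apply: contraT => /eqP ne; move: h; rewrite ltNge => /negP[].
  by rewrite (le_trans (sq1 _ _ ne))// lerDl sqr_ge0.
by rewrite (le_trans (sq1 _ _ ne))// lerDr sqr_ge0.
Qed.

(** The true message fails at most at the bad times, so some candidate is accepted. An accepted one
    agrees with the truth except at [D] failures of its own and at the [D] bad times, and distinct
    codewords differ in more than [2 * D] places. *)
Lemma lin_dec_correct w k k' :
  (#|[pred t | ~~ `[< good_time t >] ]| <= D)%N ->
  lin_dec k' (user_rx H G lin_code w ZR k' (Z k')) w (k, k') = w (k, k').
Proof.
move=> bad; rewrite ffunE /=.
set Y := user_rx _ _ _ _ _ _ _.
have close t (s : streams k k') : good_time t ->
    nsq (est k' Y w (val s) t - msg_sym (w (k, k')) s t) <= thr.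
  move=> gt; rewrite -symE /Y; case: s => s /= /andP[_ /eqP <-].
  exact: est_close.
case: pickP => [mu /= tmu|/(_ (w (k, k')))]; last first.
  rewrite /test => /negP[]; apply: leq_trans bad; apply: subset_leq_card.
  apply/fintype.subsetP => t; rewrite !inE => /existsP[s hs]; apply/negP => /asboolP gt.
  by move: hs; rewrite ltNge close.
apply: cw_dist; rewrite /hdist mul2n -addnn.
apply: leq_trans (leq_add tmu bad).
rewrite -cardUI; apply: leq_trans (leq_addr _ _).
apply: subset_leq_card; apply/fintype.subsetP => t; rewrite !inE.
apply: contraNT; rewrite negb_or => /andP[/fintype.existsPn ht /negPn/asboolP gt].
apply/eqP/ffunP => s; apply: qam_inj.
apply: le_trans (nsqB_le (est k' Y w (val s) t) _ _) _.
have := ht s; rewrite -leNgt => h1; have h2 := close t s gt.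
rewrite /msg_sym in h1 h2; lra.
Qed.
End LinearScheme.

(** * Measurability of the error events *)

Section ComplexMeasurable.
Context {R : realType} {d : measure_display} {Omega : measurableType d}.
Local Notation C := R[i].

Definition cmeasurable (f : Omega -> C) :=
  measurable_fun setT (fun o => complex.Re (f o)) /\
  measurable_fun setT (fun o => complex.Im (f o)).

Lemma cmeasurable_cst z : cmeasurable (fun=> z).
Proof. by split; exact: measurable_cst. Qed.

Lemma cmeasurableD f g : cmeasurable f -> cmeasurable g -> cmeasurable (fun o => f o + g o).
Proof.
move=> [fr fi] [gr gi]; split.
  rewrite (_ : (fun o => _) = (fun o => complex.Re (f o)) \+ (fun o => complex.Re (g o))).
    exact: measurable_funD.
  by apply/funext => o /=; case: (f o) (g o) => [? ?] [? ?].
rewrite (_ : (fun o => _) = (fun o => complex.Im (f o)) \+ (fun o => complex.Im (g o))).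
  exact: measurable_funD.
by apply/funext => o /=; case: (f o) (g o) => [? ?] [? ?].
Qed.

Lemma cmeasurableZ z f : cmeasurable f -> cmeasurable (fun o => z * f o).
Proof.
move=> [fr fi]; split.
  rewrite (_ : (fun o => _) = (fun o => complex.Re z * complex.Re (f o)) \-
      (fun o => complex.Im z * complex.Im (f o))).
    by apply: measurable_funB; apply: measurable_funM => //; exact: measurable_cst.
  by apply/funext => o /=; case: z (f o) => [? ?] [? ?].
rewrite (_ : (fun o => _) = (fun o => complex.Re z * complex.Im (f o)) \+
    (fun o => complex.Im z * complex.Re (f o))).
  by apply: measurable_funD; apply: measurable_funM => //; exact: measurable_cst.
by apply/funext => o /=; case: z (f o) => [? ?] [? ?].
Qed.

Lemma cmeasurable_sum (J : Type) (s : seq J) (f : J -> Omega -> C) :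
  (forall j, cmeasurable (f j)) -> cmeasurable (fun o => \sum_(j <- s) f j o).
Proof.
move=> mf; elim: s => [|j s IH].
  by under eq_fun do rewrite big_nil; exact: cmeasurable_cst.
by under eq_fun do rewrite big_cons; exact: cmeasurableD.
Qed.

Lemma cmeasurable_if (b : Omega -> bool) f g : measurable_fun setT b ->
  cmeasurable f -> cmeasurable g -> cmeasurable (fun o => if b o then f o else g o).
Proof.
move=> mb [fr fi] [gr gi]; split.
  rewrite (_ : (fun o => _) = (fun o => if b o then complex.Re (f o) else complex.Re (g o))).
    exact: measurable_fun_ifT.
  by apply/funext => o; case: (b o).
rewrite (_ : (fun o => _) = (fun o => if b o then complex.Im (f o) else complex.Im (g o))).
  exact: measurable_fun_ifT.
by apply/funext => o; case: (b o).
Qed.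

Lemma measurable_nsq f : cmeasurable f -> measurable_fun setT (fun o => nsq (f o)).
Proof. by move=> [fr fi]; apply: measurable_funD; exact: measurable_funX. Qed.

Definition mxmeasurable m n (A : Omega -> 'M[C]_(m, n)) :=
  forall i j, cmeasurable (fun o => A o i j).

Lemma mxmeasurableM m n p (A : 'M[C]_(m, n)) (B : Omega -> 'M[C]_(n, p)) :
  mxmeasurable B -> mxmeasurable (fun o => A *m B o).
Proof.
move=> mB i j; under eq_fun do rewrite mxE.
by apply: cmeasurable_sum => k; exact: cmeasurableZ.
Qed.

Lemma mxmeasurableD m n (A B : Omega -> 'M[C]_(m, n)) :
  mxmeasurable A -> mxmeasurable B -> mxmeasurable (fun o => A o + B o).
Proof. by move=> mA mB i j; under eq_fun do rewrite mxE; exact: cmeasurableD. Qed.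

Lemma mxmeasurable_cst m n (A : 'M[C]_(m, n)) : mxmeasurable (fun=> A).
Proof. by move=> i j; exact: cmeasurable_cst. Qed.

Lemma mxmeasurableZ m n z (A : Omega -> 'M[C]_(m, n)) :
  mxmeasurable A -> mxmeasurable (fun o => z *: A o).
Proof. by move=> mA i j; under eq_fun do rewrite mxE; exact: cmeasurableZ. Qed.

Lemma mxmeasurable_col m n t (A : Omega -> 'M[C]_(m, n)) :
  mxmeasurable A -> mxmeasurable (fun o => col t (A o)).
Proof. by move=> mA i j; under eq_fun do rewrite mxE; exact: mA. Qed.

Lemma measurable_fro m n (A : Omega -> 'M[C]_(m, n)) :
  mxmeasurable A -> measurable_fun setT (fun o => fro (A o)).
Proof.
move=> mA; apply: measurable_sum => i; apply: measurable_sum => j.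
by apply: measurable_nsq; exact: mA.
Qed.

(** Finite union over the truth tables accepted by [phi]. The decoder depends on the noise through
    finitely many threshold comparisons, so its error events have this form. *)
Lemma measurable_bool_comb (J : finType) (b : J -> Omega -> bool) (phi : {ffun J -> bool} -> bool) :
  (forall j, measurable [set o | b j o]) ->
  measurable [set o | phi [ffun j => b j o]].
Proof.
move=> mb; rewrite (_ : [set o | _] = \bigcup_(f in [set f | phi f])
   \bigcap_(j in [set: J]) [set o | b j o = f j]).
  apply: fin_bigcup_measurable => [|f _]; first exact: finite_finset.
  apply: fin_bigcap_measurable => // j _; case: (f j); first exact: mb.
  rewrite (_ : [set o | _] = ~` [set o | b j o]); first exact: measurableC.
  by apply/seteqP; split => x /=; [move=> ->|move/negP/negbTE].
apply/seteqP; split => [x /= px|x [f /= pf fx]].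
  by exists [ffun j => b j x] => // j _; rewrite /= ffunE.
rewrite (_ : [ffun j => _] = f)//; apply/ffunP => j; rewrite ffunE; exact: fx.
Qed.
End ComplexMeasurable.

Section ErrorEventMeasurable.
Context {R : realType} {K M N : nat}.
Context (H : 'I_K -> 'M[R[i]]_(N, M)) (G : 'I_K -> 'M[R[i]]_(M, N)).
Context {S : finType} (src dst : S -> 'I_K).
Context (v : S -> 'cV[R[i]]_M) (u : S -> 'rV[R[i]]_M) (F : 'M[R[i]]_N).
Context (T Q D : nat) (a thr P gam : R) (m : 'I_K -> 'I_K -> nat).
Context (cw : forall i j, 'I_(m i j).+1 ->
  {ffun 'I_T -> {ffun streams src dst i j -> 'I_Q.+1 * 'I_Q.+1}}).
Local Notation code := (lin_code H G v u F D a thr P gam cw).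

Context (sigma2 : R) {d : measure_display} {Omega : measurableType d}.
Context (Pr : probability Omega R).
Context (ZR : Omega -> 'M[R[i]]_(N, T)) (Z : 'I_K -> Omega -> 'M[R[i]]_(M, T)).
Hypothesis gauss : gaussian_noise sigma2 Pr ZR Z.

Lemma mxmeasurable_ZR : mxmeasurable ZR.
Proof.
move=> i t; split; [have := gauss.1 (inl (i, t), false)|have := gauss.1 (inl (i, t), true)];
  by [].
Qed.

Lemma mxmeasurable_Z k : mxmeasurable (Z k).
Proof.
move=> i t; split; [have := gauss.1 (inr (k, i, t), false)|have := gauss.1 (inr (k, i, t), true)];
  by [].
Qed.

Lemma mxmeasurable_user_rx k' w :
  mxmeasurable (fun o => user_rx H G code w (ZR o) k' (Z k' o)).
Proof.
apply: mxmeasurableD; last exact: mxmeasurable_Z.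
apply: mxmeasurableM => i t /=.
have mY : mxmeasurable (fun o => (gam%:C)%C *: (F *m col t (relay_rx H code w (ZR o)))).
  apply: mxmeasurableZ; apply: mxmeasurableM; apply: mxmeasurable_col.
  by apply: mxmeasurableD; [exact: mxmeasurable_cst|exact: mxmeasurable_ZR].
rewrite (_ : (fun o => _) = fun o =>
  if fro ((gam%:C)%C *: (F *m col t (relay_rx H code w (ZR o)))) <= P
  then ((gam%:C)%C *: (F *m col t (relay_rx H code w (ZR o)))) i 0 else 0).
  apply: cmeasurable_if; [|exact: mY|exact: cmeasurable_cst].
  by apply: measurable_fun_ler; [exact: measurable_fro|exact: measurable_cst].
by apply/funext => o; rewrite mxE /clip; case: ifP => // _; rewrite mxE.
Qed.

Lemma measurable_err_event k k' w : measurable (err_event H G code ZR Z k k' w).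
Proof.
pose b (j : 'I_T * streams src dst k k' * 'I_(m k k').+1) o : bool :=
  thr < nsq (est H G v u F a gam cw k' (user_rx H G code w (ZR o) k' (Z k' o)) w
    (val j.1.2) j.1.1 - msg_sym a cw j.2 j.1.2 j.1.1).
pose phi (f : {ffun 'I_T * streams src dst k k' * 'I_(m k k').+1 -> bool}) : bool :=
  odflt ord0 [pick mu | (#|[pred t | [exists s, f (t, s, mu)]]| <= D)%N] != w (k, k').
rewrite (_ : err_event _ _ _ _ _ _ _ _ = [set o | phi [ffun j => b j o]]).
  apply: measurable_bool_comb => -[[t s] mu].
  have mX : measurable_fun setT (fun o => nsq (est H G v u F a gam cw k'
      (user_rx H G code w (ZR o) k' (Z k' o)) w (val s) t - msg_sym a cw mu s t)).
    apply: measurable_nsq; apply: cmeasurableD; last exact: cmeasurable_cst.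
    apply: cmeasurableD; last exact: cmeasurable_cst.
    apply: cmeasurableZ; apply: mxmeasurableM; apply: mxmeasurable_col.
    exact: mxmeasurable_user_rx.
  have := measurable_fun_ltr (measurable_cst thr) mX.
  move=> /(_ measurableT [set true]); rewrite setTI; exact.
apply/funext => o; rewrite /err_event /phi /= ffunE /=.
congr (is_true (odflt _ _ != _)); apply: eq_pick => mu; congr (_ <= D)%N.
by apply: eq_card => t; rewrite !inE; apply: eq_existsb => s; rewrite ffunE.
Qed.
End ErrorEventMeasurable.

(** * Rates of the linear scheme *)

Section AchievableRate.
Context {R : realType} {K M N : nat}.
Context (H : 'I_K -> 'M[R[i]]_(N, M)) (G : 'I_K -> 'M[R[i]]_(M, N)).
Context {S : finType} (src dst : S -> 'I_K).
Context (v : S -> 'cV[R[i]]_M) (u : S -> 'rV[R[i]]_M) (F : 'M[R[i]]_N).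
Hypothesis src_dst : forall s, src s != dst s.
Hypothesis zero_forcing : forall s t, src t != dst s ->
  (u s *m G (dst s) *m F *m H (src t) *m v t) 0 0 = (s == t)%:R.

Definition nstreams i j := #|{: streams src dst i j}|.

Lemma card_noise_idx T : #|{: noise_idx K M N T}| = ((N + K * M) * 2 * T)%N.
Proof.
rewrite card_prod card_sum !card_prod !card_ord card_bool; lia.
Qed.

Definition noise_time T (j : noise_idx K M N T) : 'I_T :=
  match j with (inl (_, t), _) => t | (inr (_, _, t), _) => t end.

Lemma codebooks T Q D :
  exists (m : 'I_K -> 'I_K -> nat) (cw : forall i j, 'I_(m i j).+1 ->
      {ffun 'I_T -> {ffun streams src dst i j -> 'I_Q.+1 * 'I_Q.+1}}),
    [/\ forall k, m k k = 0%N,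
        forall i j mu mu', (hdist (cw i j mu) (cw i j mu') <= D)%N -> mu = mu' &
        forall i j, ((Q.+1 ^ 2) ^ (nstreams i j * T) <=
          (m i j).+1 * (2 ^ T * (Q.+1 ^ 2) ^ (nstreams i j * D)))%N].
Proof.
pose A i j : finType := {ffun streams src dst i j -> 'I_Q.+1 * 'I_Q.+1}.
have cA i j : #|A i j| = ((Q.+1 ^ 2) ^ nstreams i j)%N.
  by rewrite card_ffun card_prod card_ord.
have A0 i j : (0 < #|A i j|)%N by rewrite cA !expn_gt0.
have gv i j : exists (m : nat) (cw : 'I_m.+1 -> {ffun 'I_T -> A i j}),
    (forall mu mu', (hdist (cw mu) (cw mu') <= D)%N -> mu = mu') /\
    ((Q.+1 ^ 2) ^ (nstreams i j * T) <=
      m.+1 * (2 ^ T * (Q.+1 ^ 2) ^ (nstreams i j * D)))%N.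
  have := @gilbert_varshamov (A i j) T D (A0 i j).
  by rewrite cA -(expnM _ _ T) -(expnM _ _ D).
pose E i j := cid (gv i j).
pose E2 i j := cid (svalP (E i j)).
exists (fun i j => sval (E i j)), (fun i j => sval (E2 i j)); split.
(* No stream goes from a user to itself, so all words over that alphabet coincide and separation
   leaves a single codeword. *)
- move=> k; have [dk _] := svalP (E2 k k).
  have st_false (s : streams src dst k k) : False.
    by case: s => s /= /andP[/eqP sk /eqP dk']; have := src_dst s; rewrite sk dk' eqxx.
  apply/eqP; apply: contraT; rewrite -lt0n => m0.
  pose o1 := Ordinal (m0 : (1 < (sval (E k k)).+1)%N).
  have e : sval (E2 k k) ord0 = sval (E2 k k) o1.
    by apply/ffunP => t; apply/ffunP => s; case: (st_false s).
  by have := dk ord0 o1; rewrite e hdistxx => /(_ isT)/(congr1 val).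
- by move=> i j; have [+ _] := svalP (E2 i j).
- by move=> i j; have [_ +] := svalP (E2 i j).
Qed.

Context (sigma2 : R).
Hypothesis sigma2_gt0 : 0 < sigma2.

(** Constants independent of the SNR: [cg * P] bounds the energy at the relay output before the gain
    [gam], so [gam] prevents clipping; [cthr * B ^+ 2] bounds the error of an estimate;
    [cV * (a * Q%:R) ^+ 2] bounds the transmitted energy. *)
Let cg : R := N%:R * fro F * (2 * (K%:R * (\sum_(k < K) M%:R * fro (H k)) + N%:R * 2)).
Let gam := (1 + cg)^-1.
Let cthr : R := \sum_s 2 * (N%:R * fro (u s *m G (dst s) *m F) * (N%:R * 2) +
  gam^-1 ^+ 2 * (M%:R * fro (u s) * (M%:R * 2))).
Let cV : R := 2 * #|S|%:R * (\sum_s fro (v s)) + 1.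

Let cg_ge0 : 0 <= cg.
Proof.
rewrite mulr_ge0 ?mulr_ge0 ?addr_ge0 ?mulr_ge0 ?fro_ge0 ?sumr_ge0// => k _.
by rewrite mulr_ge0 ?fro_ge0.
Qed.

Let gam_gt0 : 0 < gam. Proof. by rewrite invr_gt0 ltr_wpDr. Qed.

Let thr_term_ge0 s : 0 <= 2 * (N%:R * fro (u s *m G (dst s) *m F) * (N%:R * 2) +
  gam^-1 ^+ 2 * (M%:R * fro (u s) * (M%:R * 2))).
Proof.
by do ?[exact: fro_ge0 | exact: sqr_ge0 | exact: ler0n | apply: mulr_ge0 | apply: addr_ge0].
Qed.

Let cthr_ge0 : 0 <= cthr. Proof. exact: sumr_ge0. Qed.

Let cV_gt0 : 0 < cV.
Proof.
rewrite ltr_wpDl// mulr_ge0// ?mulr_ge0//.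
by apply: sumr_ge0 => s _; exact: fro_ge0.
Qed.

Lemma block_code T Q D (B P a eps : R) : (0 < T)%N -> 0 < B -> B ^+ 2 <= P ->
  a = B * (4 * cthr + 1) -> cV * (a * Q%:R) ^+ 2 <= P ->
  2 ^+ ((N + K * M) * 2 * T) *
    fine (normal_prob 0 (Num.sqrt (sigma2 / 2)) (big_abs B)) ^+ D.+1 <= eps ->
  exists (n : 'I_K -> 'I_K -> nat) (c : Defs.code R M N T n),
    [/\ code_valid P c,
      (forall k k', ((Q.+1 ^ 2) ^ (nstreams k k' * T) <=
          n k k' * (2 ^ T * (Q.+1 ^ 2) ^ (nstreams k k' * (2 * D))))%N) &
      forall (d : measure_display) (Omega : measurableType d)
             (Pr : probability Omega R)
             (ZR : Omega -> 'M[R[i]]_(N, T)) (Z : 'I_K -> Omega -> 'M[R[i]]_(M, T)),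
        gaussian_noise sigma2 Pr ZR Z ->
        forall k k', k != k' ->
         (forall w, measurable (err_event H G c ZR Z k k' w)) /\
         err_prob H G c Pr ZR Z k k' <= eps].
Proof.
move=> T0 B0 BP aE aP noise.
have P0 : 0 <= P by apply: le_trans BP; exact: sqr_ge0.
have a0 : 0 < a by rewrite aE mulr_gt0// ltr_wpDl// mulr_ge0.
have [m [cw [mkk cwd cwn]]] := codebooks T Q (2 * D).
pose thr := cthr * B ^+ 2.
exists (fun i j => (m i j).+1), (lin_code H G v u F D a thr P gam cw).
have pow k w t : fro (col t (lin_enc v a cw k w)) <= P.
  rewrite col_lin_enc big_mkcond /=; apply: le_trans (fro_sum_le _) _.
  apply: le_trans aP; apply: (@le_trans _ _ (#|S|%:R * \sum_s 2 * (a * Q%:R) ^+ 2 * fro (v s))).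
    rewrite ler_wpM2l//; apply: ler_sum => s _; case: ifP => _; last first.
      rewrite fro0.
      by do ?[exact: fro_ge0 | exact: sqr_ge0 | exact: ler0n | apply: mulr_ge0 | apply: addr_ge0].
    rewrite froZ ler_wpM2r ?fro_ge0// /sym /msg_sym /qam /nsq /=.
    set x := (cw _ _ _ t _).
    have le1 (q : 'I_Q.+1) : (a * q%:R) ^+ 2 <= (a * Q%:R) ^+ 2.
      apply: lerXn2r; [by rewrite nnegrE mulr_ge0// ltW|by rewrite nnegrE mulr_ge0// ltW|].
      by rewrite ler_pM2l// ler_nat -ltnS ltn_ord.
    by have := le1 x.1; have := le1 x.2; lra.
  rewrite -mulr_sumr /cV mulrDl mul1r; have := sqr_ge0 (a * Q%:R).
  by rewrite [X in _ -> X <= _](_ : _ = 2 * #|S|%:R * (\sum_s fro (v s)) * (a * Q%:R) ^+ 2); [lra|ring].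
split.
- exact: lin_code_valid.
- exact: cwn.
move=> d Omega Pr ZR Z gauss k k' kk'.
have merr w : measurable (err_event H G (lin_code H G v u F D a thr P gam cw) ZR Z k k' w).
  exact: measurable_err_event gauss _ _ _.
split=> //.
have mM := measurable_many_big gauss B D.
have sub w : err_event H G (lin_code H G v u F D a thr P gam cw) ZR Z k k' w `<=`
    many_big ZR Z B D.
  move=> o; rewrite /err_event /= => err; rewrite /many_big /= ltnNge.
  apply: contra err => few; apply/eqP.
  apply: (@lin_dec_correct _ _ _ _ _ _ _ _ _ _ _ _ _ _ _ _ _ _ _ _ _
    pow src_dst zero_forcing (ZR o) (fun k => Z k o) B) => //.
  - have h1 : N%:R * fro F * (2 * (K%:R * (\sum_(k0 < K) M%:R * fro (H k0) * P) +
        N%:R * (2 * B ^+ 2))) <= cg * P.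
      rewrite -mulr_suml /cg -[X in _ <= X]mulrA ler_wpM2l ?mulr_ge0 ?fro_ge0//.
      rewrite -[X in _ <= X]mulrA ler_wpM2l// [X in _ <= X]mulrDl lerD//; first by rewrite mulrA.
      by rewrite -mulrA ler_wpM2l// ler_wpM2l.
    apply: (@le_trans _ _ (gam ^+ 2 * (cg * P))); first by rewrite ler_wpM2l ?sqr_ge0.
    have gE : gam * (1 + cg) = 1 by rewrite mulVf// gt_eqF// ltr_wpDr.
    have := cg_ge0; have := gam_gt0 => g0 c0.
    have g1 : gam <= 1 by rewrite invf_le1 ?lerDl// ltr_wpDr.
    have gc : gam * cg <= 1 by rewrite -gE ler_pM2l// lerDr.
    rewrite expr2 -mulrA [gam * (cg * P)]mulrA -[X in _ <= X]mul1r.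
    apply: ler_pM => //; first exact: ltW.
      by rewrite mulr_ge0// mulr_ge0// ltW.
    by rewrite -[X in _ <= X]mul1r ler_wpM2r.
  - move=> s; rewrite /thr /cthr mulr_suml (bigD1 s)//=.
    apply: (@le_trans _ _ (2 * (N%:R * fro (u s *m G (dst s) *m F) * (N%:R * 2) +
      gam^-1 ^+ 2 * (M%:R * fro (u s) * (M%:R * 2))) * B ^+ 2)); first by rewrite le_eqVlt; apply/orP; left; apply/eqP; ring.
    by rewrite lerDl; apply: sumr_ge0 => s' _; rewrite mulr_ge0 ?sqr_ge0.
  (* The spacing was chosen so that [(4 * cthr + 1) ^+ 2] exceeds [4 * cthr]. *)
  - rewrite aE exprMn /thr mulrA [B ^+ 2 * _]mulrC ltr_pM2r ?exprn_gt0//.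
    nra.
  (* Every bad time carries a large noise component, so there are at most as many bad times as large
     components. *)
  - apply: leq_trans few.
    pose bad := [pred j : noise_idx K M N T | (B < `|noise_comp ZR Z j o|)%R].
    apply: (@leq_trans #|[set noise_time j | j in bad]|%SET); last exact: leq_imset_card.
    apply: subset_leq_card; apply/fintype.subsetP => t; rewrite !inE => nt.
    apply/imsetP; move: nt; apply: contraNP => nj; apply/asboolP.
    have nb (j : noise_idx K M N T) : noise_time j = t -> `|noise_comp ZR Z j o| <= B.
      move=> jt; rewrite leNgt; apply/negP => jB; apply: nj.
      by exists j.
    split => [i'|i'|k0 i'|k0 i'].
    + exact: (nb (inl (i', t), false)).
    + exact: (nb (inl (i', t), true)).
    + exact: (nb (inr (k0, i', t), false)).
    + exact: (nb (inr (k0, i', t), true)).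
have m0 : 0 < #|{: msg (fun i j => (m i j).+1)}|%:R :> R.
  rewrite ltr0n; apply/card_gt0P.
  by exists (finfun (fun p : 'I_K * 'I_K => ord0 : 'I_(m p.1 p.2).+1)).
rewrite /err_prob ler_pdivrMl// mulr_natl -sumr_const; apply: ler_sum => w _.
apply: le_trans noise; rewrite -card_noise_idx.
apply: le_trans (many_big_le gauss B D).
rewrite fine_le ?fin_num_measure// le_measure ?inE//.
Qed.

(** A symbol carries [2 * ln Q.+1%:R] nats. The distance [2 * D] costs at most the fraction
    [2 / L%:R] of them, and the ball bound [ln 2] per channel use, here charged to every stream. *)
Lemma rate_of_card (T Q D L n d : nat) (r snr : R) : (0 < L)%N -> (D * L <= T)%N ->
  0 <= r -> r * ln snr + ln 2 <= (1 - 2 / L%:R) * (2 * ln Q.+1%:R) ->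
  ((Q.+1 ^ 2) ^ (d * T) <= n * (2 ^ T * (Q.+1 ^ 2) ^ (d * (2 * D))))%N ->
  expR (T%:R * (r * d%:R * ln snr)) <= n%:R.
Proof.
move=> L0 DT r0 rate card.
have n0 : (0 < n)%N.
  by case: n card => //; rewrite mul0n leqn0 expn_eq0 expn_eq0.
case: d card => [|d] card; first by rewrite mulr0 mul0r mulr0 expR0 ler1n.
set ell := 2 * ln Q.+1%:R in rate.
have ell0 : 0 <= ell by rewrite mulr_ge0// ln_ge0// ler1n.
have LR : 0 < L%:R :> R by rewrite ltr0n.
have Qe : (Q.+1 ^ 2)%N%:R = expR ell.
  by rewrite natrX /ell expRM_natl lnK// posrE ltr0n.
have : expR ((d.+1 * T)%:R * ell) <=
    n%:R * (expR (T%:R * ln 2) * expR ((d.+1 * (2 * D))%:R * ell)).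
  have eM k : expR (k%:R * ell) = expR ell ^+ k := expRM_natl _ _.
  by rewrite !eM expRM_natl lnK ?posrE// -Qe -!natrX -!natrM ler_nat.
rewrite -expRD -ler_pdivrMr ?expR_gt0// -expRN -expRD => h.
apply: le_trans h; rewrite ler_expR !natrM.
have DL : D%:R <= T%:R / L%:R :> R by rewrite ler_pdivlMr// -natrM ler_nat.
have d1 : 1 <= d.+1%:R :> R by rewrite ler1n.
have T0 : 0 <= T%:R :> R by [].
have ln2 : 0 <= ln 2 :> R by rewrite ln_ge0// ler1n.
have h1 : d.+1%:R * (2 * D%:R) * ell <= d.+1%:R * (2 * (T%:R / L%:R)) * ell.
  by rewrite ler_wpM2r// ler_wpM2l// ler_wpM2l.
have h2 : T%:R * d.+1%:R * (r * ln snr + ln 2) <=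
    T%:R * d.+1%:R * ((1 - 2 / L%:R) * ell) by rewrite ler_wpM2l// mulr_ge0.
have h3 : T%:R * ln 2 <= T%:R * d.+1%:R * ln 2 :> R.
  by rewrite ler_wpM2r// ler_peMr.
have -> : T%:R * (r * d.+1%:R * ln snr) = T%:R * d.+1%:R * (r * ln snr) by ring.
have e2 : T%:R * d.+1%:R * ((1 - 2 / L%:R) * ell) =
  d.+1%:R * T%:R * ell - d.+1%:R * (2 * (T%:R / L%:R)) * ell.
  by field; rewrite gt_eqF.
rewrite e2 mulrDr in h2; lra.
Qed.

Lemma achievable_rate r : 0 <= r < 1 -> exists2 snr0 : R, 1 <= snr0 &
  forall snr, snr0 <= snr -> achievable H G (snr * sigma2) sigma2
    (fun i j => r * (nstreams i j)%:R * ln snr).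
Proof.
move=> /andP[r0 r1]; have r1' : 0 < 1 - r by rewrite subr_gt0.
(* Two of the three parts [1 / L%:R] pay for the code distance; the third, a multiple of [ln snr],
   absorbs the constants [ln 2] and [ln kap]. *)
pose L := (Num.truncn (3 / (1 - r))).+1.
have L1 : 3 / (1 - r) < L%:R by apply: truncnS_gt.
have LR : 0 < L%:R :> R by rewrite ltr0n.
have L3 : 3 < (1 - r) * L%:R by rewrite mulrC -ltr_pdivrMr.
have L3' : 3 <= L%:R :> R.
  by apply: le_trans (ltW L3) _; rewrite ler_piMl// lerBlDr lerDl.
pose c := ((N + K * M) * 2)%N.
(* The tail probability has to beat the [2 ^+ (c * T)] sets of components: as [T <= L * D.+1], this
   choice leaves an error of at most [2^-1 ^+ D.+1]. *)
have pe0 : 0 < (2^-1 : R) ^+ (c * L).+1 by rewrite exprn_gt0.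
have [B B0 hB] := normal_tail (Num.sqrt (sigma2 / 2)) pe0.
set p := fine _ in hB.
have p0 : 0 <= p by rewrite /p fine_ge0.
pose a := B * (4 * cthr + 1).
have a0 : 0 < a by rewrite mulr_gt0// ltr_wpDl// mulr_ge0.
pose kap := sigma2 / (cV * a ^+ 2).
have kap0 : 0 < kap by rewrite divr_gt0// mulr_gt0// exprn_gt0.
pose snr0 := Num.max (Num.max 1 (B ^+ 2 / sigma2)) (expR (L%:R * (1 + `|ln kap|))).
exists snr0; first by rewrite /snr0 !le_max lexx.
move=> snr; rewrite /snr0 !ge_max => /andP[/andP[snr1 snrB] snrL].
have snr_gt0 : 0 < snr by apply: lt_le_trans snr1.
have P0 : 0 < snr * sigma2 by rewrite mulr_gt0.
have BP : B ^+ 2 <= snr * sigma2 by rewrite -ler_pdivrMr.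
(* The largest grid size the power permits, before rounding down to [Q]; since [y ^+ 2 = snr * kap],
   a symbol carries [ln snr] nats up to a constant. *)
pose y := Num.sqrt (snr * sigma2 / cV) / a.
have y_gt0 : 0 < y by rewrite divr_gt0 ?sqrtr_gt0 ?divr_gt0.
have y0 := ltW y_gt0.
pose Q := Num.truncn y.
have y2 : y ^+ 2 = snr * kap.
  rewrite /y expr_div_n sqr_sqrtr ?divr_ge0 ?ltW// /kap; field.
  by rewrite !gt_eqF.
have aP : cV * (a * Q%:R) ^+ 2 <= snr * sigma2.
  have Qy : Q%:R <= y by rewrite /Q truncn_le.
  have : Q%:R ^+ 2 <= y ^+ 2 by apply: lerXn2r; rewrite ?nnegrE.
  rewrite y2 exprMn => h.
  apply: (@le_trans _ _ (cV * a ^+ 2 * (snr * kap))).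
    by rewrite mulrA ler_wpM2l// mulr_ge0 ?sqr_ge0// ltW.
  by rewrite le_eqVlt; apply/orP; left; apply/eqP; rewrite /kap; field; rewrite !gt_eqF.
have lnQ : ln snr + ln kap <= 2 * ln Q.+1%:R.
  rewrite -lnM ?posrE// -y2 mulr_natl -lnXn ?ltr0n// ler_ln ?posrE ?exprn_gt0//.
  by apply: lerXn2r; rewrite ?nnegrE// ltW// truncnS_gt.
have lnsnr : L%:R * (1 + `|ln kap|) <= ln snr by rewrite -ler_expR lnK.
have ln2 : ln 2 <= 1 :> R.
  by rewrite -ler_expR lnK ?posrE//; have := @expR_ge1Dx R 1; lra.
have rate : r * ln snr + ln 2 <= (1 - 2 / L%:R) * (2 * ln Q.+1%:R).
  have iL : 0 <= 1 - 2 / L%:R :> R by rewrite subr_ge0 ler_pdivrMr// mul1r; lra.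
  have h1 : (1 - 2 / L%:R) * (ln snr + ln kap) <= (1 - 2 / L%:R) * (2 * ln Q.+1%:R).
    by rewrite ler_wpM2l.
  have h2 : (1 - 2 / L%:R) * - `|ln kap| <= (1 - 2 / L%:R) * ln kap.
    by rewrite ler_wpM2l// lerNl -normrN ler_norm.
  have h3 : (1 - 2 / L%:R) * `|ln kap| <= `|ln kap|.
    by rewrite ler_piMl// lerBlDr lerDl divr_ge0// ltW.
  have h4 : 1 + `|ln kap| <= ln snr / L%:R by rewrite ler_pdivlMr// mulrC.
  have lns0 : 0 <= ln snr by rewrite ln_ge0.
  have h5 : r * ln snr <= (1 - 3 / L%:R) * ln snr.
    rewrite ler_wpM2r//; have : 3 / L%:R <= 1 - r by rewrite ler_pdivrMr// ltW.
    lra.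
  have e : (1 - 2 / L%:R) * ln snr = (1 - 3 / L%:R) * ln snr + ln snr / L%:R by field; rewrite gt_eqF.
  rewrite mulrDr in h1; rewrite mulrN in h2; lra.
move=> eps eps0.
exists (L * (Num.truncn eps^-1).+1)%N => T hT.
have T0 : (0 < T)%N by apply: leq_trans hT; rewrite muln_gt0.
pose D := (T %/ L)%N.
have DT : (D * L <= T)%N by apply: leq_divM.
have TD : (T <= L * D.+1)%N by rewrite ltnW// mulnC ltn_ceil.
have De : (Num.truncn eps^-1 < D.+1)%N.
  by rewrite ltnS ltnW// leq_divRL// mulnC.
have noise : 2 ^+ ((N + K * M) * 2 * T) * p ^+ D.+1 <= eps.
  apply: (@le_trans _ _ (2 ^+ (c * L * D.+1) * ((2^-1) ^+ (c * L).+1) ^+ D.+1)).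
    apply: ler_pM => //; rewrite ?exprn_ge0//.
      by apply: ler_weXn2l; rewrite ?ler1n// -/c -(mulnA c) leq_mul2l TD orbT.
    by apply: lerXn2r; rewrite ?nnegrE// ltW.
  have cancel (x : R) k q : x != 0 -> x ^+ (k * q) * (x^-1 ^+ k.+1) ^+ q = x^-1 ^+ q.
    by move=> x0; rewrite exprM -exprMn exprSr mulrA -exprMn divff// expr1n mul1r.
  rewrite [X in X <= _](cancel 2)//.
  rewrite exprVn -[eps]invrK lef_pV2 ?posrE ?invr_gt0 ?exprn_gt0//.
  apply: ltW; apply: lt_le_trans (truncnS_gt _) _.
  rewrite -natrX ler_nat; apply: leq_trans De _; apply: ltnW; exact: ltn_expl.
have [n [cd [cdP cdn perf]]] := block_code T0 B0 BP (erefl _) aP noise.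
exists n, cd; split=> //; split=> // k k' _.
exact: rate_of_card rate (cdn k k').
Qed.
End AchievableRate.

Section AchievableDof.
Context {R : realType} {K M N : nat}.
Context (H : 'I_K -> 'M[R[i]]_(N, M)) (G : 'I_K -> 'M[R[i]]_(M, N)).

(** Fallback when [snr <= 1], where [ln snr] is not positive, and witness that the set of achievable
    prelogs is nonempty. *)
Lemma achievable0 (P sigma2 : R) : 0 <= P -> achievable H G P sigma2 (fun _ _ => 0).
Proof.
move=> P0 eps eps0; exists 0%N => T _.
pose n := fun _ _ : 'I_K => 1%N.
exists n, (Defs.Code (fun _ _ => 0) (fun _ => 0) (fun _ _ _ => finfun (fun p => ord0))).
have pow0 m : avg_power (0 : 'M[R[i]]_(m, T)) <= (P%:C)%C.
  by rewrite avg_powerE fro0 mulr0 lecR.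
split; first by split.
split=> [k k' _|d Omega Pr ZR Z gauss k k' kk'].
  by rewrite mulr0 expR0.
have e0 w : err_event H G (Defs.Code (fun _ _ => 0) (fun _ => 0)
    (fun _ _ _ => finfun (fun p => ord0 : 'I_(n p.1 p.2)))) ZR Z k k' w = set0.
  by apply/seteqP; split => o //; rewrite /err_event /= !ord1 eqxx.
split=> [w|]; first by rewrite e0.
by rewrite /err_prob big1 ?mulr0 ?ltW// => w _; rewrite e0 measure0.
Qed.

Context {S : finType} (src dst : S -> 'I_K).
Context (v : S -> 'cV[R[i]]_M) (u : S -> 'rV[R[i]]_M) (F : 'M[R[i]]_N) (sigma2 : R).
Hypothesis src_dst : forall s, src s != dst s.
Hypothesis zero_forcing : forall s t, src t != dst s ->
  (u s *m G (dst s) *m F *m H (src t) *m v t) 0 0 = (s == t)%:R.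
Hypotheses (sigma2_gt0 : 0 < sigma2) (K_gt0 : (0 < K)%N).

Lemma sum_nstreams : (\sum_(i < K) \sum_(j < K | j != i) nstreams src dst i j = #|S|)%N.
Proof.
have cE i j : nstreams src dst i j = (\sum_(s | (src s == i) && (dst s == j)) 1)%N.
  by rewrite /nstreams card_sig sum1_card.
under eq_bigr do under eq_bigr do rewrite cE.
rewrite -sum1_card (partition_big src predT)//=; apply: eq_bigr => i _.
rewrite [RHS](partition_big dst (fun j => j != i))//= => s /eqP <-.
by rewrite eq_sym.
Qed.

(** A prelog [r < 1] is available only beyond a threshold depending on [r], whereas one family of
    rates must reach the limit. At each SNR the prelog is taken within [snr^-1] of the supremum of
    the achievable ones, which forces it to tend to 1. *)
Lemma dof_achievable : dof_user_achievable H G sigma2 (#|S|%:R / K%:R).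
Proof.
pose rate r (snr : R) i j := r * (nstreams src dst i j)%:R * ln snr.
pose good snr : set R := [set r | 0 <= r <= 1 /\
  achievable H G (snr * sigma2) sigma2 (rate r snr)].
have good0 snr : 0 < snr -> good snr 0.
  move=> s0; split; first by rewrite lexx ler01.
  rewrite (_ : rate 0 snr = fun _ _ => 0); first by apply: achievable0; rewrite mulr_ge0// ltW.
  by apply/funext => i; apply/funext => j; rewrite /rate !mul0r.
have near_sup snr : exists r, 0 < snr ->
    good snr r /\ forall r', good snr r' -> r' <= r + snr^-1.
  have [s0|] := boolP (0 < snr); last by exists 0.
  have hs : has_sup (good snr).
    split; first by exists 0; exact: good0.
    by exists 1 => r [/andP[]].
  have is0 : 0 < snr^-1 by rewrite invr_gt0.
  have [r gr hr] := sup_adherent is0 hs.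
  exists r => _; split=> // r' gr'.
  by have := ub_le_sup hs.2 gr'; lra.
pose rr snr := sval (cid (near_sup snr)).
have rrP snr : 0 < snr -> good snr (rr snr) /\ forall r', good snr r' -> r' <= rr snr + snr^-1.
  exact: (svalP (cid (near_sup snr))).
exists (fun snr => if 1 < snr then rate (rr snr) snr else fun _ _ => 0); split.
  move=> snr s0; have [[/andP[r0 _] ga] _] := rrP snr s0; case: ifPn => s1.
    by split=> // k k'; rewrite /rate !mulr_ge0// ln_ge0// ltW.
  by split=> //; apply: achievable0; rewrite mulr_ge0// ltW.
have KR : 0 < K%:R :> R by rewrite ltr0n.
apply/cvgrPdist_le => e e0.
pose Sz : R := #|S|%:R / K%:R.
have Sz0 : 0 <= Sz by rewrite divr_ge0.
(* The shortfall from [Sz] is at most [(dl + snr^-1) * Sz], hence at most [2 * dl * Sz] for large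
   [snr]. *)
pose dl := Num.min (1 / 2) (e / (2 * (Sz + 1))).
have dl0 : 0 < dl.
  by rewrite lt_min divr_gt0//= divr_gt0// mulr_gt0// ltr_wpDl.
have dl1 : dl <= 1 / 2 by rewrite ge_min lexx.
have dle : dl * (2 * (Sz + 1)) <= e.
  by rewrite -ler_pdivlMr ?ge_min ?lexx ?orbT// mulr_gt0// ltr_wpDl.
have r01 : 0 <= 1 - dl < 1 by apply/andP; split; lra.
have [snr0 s01 hach] := achievable_rate src_dst zero_forcing sigma2_gt0 r01.
exists (Num.max snr0 dl^-1); split; first by rewrite num_real.
move=> snr; rewrite gt_max => /andP[snr_gt snr_dl].
have s1 : 1 < snr by apply: le_lt_trans snr_gt.
have s0 : 0 < snr by apply: lt_trans s1.
have ls0 : 0 < ln snr by rewrite ln_gt0.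
have [[/andP[r0 r1] ga] hr] := rrP snr s0.
have r_ge : 1 - dl <= rr snr + snr^-1.
  apply: hr; split; first by apply/andP; split; lra.
  by apply: hach; exact: ltW.
have is_dl : snr^-1 <= dl.
  by rewrite -[dl]invrK lef_pV2 ?posrE ?invr_gt0// ltW.
rewrite s1; have -> : sum_rate (rate (rr snr) snr) / (K%:R * ln snr) = rr snr * Sz.
  have -> : sum_rate (rate (rr snr) snr) = rr snr * ln snr * #|S|%:R.
    rewrite -sum_nstreams natr_sum mulr_sumr /sum_rate; apply: eq_bigr => i _.
    by rewrite natr_sum mulr_sumr; apply: eq_bigr => j _; rewrite /rate mulrAC.
  by rewrite /Sz; field; rewrite !gt_eqF.
rewrite -/Sz -{1}[Sz]mul1r -mulrBl ger0_norm ?mulr_ge0 ?subr_ge0//.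
apply: le_trans dle; nra.
Qed.
End AchievableDof.

(** * Zero sets of polynomials *)

Section NullSets.
Context {R : realType} {I : finType} (i0 : I).
Local Notation pt := (I -> R).

Definition volume (b : pt * pt) : R := \prod_i (b.2 i - b.1 i).
Definition in_box (b : pt * pt) (x : pt) := forall i, b.1 i <= x i <= b.2 i.
Definition wf_box (b : pt * pt) := forall i, b.1 i <= b.2 i.

(** Zero Jordan content. The default of [nth] is a degenerate box, so a finite list of boxes also
    reads as a sequence. *)
Definition finitely_null (A : set pt) := forall eps : R, 0 < eps ->
  exists s : seq (pt * pt),
    [/\ forall k, wf_box (nth (fun=> 0, fun=> 0) s k), \sum_(b <- s) volume b <= eps &
        forall x, A x -> exists2 k, (k < size s)%N & in_box (nth (fun=> 0, fun=> 0) s k) x].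

Local Notation b0 := ((fun=> 0, fun=> 0) : pt * pt).

Lemma volume_ge0 b : wf_box b -> 0 <= volume b.
Proof. by move=> wb; apply: prodr_ge0 => i _; rewrite subr_ge0. Qed.

(** Uses the coordinate [i0]: an empty product would be 1. *)
Lemma volume_b0 : volume b0 = 0.
Proof. by rewrite /volume (bigD1 i0)//= subrr mul0r. Qed.

Lemma sum_nth_volume_le (s : seq (pt * pt)) B : (forall k, wf_box (nth b0 s k)) ->
  \sum_(l < B) volume (nth b0 s l) <= \sum_(b <- s) volume b.
Proof.
move=> ws; rewrite (big_nth b0) big_mkord.
case: (leqP B (size s)) => Bs.
  rewrite (big_ord_widen _ (fun l => volume (nth b0 s l)) Bs) big_mkcond /=.
  by apply: ler_sum => l _; case: ifP => // _; exact: volume_ge0.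
rewrite [leRHS](big_ord_widen _ (fun l => volume (nth b0 s l)) (ltnW Bs)) [leRHS]big_mkcond /=.
apply: ler_sum => l _; case: ltnP => // sl.
by rewrite nth_default// volume_b0.
Qed.

(** A partial sum along the enumeration of pairs is dominated by the sum over a square, large enough
    to contain the finitely many pairs met so far. *)
Lemma sum_pickle_le (F : nat * nat -> R) m : (forall p, 0 <= F p) ->
  exists B, \sum_(q < m) (if pickle_inv q is Some p then F p else 0) <=
    \sum_(k < B) \sum_(l < B) F (k : nat, l : nat).
Proof.
move=> F0; pose B := (\sum_(q < m) (if pickle_inv q is Some p then p.1 + p.2 else 0)).+1%N.
exists B; rewrite pair_bigA /=.
apply: (@le_trans _ _ (\sum_(q < m) \sum_(p : 'I_B * 'I_B | pickle (p.1 : nat, p.2 : nat) == q)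
    F (p.1 : nat, p.2 : nat))).
  apply: ler_sum => q _; case E : (pickle_inv q) => [[k l]|]; last by apply: sumr_ge0.
  have kl : (k + l < B)%N.
    by rewrite /B ltnS (bigD1 q)//= E leq_addr.
  have kB : (k < B)%N by apply: leq_ltn_trans kl; exact: leq_addr.
  have lB : (l < B)%N by apply: leq_ltn_trans kl; exact: leq_addl.
  rewrite (bigD1 (Ordinal kB, Ordinal lB)) /=; first by rewrite lerDl sumr_ge0.
  have := @pickle_invK (nat * nat)%type (val q); rewrite /ocancel E /= => ->.
  exact: eqxx.
rewrite [leRHS](bigID (fun p : 'I_B * 'I_B => (pickle (p.1 : nat, p.2 : nat) < m)%N)) /=.
rewrite -[leLHS]addr0 lerD ?sumr_ge0//.
case: m => [|m] in B *; first by rewrite big_ord0 sumr_ge0.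
rewrite [leRHS](partition_big (fun p : 'I_B * 'I_B => inord (pickle (p.1 : nat, p.2 : nat)) : 'I_m.+1) predT)//=.
apply: ler_sum => q _; rewrite le_eqVlt; apply/orP; left; apply/eqP.
apply: eq_bigl => p; apply/eqP/andP => [e|[lt /eqP <-]]; last by rewrite inordK.
by rewrite e ltn_ord; split=> //; apply/eqP/val_inj; rewrite /= inordK.
Qed.

Lemma sum_pow2_le B (eps : R) : 0 <= eps -> \sum_(k < B) eps / 2 ^+ k.+1 <= eps.
Proof.
move=> e0; suff -> : \sum_(k < B) eps / 2 ^+ k.+1 = eps - eps / 2 ^+ B.
  by rewrite gerBl divr_ge0// exprn_ge0.
elim: B => [|B IH]; first by rewrite big_ord0 expr0 divr1 subrr.
by rewrite big_ord_recr /= IH exprS; field; rewrite expf_neq0.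
Qed.

Lemma null_bigcup_finitely_null (A : nat -> set pt) (Z : set pt) :
  (forall k, finitely_null (A k)) -> (forall x, Z x -> exists k, A k x) ->
  lebesgue_null Z.
Proof.
move=> nA ZA eps eps0.
have ek k : 0 < eps / 2 ^+ k.+1 by rewrite divr_gt0// exprn_gt0.
pose s k := sval (cid (nA k _ (ek k))).
have sP k := svalP (cid (nA k _ (ek k))).
pose box q := if @pickle_inv (nat * nat)%type q is Some p then nth b0 (s p.1) p.2 else b0.
have wbox q : wf_box (box q).
  rewrite /box; case: pickle_inv => [[k l]|//] /=; by case: (sP k).
exists (fun q => (box q).1), (fun q => (box q).2); split.
- by move=> q i; exact: wbox.
- move=> m.
  have F0 (p : nat * nat) : 0 <= volume (nth b0 (s p.1) p.2).
    by apply: volume_ge0; case: (sP p.1).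
  have [B hB] := sum_pickle_le m F0.
  apply: le_trans (le_trans hB _).
    apply: ler_sum => q _; rewrite -/(volume (box q)) /box.
    by case: pickle_inv => [p|]//; rewrite volume_b0.
  apply: le_trans (sum_pow2_le B (ltW eps0)); apply: ler_sum => k _ /=.
  by have [w sk _] := sP k; apply: le_trans sk; exact: sum_nth_volume_le.
- move=> x Zx; have [k Ax] := ZA x Zx; have [_ _ /(_ x Ax) [l ls inb]] := sP k.
  exists (pickle (k, l)) => //= i; rewrite /box pickleK_inv; exact: inb.
Qed.
End NullSets.

Section PolynomialFunctions.
Context {R : realType} {I : finType}.
Local Notation pt := (I -> R).

(** Polynomials are kept as functions: boundedness, the Lipschitz property and restriction to a line
    all follow by induction on this predicate. *)
Inductive rpoly : (pt -> R) -> Prop :=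
| rpoly_cst c : rpoly (fun=> c)
| rpoly_var i : rpoly (fun x => x i)
| rpolyD f g : rpoly f -> rpoly g -> rpoly (fun x => f x + g x)
| rpolyM f g : rpoly f -> rpoly g -> rpoly (fun x => f x * g x).

Lemma rpoly_ext f g : f =1 g -> rpoly f -> rpoly g.
Proof. by move=> /funext ->. Qed.

Lemma rpoly_sum (J : Type) (s : seq J) (f : J -> pt -> R) :
  (forall j, rpoly (f j)) -> rpoly (fun x => \sum_(j <- s) f j x).
Proof.
move=> pf; elim: s => [|j s IH].
  by apply: (rpoly_ext (f := fun=> 0)); [move=> x; rewrite big_nil|exact: rpoly_cst].
by apply: (rpoly_ext (f := fun x => f j x + \sum_(j <- s) f j x));
  [move=> x; rewrite big_cons|exact: rpolyD].
Qed.

Lemma rpolyX f n : rpoly f -> rpoly (fun x => f x ^+ n).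
Proof.
move=> pf; elim: n => [|n IH].
  by apply: (rpoly_ext (f := fun=> 1)); [move=> x; rewrite expr0|exact: rpoly_cst].
by apply: (rpoly_ext (f := fun x => f x * f x ^+ n)); [move=> x; rewrite exprS|exact: rpolyM].
Qed.

Lemma rpolyMn f n : rpoly f -> rpoly (fun x => f x *+ n).
Proof.
move=> pf; apply: (rpoly_ext (f := fun x => f x * n%:R)); first by move=> x; rewrite mulr_natr.
by apply: rpolyM => //; exact: rpoly_cst.
Qed.

Definition upd (x : pt) (i : I) (t : R) : pt := fun j => if j == i then t else x j.

(* [p x] is the polynomial obtained from a function by freezing every
   coordinate of [x] except the [i]-th one. *)
Definition slice_poly (i : I) (p : pt -> {poly R}) :=
  [/\ forall x t, p (upd x i t) = p x, forall k, rpoly (fun x => (p x)`_k) &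
      exists n, forall x, (size (p x) <= n)%N].

Lemma rpoly_slice f i : rpoly f ->
  exists2 p, slice_poly i p & forall x, f x = (p x).[x i].
Proof.
elim=> {f} [c|j|f g _ [p [pu pr [n pn]] pf] _ [q [qu qr [m qm]] qf]|
            f g _ [p [pu pr [n pn]] pf] _ [q [qu qr [m qm]] qf]].
- exists (fun=> c%:P); last by move=> x; rewrite hornerC.
  split=> // [k|]; last by exists 1%N => x; exact: size_polyC_leq1.
  by apply: (rpoly_ext (f := fun=> (c%:P)`_k)) => //; exact: rpoly_cst.
- have [->|ji] := eqVneq j i.
    exists (fun=> 'X); last by move=> x; rewrite hornerX.
    split=> // [k|]; last by exists 2 => x; rewrite size_polyX.
    exact: rpoly_cst.
  exists (fun x => (x j)%:P); last by move=> x; rewrite hornerC.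
  split=> [x t|k|]; last by exists 1%N => x; exact: size_polyC_leq1.
    by rewrite /upd (negPf ji).
  case: k => [|k].
    by apply: (rpoly_ext (f := fun x => x j)); [move=> x; rewrite coefC|exact: rpoly_var].
  by apply: (rpoly_ext (f := fun=> 0)); [move=> x; rewrite coefC|exact: rpoly_cst].
- exists (fun x => p x + q x); last by move=> x; rewrite hornerD pf qf.
  split=> [x t|k|]; first by rewrite pu qu.
    apply: (rpoly_ext (f := fun x => (p x)`_k + (q x)`_k)); first by move=> x; rewrite coefD.
    exact: rpolyD.
  exists (maxn n m) => x; apply: leq_trans (size_polyD _ _) _.
  by rewrite geq_max !leq_max pn qm orbT.
- exists (fun x => p x * q x); last by move=> x; rewrite hornerM pf qf.
  split=> [x t|k|]; first by rewrite pu qu.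
    apply: (rpoly_ext (f := fun x => \sum_(j < k.+1) (p x)`_j * (q x)`_(k - j))).
      by move=> x; rewrite coefM.
    by apply: rpoly_sum => j; exact: rpolyM.
  exists (n + m)%N => x; apply: leq_trans (size_polyMleq _ _) _.
  by apply: leq_trans (leq_pred _) _; exact: leq_add.
Qed.

Lemma slice_poly_horner i p : slice_poly i p -> rpoly (fun x => (p x).[x i]).
Proof.
move=> [_ pr [n pn]].
apply: (rpoly_ext (f := fun x => \sum_(k < n) (p x)`_k * x i ^+ k)).
  by move=> x; rewrite (horner_coef_wide _ (pn x)).
by apply: rpoly_sum => k; apply: rpolyM => //; apply: rpolyX; exact: rpoly_var.
Qed.

Lemma slice_poly_nderivn i p r : slice_poly i p -> slice_poly i (fun x => (p x)^`N(r)).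
Proof.
move=> [pu pr [n pn]]; split=> [x t|k|]; first by rewrite pu.
  apply: (rpoly_ext (f := fun x => (p x)`_(r + k) *+ 'C(r + k, r))).
    by move=> x; rewrite coef_nderivn.
  exact: rpolyMn.
exists n => x; apply: leq_trans (pn x).
apply/leq_sizeP => j pj; rewrite coef_nderivn nth_default ?mul0rn//.
by apply: leq_trans pj _; exact: leq_addl.
Qed.

Definition in_cube (k : R) (x : pt) := forall j, `|x j| <= k.

Lemma rpoly_bounded f k : 0 <= k -> rpoly f ->
  exists2 c, 0 <= c & forall x, in_cube k x -> `|f x| <= c.
Proof.
move=> k0; elim=> {f} [c|j|f g _ [a a0 fa] _ [b b0 gb]|f g _ [a a0 fa] _ [b b0 gb]].
- by exists `|c|.
- by exists k.
- exists (a + b) => [|x xk]; first exact: addr_ge0.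
  by apply: le_trans (ler_normD _ _) _; rewrite lerD ?fa ?gb.
- exists (a * b) => [|x xk]; first exact: mulr_ge0.
  by rewrite normrM ler_pM ?fa ?gb.
Qed.

Lemma rpoly_lipschitz f k : 0 <= k -> rpoly f ->
  exists2 l, 0 <= l & forall x y h, in_cube k x -> in_cube k y ->
    (forall j, `|x j - y j| <= h) -> `|f x - f y| <= l * h.
Proof.
move=> k0; elim=> {f} [c|j|f g _ [a a0 fa] _ [b b0 gb]|f g pf [a a0 fa] pg [b b0 gb]].
- by exists 0 => // x y h _ _ _; rewrite subrr normr0 mul0r.
- by exists 1 => // x y h _ _; rewrite mul1r; apply.
- exists (a + b) => [|x y h xk yk xy]; first exact: addr_ge0.
  rewrite opprD addrACA mulrDl; apply: le_trans (ler_normD _ _) _.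
  by rewrite lerD ?fa ?gb.
- have [c c0 fc] := rpoly_bounded k0 pf; have [e e0 ge] := rpoly_bounded k0 pg.
  exists (c * b + a * e) => [|x y h xk yk xy]; first by rewrite addr_ge0 ?mulr_ge0.
  have -> : f x * g x - f y * g y = f x * (g x - g y) + (f x - f y) * g y by ring.
  apply: le_trans (ler_normD _ _) _; rewrite !normrM mulrDl lerD//.
    by rewrite -mulrA ler_pM ?fc ?gb.
  by rewrite mulrAC ler_pM ?ge ?fa.
Qed.

(** The Taylor coefficients at [x i] are polynomial functions of [x], hence bounded on the cube,
    which makes the second-order remainder uniform. *)
Lemma slice_poly_taylor i p k : 0 <= k -> slice_poly i p ->
  exists2 c, 0 <= c & forall x t, in_cube k x -> `|t| <= k ->
    `|(p x).[t] - (p x).[x i] - (p x)^`().[x i] * (t - x i)| <= c * (t - x i) ^+ 2.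
Proof.
move=> k0 sp; have [pu pr [n pn]] := sp.
have bd r : exists2 c, 0 <= c & forall x, in_cube k x -> `|(p x)^`N(r).[x i]| <= c.
  by apply: rpoly_bounded => //; apply: slice_poly_horner; exact: slice_poly_nderivn.
pose c r := sval (cid2 (bd r)).
have c0 r : 0 <= c r by rewrite /c; case: cid2.
have cP r x : in_cube k x -> `|(p x)^`N(r).[x i]| <= c r.
  by rewrite /c; case: cid2 => ? ? h; exact: h.
exists (\sum_(r < n) c r.+2 * (2 * k) ^+ r).
  by apply: sumr_ge0 => r _; rewrite mulr_ge0// exprn_ge0// mulr_ge0.
move=> x t xk tk; set h := t - x i.
have -> : (p x).[t] - (p x).[x i] - (p x)^`().[x i] * h =
    \sum_(r < n) (p x)^`N(r.+2).[x i] * h ^+ r.+2.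
  have -> : t = x i + h by rewrite /h addrC subrK.
  rewrite (@nderiv_taylor_wide _ n.+2 (p x) (x i) h (mulrC _ _)).
    rewrite !big_ord_recl /= nderivn0 nderivn1 expr0 expr1 mulr1.
    rewrite [X in _ + (_ + X) - _ - _ = _](_ : _ =
      \sum_(r < n) (p x)^`N(r.+2).[x i] * h ^+ r.+2)//; ring.
  by apply: leq_trans (pn x) _; rewrite -addn2 leq_addr.
apply: le_trans (ler_norm_sum _ _ _) _; rewrite mulr_suml; apply: ler_sum => r _.
rewrite normrM -mulrA ler_pM ?cP// normrX exprSr exprSr -mulrA -expr2 real_normK ?num_real//.
rewrite ler_wpM2r ?sqr_ge0// lerXn2r ?nnegrE ?mulr_ge0//.
by apply: le_trans (ler_normB _ _) _; rewrite mulr_natl mulr2n lerD.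
Qed.
End PolynomialFunctions.

(** * Simple zeros have zero content *)

Section ZeroSets.
Context {R : realType} {I : finType}.
Local Notation pt := (I -> R).

Lemma grid_cell (k t : R) m : 0 < k -> (0 < m)%N -> `|t| <= k ->
  exists q : 'I_m, - k + q%:R * (2 * k / m%:R) <= t <= - k + q.+1%:R * (2 * k / m%:R).
Proof.
move=> k0 m0; rewrite ler_norml => /andP[kt tk].
have mR : 0 < m%:R :> R by rewrite ltr0n.
set h := 2 * k / m%:R; have h0 : 0 < h by rewrite divr_gt0// mulr_gt0.
have mh : m%:R * h = 2 * k by rewrite /h mulrC divfK// gt_eqF.
pose y := (t + k) / h; have yE : y * h = t + k by rewrite /y divfK// gt_eqF.
have y0 : 0 <= y by apply: divr_ge0; [lra|exact: ltW].
have [ym|my] := ltnP (Num.truncn y) m.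
  exists (Ordinal ym).
  have h1 : (Ordinal ym)%:R * h <= y * h by rewrite ler_pM2r// truncn_le.
  have h2 : y * h <= (Ordinal ym).+1%:R * h by rewrite ler_pM2r// ltW// truncnS_gt.
  by rewrite yE in h1 h2; apply/andP; split; lra.
case: m m0 mR h h0 mh y yE y0 my => // m _ mR h h0 mh y yE y0 my.
have h1 : m.+1%:R * h <= y * h.
  by rewrite ler_pM2r//; apply: le_trans (_ : (Num.truncn y)%:R <= _); rewrite ?ler_nat ?truncn_le.
exists ord_max; rewrite [(nat_of_ord ord_max).+1%:R * h]mh; apply/andP; split; last by lra.
have : (@ord_max m)%:R * h <= m.+1%:R * h by rewrite ler_pM2r// ler_nat.
by rewrite yE in h1; lra.
Qed.

Variables (i : I) (p : pt -> {poly R}) (k : R).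
Hypotheses (sp : slice_poly i p) (k_gt0 : 0 < k).

Definition simple_zeros : set pt :=
  [set x | [/\ in_cube k x, (p x).[x i] = 0 & k^-1 <= `|(p x)^`().[x i]| ]].

(** A quantitative implicit function theorem. Giving [x] the [i]-th coordinate of [y] yields a value
    that is small because [y] is a zero, and that Taylor at [x] evaluates as derivative times
    displacement. For displacements up to [r] the quadratic error is at most half the lower bound
    for that product. *)
Lemma simple_zeros_column : exists r l, [/\ 0 < r, 0 <= l &
  forall x y h, simple_zeros x -> simple_zeros y -> 0 <= h ->
    (forall j, j != i -> `|x j - y j| <= h) -> `|x i - y i| <= r ->
    `|x i - y i| <= l * h].
Proof.
have k0 := ltW k_gt0.
have [l l0 lip] := rpoly_lipschitz k0 (slice_poly_horner sp).
have [c c0 tay] := slice_poly_taylor k0 sp.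
exists (2 * k * (c + 1))^-1, (2 * k * l); split.
- by rewrite invr_gt0 !mulr_gt0// ltr_wpDl.
- by rewrite !mulr_ge0.
move=> x y h [xk x0 dx] [yk y0 dy] h0 xyh; rewrite distrC => xyr.
set D := y i - x i in xyr *.
pose z := upd x i (y i).
have zk : in_cube k z by move=> j; rewrite /z /upd; case: ifP => _; [exact: yk|exact: xk].
have zy j : `|z j - y j| <= h.
  rewrite /z /upd; case: eqVneq => [->|ji]; last exact: xyh.
  by rewrite subrr normr0.
have := lip z y h zk yk zy; rewrite y0 subr0.
have -> : (p z).[z i] = (p x).[y i].
  by have [-> _ _] := sp; rewrite /z /upd eqxx.
move=> lz; have := tay x (y i) xk (yk i); rewrite x0 subr0 -/D => t1.
have d1 : k^-1 * `|D| <= `|(p x)^`().[x i] * D| by rewrite normrM ler_wpM2r.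
have d2 : `|(p x)^`().[x i] * D| <= l * h + c * D ^+ 2.
  have -> : (p x)^`().[x i] * D = (p x).[y i] - ((p x).[y i] - (p x)^`().[x i] * D) by ring.
  by apply: le_trans (ler_normB _ _) _; rewrite lerD.
have d3 : c * D ^+ 2 <= (2 * k)^-1 * `|D|.
  rewrite -(real_normK (num_real D)) expr2 mulrA ler_wpM2r//.
  apply: (@le_trans _ _ ((c + 1) * (2 * k * (c + 1))^-1)).
    by apply: ler_pM => //; rewrite lerDl.
  rewrite le_eqVlt; apply/orP; left; apply/eqP; field.
  by rewrite !gt_eqF//= ltr_wpDl.
have e1 : k^-1 = 2 * (2 * k)^-1 by field; rewrite gt_eqF.
have d4 : (2 * k)^-1 * `|D| <= l * h by rewrite e1 in d1; lra.
by rewrite -(mulrA (2 * k)) -ler_pdivrMl ?mulr_gt0.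
Qed.

Lemma simple_zeros_finitely_null : finitely_null simple_zeros.
Proof.
move=> eps eps0; have k0 := ltW k_gt0.
have [r [l [r0 l0 col]]] := simple_zeros_column.
pose m2 := (Num.truncn (2 * k / r)).+1.
have m2r : 2 * k / m2%:R <= r.
  by rewrite ler_pdivrMr ?ltr0n// [r * _]mulrC -ler_pdivrMr// ltW// truncnS_gt.
pose n1 := #|[pred j | j != i]|.
(* There are [m ^ n1 * m2] cells, each with a box of volume at most [2 * w * h ^+ n1], where [h] and
   [w] are of order [1 / m]; the total is at most [Kc / m%:R]. *)
pose Kc := m2%:R * (2 * k) ^+ n1 * (4 * k * l).
have Kc0 : 0 <= Kc by rewrite !mulr_ge0// exprn_ge0// mulr_ge0.
pose m' := Num.truncn (Kc / eps); pose m := m'.+1.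
have mR : 0 < m%:R :> R by rewrite ltr0n.
have Kcm : Kc / m%:R <= eps.
  by rewrite ler_pdivrMr// [eps * _]mulrC -ler_pdivrMr// ltW// truncnS_gt.
pose h := 2 * k / m%:R; have h0 : 0 <= h by rewrite divr_ge0// mulr_ge0.
pose w := l * h; have w0 : 0 <= w by exact: mulr_ge0.
pose Ix := ({ffun I -> 'I_m} * 'I_m2)%type.
pose cell (a : Ix) (x : pt) :=
  (forall j, j != i -> - k + (a.1 j)%:R * h <= x j <= - k + (a.1 j).+1%:R * h) /\
  - k + a.2%:R * (2 * k / m2%:R) <= x i <= - k + a.2.+1%:R * (2 * k / m2%:R).
(* In direction [i] the box is centered at one chosen zero of the cell, and all others are within
   [w] of it; a cell without zeros gets the degenerate box. *)
pose box (a : Ix) : pt * pt :=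
  if pselect (exists x, simple_zeros x /\ cell a x) is left e then
    let x0 := sval (cid e) in
    ((fun j => if j == i then x0 i - w else - k + (a.1 j)%:R * h),
     (fun j => if j == i then x0 i + w else - k + (a.1 j).+1%:R * h))
  else (fun=> 0, fun=> 0).
have wbox a : wf_box (box a).
  rewrite /box /wf_box; case: pselect => [e|//] j /=; case: eqP => _; first by lra.
  by rewrite lerD2l ler_wpM2r// ler_nat.
have vbox a : volume (box a) <= 2 * w * h ^+ n1.
  rewrite /box /volume; case: pselect => [e|ne] /=; last first.
    by rewrite (bigD1 i)//= subrr mul0r !mulr_ge0// exprn_ge0.
  rewrite (bigD1 i)//= eqxx (eq_bigr (fun=> h)); last first.
    by move=> j /negPf ->; rewrite -addn1 natrD; ring.
  by rewrite prodr_const; rewrite le_eqVlt; apply/orP; left; apply/eqP; congr (_ * _); ring.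
(* Direction [i] is governed by the second index; fixing its entry here avoids listing each cell [m]
   times. *)
pose Q : pred {ffun I -> 'I_m} :=
  fun f => f \in family (fun j => if j == i then pred1 ord0 else predT).
have cQ : #|Q| = (m ^ n1)%N.
  rewrite (card_family (fun j => if j == i then pred1 (ord0 : 'I_m) else predT)).
  rewrite foldrE big_map big_enum /= (bigD1 i)//= eqxx card1 mul1n.
  rewrite -prod_nat_const; apply: eq_big => j; first by rewrite inE.
  by move=> /negPf ->; rewrite cardT size_enum_ord.
pose P : pred Ix := fun a => Q a.1.
have cP : #|P| = (m ^ n1 * m2)%N.
  rewrite -cQ -[m2 in RHS]card_ord -cardX; apply: eq_card => -[f e].
  by rewrite !inE andbT.
exists [seq box a | a <- enum P]; split.
- move=> q; have [qs|qs] := ltnP q (size (enum P)).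
    have [a0 _] : exists a0 : Ix, True by exists ([ffun=> ord0], ord0).
    by rewrite (nth_map a0).
  by rewrite nth_default// size_map.
- rewrite big_map big_enum /=.
  apply: (@le_trans _ _ (\sum_(a in P) 2 * w * h ^+ n1)); first exact: ler_sum.
  rewrite sumr_const cP -[X in X <= _]mulr_natl natrM natrX; apply: le_trans Kcm.
  rewrite le_eqVlt; apply/orP; left; apply/eqP.
  have mh : m%:R * h = 2 * k by rewrite /h mulrC divfK// gt_eqF.
  transitivity ((m%:R * h) ^+ n1 * m2%:R * (2 * w)).
    by rewrite (exprMn n1 m%:R h); move: (m%:R ^+ n1) (h ^+ n1) => u1 u2; ring.
  by rewrite mh /Kc /w /h; field; rewrite gt_eqF.
- move=> x Sx; have [xk _ _] := Sx.
  have gc j : exists q : 'I_m, - k + q%:R * h <= x j <= - k + q.+1%:R * h.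
    exact: grid_cell.
  pose q j := sval (cid (gc j)); have qP j := svalP (cid (gc j)).
  have [e eP] := @grid_cell k (x i) m2 k_gt0 isT (xk i).
  pose a : Ix := ([ffun j => if j == i then ord0 else q j], e).
  have ca : cell a x.
    by split=> // j /negPf ji; rewrite /= ffunE ji; exact: qP.
  have aP : a \in enum P.
    rewrite mem_enum unfold_in /P /Q /=; apply/familyP => j; rewrite ffunE.
    by case: eqP => _; rewrite inE.
  exists (index a (enum P)); first by rewrite size_map index_mem.
  rewrite (nth_map a) ?index_mem// nth_index//.
  rewrite /box; case: pselect => [ex|[]]; last by exists x.
  case: (cid ex) => x0 [Sx0 cx0] /= j /=; case: eqP => [->|/eqP ji]; last by have := ca.1 j ji.
  have cellD (n : nat) (s a1 a2 : R) : - k + n%:R * s <= a1 <= - k + n.+1%:R * s ->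
      - k + n%:R * s <= a2 <= - k + n.+1%:R * s -> `|a1 - a2| <= s.
    by rewrite -natr1 ler_norml => /andP[? ?] /andP[? ?]; apply/andP; split; lra.
  have : `|x i - x0 i| <= w.
    apply: col Sx Sx0 h0 _ _ => [j1 ji1|].
      exact: cellD (ca.1 _ ji1) (cx0.1 _ ji1).
    by apply: le_trans m2r; exact: cellD ca.2 cx0.2.
  by rewrite ler_norml => /andP[? ?]; apply/andP; split; lra.
Qed.
End ZeroSets.

Section PolynomialZeroSets.
Context {R : realType} {I : finType} (i0 : I).
Local Notation pt := (I -> R).

Lemma root_derivn_neq0 (P : {poly R}) (a b : R) : P.[a] = 0 -> P.[b] != 0 ->
  exists r, P^`(r).[a] = 0 /\ P^`(r.+1).[a] != 0.
Proof.
move=> Pa Pb; apply: contrapT => nr.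
have all0 r : P^`(r).[a] = 0.
  elim: r => [|r IH]; first by rewrite derivn0.
  by apply/eqP; apply: contrapT => /negP h; apply: nr; exists r.
move/eqP: Pb; apply; have -> : b = a + (b - a) by rewrite addrC subrK.
rewrite nderiv_taylor; last exact: mulrC.
rewrite big1// => r _; have := all0 r; rewrite nderivn_def hornerMn => /eqP.
by rewrite mulrn_eq0 eqn0Ngt fact_gt0 /= => /eqP ->; rewrite mul0r.
Qed.

Lemma slice_poly_derivn i (p : pt -> {poly R}) r :
  slice_poly i p -> slice_poly i (fun x => (p x)^`(r)).
Proof.
move=> sp; elim: r => [|r IH]; first by rewrite (_ : (fun x => _) = p).
rewrite (_ : (fun x => _) = fun x => ((p x)^`(r))^`N(1)); first exact: slice_poly_nderivn.
by apply/funext => x; rewrite nderivn1 derivnS.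
Qed.

(* Replacing the coordinates of a zero [x] by those of [x0] one at a time, some
   replacement makes [f] nonzero; [x] is then a zero of a nonzero univariate
   polynomial in that coordinate, hence a simple zero of one of its derivatives. *)
Lemma rpoly_zero_null (f : pt -> R) (x0 : pt) : rpoly f -> f x0 != 0 ->
  lebesgue_null [set x | f x = 0].
Proof.
move=> pf fx0.
pose mix (l : seq I) (x : pt) : pt := fun j => if j \in l then x0 j else x j.
have pmix l : rpoly (fun x => f (mix l x)).
  elim: pf => {f fx0} [c|j|f g _ IHf _ IHg|f g _ IHf _ IHg].
  - exact: rpoly_cst.
  - by rewrite /mix; case: (j \in l); [exact: rpoly_cst|exact: rpoly_var].
  - exact: rpolyD.
  - exact: rpolyM.
pose co q := nth i0 (enum I) q.
pose p q := s2val (cid2 (rpoly_slice (co q) (pmix (take q (enum I))))).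
have sp q : slice_poly (co q) (p q) := s2valP (cid2 (rpoly_slice (co q) (pmix (take q (enum I))))).
have fp q x : f (mix (take q (enum I)) x) = (p q x).[x (co q)] :=
  s2valP' (cid2 (rpoly_slice (co q) (pmix (take q (enum I))))) x.
(* The pieces are numbered by a coordinate, an order of differentiation and a size, which bounds
   both the cube and the inverse of the derivative. *)
pose A n : set pt := if @pickle_inv (nat * nat * nat)%type n is Some t then
  simple_zeros (co t.1.1) (fun x => (p t.1.1 x)^`(t.1.2)) t.2.+1%:R else set0.
apply: (@null_bigcup_finitely_null _ _ i0 A).
  move=> n; rewrite /A; case: pickle_inv => [t|].
    by apply: simple_zeros_finitely_null; [exact: slice_poly_derivn|].
  move=> eps e0; exists [::]; split=> //; first by move=> k j; rewrite nth_nil.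
  by rewrite big_nil ltW.
move=> x /= fx.
have [q [qI fq fq1]] : exists q, [/\ (q < #|I|)%N, f (mix (take q (enum I)) x) = 0 &
    f (mix (take q.+1 (enum I)) x) != 0].
  apply: contrapT => nq.
  have all0 q : (q <= #|I|)%N -> f (mix (take q (enum I)) x) = 0.
    elim: q => [_|q IH qI]; first by rewrite take0 -fx; congr f; apply/funext.
    apply/eqP; apply: contrapT => /negP h; apply: nq; exists q; split=> //.
    by apply: IH; exact: ltnW.
  move/eqP: fx0; apply; rewrite -(all0 _ (leqnn _)) cardE take_size; congr f.
  by apply/funext => j; rewrite /mix mem_enum.
have pa : (p q x).[x (co q)] = 0 by rewrite -fp.
have pb : (p q x).[x0 (co q)] != 0.
  have [pu _ _] := sp q.
  have := fp q (upd x (co q) (x0 (co q))); rewrite pu {2}/upd eqxx => <-.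
  move: fq1; rewrite (take_nth i0) -?cardE//; congr (f _ != 0).
  apply/funext => j; rewrite /mix /upd mem_rcons inE -/(co q).
  by case: eqVneq => [->|//]; case: ifP.
have [r [r0 r1]] := root_derivn_neq0 pa pb.
set D := _.[_] in r1.
pose k := Num.truncn (\sum_j `|x j| + `|D|^-1).
have kb : \sum_j `|x j| + `|D|^-1 <= k.+1%:R by rewrite ltW// truncnS_gt.
have D0 : 0 < `|D| by rewrite normr_gt0.
have sx0 : 0 <= \sum_j `|x j| by apply: sumr_ge0.
have Di0 : 0 < `|D|^-1 by rewrite invr_gt0.
exists (pickle (q, r, k)); rewrite /A pickleK_inv /=; split=> //=.
- move=> j; apply: le_trans kb; rewrite (bigD1 j)//= -addrA lerDl.
  by rewrite addr_ge0 ?sumr_ge0// ltW.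
- rewrite -derivnS -/D -[X in _ <= X]invrK lef_pV2 ?posrE//.
  by apply: le_trans kb; rewrite lerDr.
Qed.
End PolynomialZeroSets.

Section ComplexPolynomials.
Context {R : realType} {I : finType}.
Local Notation pt := (I -> R).
Local Notation C := R[i].

Definition cpoly (f : pt -> C) :=
  rpoly (fun x => complex.Re (f x)) /\ rpoly (fun x => complex.Im (f x)).

Lemma cpoly_ext f g : f =1 g -> cpoly f -> cpoly g.
Proof. by move=> /funext ->. Qed.

Lemma cpoly_cst z : cpoly (fun=> z).
Proof. by split; exact: rpoly_cst. Qed.

Lemma cpolyD f g : cpoly f -> cpoly g -> cpoly (fun x => f x + g x).
Proof.
move=> [fr fi] [gr gi]; split.
  apply: (rpoly_ext (f := fun x => complex.Re (f x) + complex.Re (g x))).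
    by move=> x; case: (f x) (g x) => [? ?] [? ?].
  exact: rpolyD.
apply: (rpoly_ext (f := fun x => complex.Im (f x) + complex.Im (g x))).
  by move=> x; case: (f x) (g x) => [? ?] [? ?].
exact: rpolyD.
Qed.

Lemma cpolyM f g : cpoly f -> cpoly g -> cpoly (fun x => f x * g x).
Proof.
move=> [fr fi] [gr gi]; split.
  apply: (rpoly_ext (f := fun x => complex.Re (f x) * complex.Re (g x) +
      -1 * (complex.Im (f x) * complex.Im (g x)))).
    by move=> x; case: (f x) (g x) => [? ?] [? ?] /=; rewrite mulN1r.
  by apply: rpolyD; [exact: rpolyM|apply: rpolyM; [exact: rpoly_cst|exact: rpolyM]].
apply: (rpoly_ext (f := fun x => complex.Re (f x) * complex.Im (g x) +
    complex.Im (f x) * complex.Re (g x))).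
  by move=> x; case: (f x) (g x) => [? ?] [? ?].
by apply: rpolyD; exact: rpolyM.
Qed.

Lemma cpoly_sum (J : Type) (s : seq J) (P : pred J) (f : J -> pt -> C) :
  (forall j, cpoly (f j)) -> cpoly (fun x => \sum_(j <- s | P j) f j x).
Proof.
move=> pf; elim: s => [|j s IH].
  by apply: (cpoly_ext (f := fun=> 0)); [move=> x; rewrite big_nil|exact: cpoly_cst].
apply: (cpoly_ext (f := fun x => (if P j then f j x else 0) + \sum_(j <- s | P j) f j x)).
  by move=> x; rewrite big_cons; case: (P j); rewrite ?add0r.
by apply: cpolyD => //; case: (P j) => //; exact: cpoly_cst.
Qed.

Lemma cpoly_prod (J : Type) (s : seq J) (f : J -> pt -> C) :
  (forall j, cpoly (f j)) -> cpoly (fun x => \prod_(j <- s) f j x).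
Proof.
move=> pf; elim: s => [|j s IH].
  by apply: (cpoly_ext (f := fun=> 1)); [move=> x; rewrite big_nil|exact: cpoly_cst].
by apply: (cpoly_ext (f := fun x => f j x * \prod_(j <- s) f j x));
  [move=> x; rewrite big_cons|exact: cpolyM].
Qed.

Lemma rpoly_nsq f : cpoly f -> rpoly (fun x => nsq (f x)).
Proof. by move=> [fr fi]; apply: rpolyD; exact: rpolyX. Qed.

Definition mxcpoly m n (A : pt -> 'M[C]_(m, n)) := forall i j, cpoly (fun x => A x i j).

Lemma mxcpoly_cst m n (A : 'M[C]_(m, n)) : mxcpoly (fun=> A).
Proof. by move=> i j; exact: cpoly_cst. Qed.

Lemma mxcpoly_mul m n q (A : pt -> 'M[C]_(m, n)) (B : pt -> 'M[C]_(n, q)) :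
  mxcpoly A -> mxcpoly B -> mxcpoly (fun x => A x *m B x).
Proof.
move=> pA pB i j; apply: (cpoly_ext (f := fun x => \sum_k A x i k * B x k j)).
  by move=> x; rewrite mxE.
by apply: cpoly_sum => k; exact: cpolyM.
Qed.

Lemma mxcpolyD m n (A B : pt -> 'M[C]_(m, n)) :
  mxcpoly A -> mxcpoly B -> mxcpoly (fun x => A x + B x).
Proof.
move=> pA pB i j; apply: (cpoly_ext (f := fun x => A x i j + B x i j)).
  by move=> x; rewrite mxE.
exact: cpolyD.
Qed.

Lemma mxcpolyZ m n (z : pt -> C) (A : pt -> 'M[C]_(m, n)) :
  cpoly z -> mxcpoly A -> mxcpoly (fun x => z x *: A x).
Proof.
move=> pz pA i j; apply: (cpoly_ext (f := fun x => z x * A x i j)).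
  by move=> x; rewrite mxE.
exact: cpolyM.
Qed.

Lemma mxcpoly_sum m n (J : finType) (P : pred J) (A : J -> pt -> 'M[C]_(m, n)) :
  (forall j, mxcpoly (A j)) -> mxcpoly (fun x => \sum_(j | P j) A j x).
Proof.
move=> pA i k; apply: (cpoly_ext (f := fun x => \sum_(j | P j) A j x i k)).
  by move=> x; rewrite summxE.
by apply: cpoly_sum => j; exact: pA.
Qed.

Lemma mxcpoly_tr m n (A : pt -> 'M[C]_(m, n)) : mxcpoly A -> mxcpoly (fun x => (A x)^T).
Proof.
by move=> pA i j; apply: (cpoly_ext (f := fun x => A x j i)); [move=> x; rewrite mxE|].
Qed.

Lemma cpoly_det n (A : pt -> 'M[C]_n) : mxcpoly A -> cpoly (fun x => \det (A x)).
Proof.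
move=> pA; apply: cpoly_sum => s; apply: cpolyM; first exact: cpoly_cst.
by apply: cpoly_prod => i; exact: pA.
Qed.

Lemma mxcpoly_adj n (A : pt -> 'M[C]_n) : mxcpoly A -> mxcpoly (fun x => \adj (A x)).
Proof.
move=> pA i j; apply: (cpoly_ext (f := fun x => cofactor (A x) j i)).
  by move=> x; rewrite mxE.
apply: cpolyM; first exact: cpoly_cst.
apply: cpoly_det => k l.
by apply: (cpoly_ext (f := fun x => A x (lift j k) (lift i l))); [move=> x; rewrite !mxE|].
Qed.

(* Cramer's rule extends a solution at [x0] to a polynomial family of solutions. *)
Lemma polynomial_kernel n m (J : finType) (A : J -> pt -> 'M[C]_(n, m)) (x0 : pt)
    (W : J -> 'M[C]_(m, n)) (v0 : J -> 'cV[C]_m) :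
  (forall j, mxcpoly (A j)) -> \sum_j A j x0 *m W j = 1%:M ->
  \sum_j A j x0 *m v0 j = 0 ->
  exists v : J -> pt -> 'cV[C]_m, [/\ forall j, mxcpoly (v j),
    forall x, \sum_j A j x *m v j x = 0 & forall j, v j x0 = v0 j].
Proof.
move=> pA AW Av0.
pose B x := \sum_j A j x *m W j; pose r x := \sum_j A j x *m v0 j.
have pB : mxcpoly B.
  by apply: mxcpoly_sum => j; apply: mxcpoly_mul => //; exact: mxcpoly_cst.
have pr : mxcpoly r.
  by apply: mxcpoly_sum => j; apply: mxcpoly_mul => //; exact: mxcpoly_cst.
(* Applying the system gives [\det (B x) *: r x - B x *m \adj (B x) *m r x], which is 0; at [x0] the
   determinant is 1 and [r] vanishes. *)
exists (fun j x => \det (B x) *: v0 j + (- W j) *m (\adj (B x) *m r x)); split.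
- move=> j; apply: mxcpolyD.
    by apply: mxcpolyZ; [exact: cpoly_det|exact: mxcpoly_cst].
  apply: mxcpoly_mul; first exact: mxcpoly_cst.
  by apply: mxcpoly_mul => //; exact: mxcpoly_adj.
- move=> x; under eq_bigr do rewrite mulmxDr -scalemxAr mulNmx mulmxN mulmxA.
  rewrite big_split /= -scaler_sumr -/(r x) sumrN -mulmx_suml -/(B x) mulmxA.
  by rewrite mul_mx_adj mul_scalar_mx subrr.
- move=> j; have -> : r x0 = 0 by [].
  by rewrite /B AW det1 scale1r !mulmx0 addr0.
Qed.
End ComplexPolynomials.

(** * Signal alignment *)

Section Groups.
Context {R : realType} {Gam : finType} (tau : Gam -> option 'I_3).
Local Notation C := R[i].

(* A group [g] exchanges one stream between every user and its successor when
   [tau g = None], and one stream each way between the two users other than [u]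
   when [tau g = Some u]. *)
Definition member g (k : 'I_3) := Some k != tau g.

(** The indices of the three users sum to 0 modulo 3, so [6 - k - u] is the third user. For [k = u]
    it gives [u] back, so [target g] permutes all users. *)
Definition target g (k : 'I_3) : 'I_3 :=
  if tau g is Some u then inord ((6 - k - u) %% 3) else inord (k.+1 %% 3).

(** The member whose relay vector is expressed as minus the sum of the others; the remaining members
    index the basis. *)
Definition pivot g : 'I_3 := if tau g is Some u then inord (u.+1 %% 3) else ord0.

Definition relay_basis : pred (Gam * 'I_3) := fun s => member s.1 s.2 && (s.2 != pivot s.1).

Lemma member_pivot g : member g (pivot g).
Proof.
rewrite /member /pivot; case: (tau g) => [[[|[|[|?]]] ?]|//] //=;
  by apply/eqP => -[] /(congr1 val) /=; rewrite inordK.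
Qed.

Lemma member_target g k : member g (target g k) = member g k.
Proof.
rewrite /member /target; case: (tau g) => [[[|[|[|?]]] ?]|//] //=;
  case: k => [[|[|[|?]]] ?] //=;
  by rewrite !(inj_eq (@Some_inj _)) -!val_eqE /= ?inordK.
Qed.

Lemma target_neq g k : member g k -> target g k != k.
Proof.
rewrite /member /target; case: (tau g) => [[[|[|[|?]]] ?]|] //=;
  case: k => [[|[|[|?]]] ?] //=; rewrite -val_eqE /= ?inordK //.
Qed.

Lemma target_inj g : injective (target g).
Proof.
rewrite /target; case: (tau g) => [[[|[|[|?]]] ?]|] //=;
  move=> [[|[|[|?]]] ?] [[|[|[|?]]] ?] //= /(congr1 val) /=; rewrite ?inordK // => _;
  exact/val_inj.
Qed.

Lemma member_others g k j : ~~ member g k -> j != k -> member g j.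
Proof.
rewrite /member negbK => /eqP <- jk.
by apply: contra jk => /eqP [->].
Qed.

(** A permutation matrix minus the identity has zero row and column sums, as compatibility with
    vectors summing to zero requires. *)
Lemma sum_target g (k : 'I_3) : member g k ->
  \sum_(j | member g j) ((target g j == k)%:R - (j == k)%:R) = 0 :> C.
Proof.
move=> gk; rewrite sumrB; apply/eqP; rewrite subr_eq0; apply/eqP.
rewrite [RHS](reindex_inj (@target_inj g)) /=.
by apply: eq_bigl => j; rewrite member_target.
Qed.

Lemma sum_target_col g (j : 'I_3) : member g j ->
  \sum_(k | member g k) ((target g j == k)%:R - (j == k)%:R) = 0 :> C.
Proof.
move=> gj; rewrite sumrB; apply/eqP; rewrite subr_eq0; apply/eqP.
have one (i : 'I_3) : member g i -> \sum_(k | member g k) (i == k)%:R = 1 :> C.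
  move=> gi; rewrite (bigD1 i)//= eqxx big1 ?addr0// => k /andP[_ /negPf].
  by rewrite eq_sym => ->.
by rewrite !one// member_target.
Qed.

Local Notation n' := #|relay_basis|.

Definition basis_mx n (r : Gam -> 'I_3 -> 'cV[C]_n) : 'M[C]_(n, n') :=
  \matrix_(i < n, j < n') r (enum_val j).1 (enum_val j).2 i 0.

Definition coords g k : 'cV[C]_n' :=
  \col_(j < n') (((enum_val j).1 == g)%:R *
    (if k == pivot g then -1 else (k == (enum_val j).2)%:R)).

Lemma basis_mx_coords n (r : Gam -> 'I_3 -> 'cV[C]_n) g k :
  (forall g, \sum_(k | member g k) r g k = 0) -> member g k ->
  basis_mx r *m coords g k = r g k.
Proof.
move=> r0 gk; apply/matrixP => i j; rewrite ord1 !mxE {j}.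
transitivity (\sum_(s in relay_basis) r s.1 s.2 i 0 * ((s.1 == g)%:R *
    (if k == pivot g then -1 else (k == s.2)%:R))).
  by rewrite [RHS]big_enum_val; apply: eq_bigr => j _; rewrite !mxE.
transitivity (\sum_(k' | member g k' && (k' != pivot g)) r g k' i 0 *
    (if k == pivot g then -1 else (k == k')%:R)).
  rewrite [LHS]big_mkcond [RHS]big_mkcond /=.
  rewrite -(pair_bigA _ (fun g' k' => if (g', k') \in relay_basis then r g' k' i 0 * ((g' == g)%:R *
    (if k == pivot g then -1 else (k == k')%:R)) else 0)) /=.
  rewrite (bigD1 g)//= [X in _ + X]big1 ?addr0; last first.
    move=> g' /negPf g'g; rewrite big1// => k' _.
    by rewrite g'g mul0r mulr0; case: ifP.
  by apply: eq_bigr => k' _; rewrite unfold_in /= eqxx mul1r.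
case: eqVneq => [->|kp].
  have := congr1 (fun A : 'cV_n => A i 0) (r0 g).
  rewrite (bigD1 (pivot g)) ?member_pivot//= !mxE summxE => /eqP.
  rewrite addr_eq0 => /eqP ->; rewrite -sumrN; apply: eq_bigr => k' _.
  by rewrite mulrN1.
rewrite (bigD1 k) /=; last by rewrite gk.
rewrite eqxx mulr1 big1 ?addr0// => k' /andP[_ /negPf].
by rewrite eq_sym => ->; rewrite mulr0.
Qed.

Lemma sum_coords g : \sum_(k | member g k) coords g k = 0.
Proof.
apply/matrixP => j i; rewrite summxE !mxE; under eq_bigr do rewrite mxE.
rewrite -mulr_sumr; case: eqVneq => [<-|_]; last by rewrite mul0r.
have := enum_valP j; set s := enum_val j; rewrite unfold_in /relay_basis => /andP[sm sp].
rewrite (bigD1 (pivot s.1)) ?member_pivot//= eqxx (bigD1 s.2) /=; last by rewrite sm.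
rewrite (negPf sp) eqxx big1 => [|k /andP[/andP[_ /negPf ->] /negPf ->]//].
by rewrite addr0 addNr mulr0.
Qed.

Lemma coords_basis (i : 'I_n') :
  coords (enum_val i).1 (enum_val i).2 = delta_mx i 0.
Proof.
have := enum_valP i; rewrite unfold_in /relay_basis => /andP[_ /negPf sp].
apply/matrixP => j k; rewrite !mxE ord1 sp eqxx andbT.
case: (eqVneq j i) => [->|ji]; first by rewrite !eqxx mulr1.
case: (eqVneq (enum_val j).1) => [e1|_]; last by rewrite mul0r.
case: (eqVneq (enum_val i).2) => [e2|_]; last by rewrite mulr0.
case/eqP: ji; apply: enum_val_inj.
by case: (enum_val j) (enum_val i) e1 e2 => [? ?] [? ?] /= -> ->.
Qed.

(** Routing along [target] alone does not respect the relation that the vectors of a group sum to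
    zero. Subtracting the identity restores it, and the added term only returns to a user its own
    stream. *)
Definition relay_mx : 'M[C]_n' :=
  basis_mx (fun g' j => \col_(i < n') (((enum_val i).1 == g')%:R *
    ((target g' j == (enum_val i).2)%:R - (j == (enum_val i).2)%:R))).

Lemma relay_mx_coords g k g' j : member g k -> member g' j ->
  ((coords g k)^T *m relay_mx *m coords g' j) 0 0 =
    (g == g')%:R * ((target g' j == k)%:R - (j == k)%:R).
Proof.
move=> gk gj; rewrite -mulmxA basis_mx_coords//; last first.
  move=> h; apply/matrixP => i t; rewrite summxE !mxE; under eq_bigr do rewrite mxE.
  rewrite -mulr_sumr; case: eqVneq => [<-|_]; last by rewrite mul0r.
  rewrite sum_target ?mulr0//.
  by have := enum_valP i; rewrite unfold_in /relay_basis => /andP[].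
pose r h l : 'cV[C]_1 := const_mx ((h == g')%:R * ((target g' j == l)%:R - (j == l)%:R)).
have r0 h : \sum_(l | member h l) r h l = 0.
  apply/matrixP => a b; rewrite summxE !mxE; under eq_bigr do rewrite mxE.
  by rewrite -mulr_sumr; case: eqVneq => [->|_]; rewrite ?mul0r// sum_target_col ?mulr0.
have := basis_mx_coords r0 gk => /(congr1 (fun A : 'M[C]_1 => A 0 0)); rewrite [RHS]mxE => <-.
by rewrite !mxE; apply: eq_bigr => i _; rewrite !mxE mulrC.
Qed.
End Groups.

(** * Alignment around a reference channel *)

Section Alignment.
Context {R : realType} {Gam : finType} (tau : Gam -> option 'I_3) (N M : nat).
Local Notation C := R[i].
Local Notation n' := #|relay_basis tau|.
Local Notation member := (member tau).
Local Notation coords := (@coords R Gam tau).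

Hypothesis basis_le : (n' <= N)%N.
Hypothesis members_le : forall k, (#|[pred g | member g k]| <= M)%N.

Definition relay_proj : 'M[C]_(n', N) := pid_mx n'.

Definition antenna k g : nat := index g (enum [pred g | member g k]).
Definition antenna_col k g : 'cV[C]_M := \col_(j < M) (val j == antenna k g)%:R.

(** Reference channel: each user devotes a separate antenna to each of its groups, and that antenna
    reaches the relay exactly along the coordinates of the group, so that unit vectors are
    aligned. *)
Definition witness_mx k : 'M[C]_(n', M) :=
  \matrix_(i < n', j < M)
    \sum_(g | member g k && (antenna k g == val j)) coords g k i 0.

Lemma witness_mx_col k g : member g k -> witness_mx k *m antenna_col k g = coords g k.
Proof.
move=> gk; have gs : g \in enum [pred g | member g k] by rewrite mem_enum.
have aM : (antenna k g < M)%N.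
  by apply: leq_trans (members_le k); rewrite cardE index_mem.
apply/matrixP => i t; rewrite ord1 mxE (bigD1 (Ordinal aM))//= !mxE /= eqxx mulr1.
rewrite [X in _ + X]big1 ?addr0 => [|j ja]; last first.
  by rewrite !mxE (_ : (_ == _) = false) ?mulr0//; apply: contraNF ja => /eqP e; apply/eqP/val_inj.
rewrite (bigD1 g) /=; last by rewrite gk eqxx.
rewrite mxE big1 ?addr0// => h /andP[/andP[hk /eqP ha] /negP[]]; apply/eqP.
have hs : h \in enum [pred g | member g k] by rewrite mem_enum.
by have := congr1 (nth g (enum [pred g | member g k])) ha; rewrite /antenna /= !nth_index.
Qed.

Lemma relay_projK : relay_proj *m relay_proj^T = 1%:M.
Proof. by rewrite /relay_proj tr_pid_mx pid_mx_id// pid_mx_1. Qed.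

(* Column [i] of [W j] expresses the [i]-th basis vector with the antennas of
   the members of [g] only: directly if its user is a member, and through the
   relation between the vectors of its group otherwise. *)
Lemma witness_surjective g : exists W : 'I_3 -> 'M[C]_(M, n'),
  \sum_j (if member g j then witness_mx j else 0) *m W j = 1%:M.
Proof.
pose w (s : Gam * 'I_3) j : 'cV[C]_M :=
  if member g s.2 then (if j == s.2 then antenna_col j s.1 else 0)
  else (if (j != s.2) && member s.1 j then - antenna_col j s.1 else 0).
exists (fun j => \matrix_(a < M, i < n') w (enum_val i) j a 0).
have key s : member s.1 s.2 ->
    \sum_j (if member g j then witness_mx j else 0) *m w s j = coords s.1 s.2.
  move=> ss; rewrite /w; have [gs|gs] := boolP (member g s.2).
    rewrite (bigD1 s.2)//= gs eqxx witness_mx_col// big1 ?addr0// => j /negPf ->.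
    by rewrite mulmx0.
  have := sum_coords (R := R) tau s.1; rewrite (bigD1 s.2)//= => /eqP; rewrite addr_eq0 => /eqP ->.
  rewrite -sumrN [RHS]big_mkcond; apply: eq_bigr => j _; rewrite [(j != s.2) && _]andbC.
  have [/andP[sj js]|_] := boolP (member s.1 j && _); last by rewrite mulmx0.
  by rewrite (member_others gs js) mulmxN witness_mx_col.
apply/matrixP => i j; have := enum_valP j; rewrite unfold_in /relay_basis => /andP[/key e _].
have := congr1 (fun A : 'cV[C]_n' => A i 0) e; rewrite coords_basis !mxE eqxx andbT => <-.
rewrite !summxE; apply: eq_bigr => k _; rewrite !mxE.
by apply: eq_bigr => a _; rewrite !mxE.
Qed.

Context {I : finType}.
Local Notation pt := (I -> R).
Variables (H : 'I_3 -> pt -> 'M[C]_(N, M)) (x0 : pt).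
Hypothesis pH : forall k, mxcpoly (H k).
Hypothesis Hx0 : forall k, H k x0 = relay_proj^T *m witness_mx k.

(** [polynomial_kernel], applied to each group, gives directions whose relay images sum to zero; the
    columns of [Q] are the images of the members other than the pivot. As [Q] is the identity at
    [x0], its determinant is a nonzero polynomial. *)
Lemma alignment : exists (v : Gam -> 'I_3 -> pt -> 'cV[C]_M) (Q : pt -> 'M[C]_n'),
  [/\ mxcpoly Q, Q x0 = 1%:M &
    forall x g k, member g k -> relay_proj *m H k x *m v g k x = Q x *m coords g k].
Proof.
pose A g j x : 'M[C]_(n', M) := if member g j then relay_proj *m H j x else 0.
have pA g j : mxcpoly (A g j).
  rewrite /A; case: (member g j); last exact: mxcpoly_cst.
  by apply: mxcpoly_mul => //; exact: mxcpoly_cst.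
have A0 g j : A g j x0 = if member g j then witness_mx j else 0.
  by rewrite /A; case: ifP => // _; rewrite Hx0 mulmxA relay_projK mul1mx.
pose v0 g j : 'cV[C]_M := if member g j then antenna_col j g else 0.
have vE g : exists v : 'I_3 -> pt -> 'cV[C]_M, [/\ forall j, mxcpoly (v j),
    forall x, \sum_j A g j x *m v j x = 0 & forall j, v j x0 = v0 g j].
  have [W hW] := witness_surjective g.
  apply: (@polynomial_kernel _ _ _ _ _ (A g) x0 W (v0 g)) => //.
    by rewrite -hW; apply: eq_bigr => j _; rewrite A0.
  rewrite -[RHS](sum_coords (R := R) tau g) [RHS]big_mkcond; apply: eq_bigr => j _.
  by rewrite A0 /v0; case: ifPn => [gj|_]; rewrite ?mulmx0// witness_mx_col.
pose v g := sval (cid (vE g)).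
have pv g j : mxcpoly (v g j) by have [+ _ _] := svalP (cid (vE g)); exact.
have kv g x : \sum_j A g j x *m v g j x = 0.
  by have [_ + _] := svalP (cid (vE g)); exact.
have v0E g j : v g j x0 = v0 g j by have [_ _ +] := svalP (cid (vE g)); exact.
pose r x g k : 'cV[C]_n' := relay_proj *m H k x *m v g k x.
have r0 x g : \sum_(k | member g k) r x g k = 0.
  rewrite -[RHS](kv g x) big_mkcond; apply: eq_bigr => k _; rewrite /A.
  by case: ifP => //; rewrite mul0mx.
exists v, (fun x => basis_mx tau (r x)); split.
- move=> i j; apply: (cpoly_ext (f := fun x => r x (enum_val j).1 (enum_val j).2 i 0)).
    by move=> x; rewrite [RHS]mxE.
  apply: mxcpoly_mul => //; apply: mxcpoly_mul => //; exact: mxcpoly_cst.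
- apply/matrixP => i j; rewrite mxE; have := enum_valP j; rewrite unfold_in /relay_basis => /andP[mj _].
  rewrite /r v0E /v0 mj Hx0 mulmxA relay_projK mul1mx witness_mx_col//.
  by rewrite coords_basis !mxE eqxx andbT.
- by move=> x g k gk; rewrite (basis_mx_coords (r0 x) gk).
Qed.
End Alignment.

Section ZeroForcing.
Context {R : realType} {Gam : finType} (tau : Gam -> option 'I_3) (N M : nat).
Local Notation C := R[i].
Local Notation n' := #|relay_basis tau|.
Local Notation member := (member tau).
Local Notation coords := (@coords R Gam tau).
Context (H : 'I_3 -> 'M[C]_(N, M)) (G : 'I_3 -> 'M[C]_(M, N)).
Context (v u : Gam -> 'I_3 -> 'cV[C]_M) (Q P : 'M[C]_n').
Hypotheses (Qu : Q \in unitmx) (Pu : P \in unitmx).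
Hypothesis vE : forall g k, member g k ->
  relay_proj tau N *m H k *m v g k = Q *m coords g k.
Hypothesis uE : forall g k, member g k ->
  relay_proj tau N *m (G k)^T *m u g k = P *m coords g k.

Definition stream : finType := {s : Gam * 'I_3 | member s.1 s.2}.
Definition stream_src (s : stream) : 'I_3 := (val s).2.
Definition stream_dst (s : stream) : 'I_3 := target tau (val s).1 (val s).2.
(** Read from the right: recover the coordinates of the uplink, exchange streams within groups, and
    prepare the result for receivers whose vectors are aligned through [P]. *)
Definition relay_fwd : 'M[C]_N :=
  (relay_proj tau N)^T *m (invmx P)^T *m relay_mx tau *m invmx Q *m relay_proj tau N.

Lemma stream_src_dst s : stream_src s != stream_dst s.
Proof. by rewrite eq_sym; apply: target_neq; exact: (valP s). Qed.

(** Both alignments reduce the product to an entry of [relay_mx_coords]. Its self term disappears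
    since [t] is not sent by the receiver, and injectivity of [target] singles out [s]. *)
Lemma stream_zero_forcing (s t : stream) : stream_src t != stream_dst s ->
  ((u (val s).1 (stream_dst s))^T *m G (stream_dst s) *m relay_fwd *m
    H (stream_src t) *m v (val t).1 (stream_src t)) 0 0 = (s == t)%:R.
Proof.
move=> ts; set g := (val s).1; set k := stream_dst s.
have gk : member g k by rewrite member_target (valP s).
have tm : member (val t).1 (stream_src t) := valP t.
have e1 : (u g k)^T *m G k *m (relay_proj tau N)^T *m (invmx P)^T = (coords g k)^T.
  rewrite -[G k]trmxK -!trmx_mul; congr (_^T).
  by rewrite (mulmxA (relay_proj tau N)) uE// mulmxA mulVmx// mul1mx.
have e2 : invmx Q *m (relay_proj tau N *m H (stream_src t) *m v (val t).1 (stream_src t)) =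
    coords (val t).1 (stream_src t) by rewrite vE// mulmxA mulVmx// mul1mx.
have -> : (u g k)^T *m G k *m relay_fwd *m H (stream_src t) *m v (val t).1 (stream_src t) =
    (coords g k)^T *m relay_mx tau *m coords (val t).1 (stream_src t).
  by rewrite -e1 -e2 /relay_fwd !mulmxA.
rewrite relay_mx_coords// (negPf ts) subr0.
have [gt|gt] := eqVneq g (val t).1; last first.
  rewrite mul0r (_ : (s == t) = false)//.
  by apply: contraNF gt => /eqP e; rewrite /g e.
rewrite mul1r; congr (_%:R); congr nat_of_bool.
apply/eqP/eqP => [|e]; last by rewrite /k e.
rewrite /k /stream_dst -/g gt => /target_inj e.
by apply/val_inj; rewrite [LHS]surjective_pairing [RHS]surjective_pairing -/g gt -e.
Qed.
End ZeroForcing.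

(** * Numbers of groups and streams *)

Section GroupCounts.
Variables (a : nat) (b : 'I_3 -> nat).

Definition group : finType := ('I_a + {u : 'I_3 & 'I_(b u)})%type.

Definition absent (g : group) : option 'I_3 :=
  if g is inr s then Some (tag s) else None.

Lemma sum_group (F : option 'I_3 -> nat) :
  (\sum_g F (absent g) = a * F None + \sum_u b u * F (Some u))%N.
Proof.
rewrite big_sumType /= sum_nat_const card_ord; congr (_ + _)%N.
rewrite -(sig_big_dep xpredT (fun=> xpredT) (fun u (_ : 'I_(b u)) => F (Some u))) /=.
by apply: eq_bigr => u _; rewrite sum_nat_const card_ord.
Qed.

Lemma card_member k :
  (#|[pred g | member absent g k]| = a + \sum_(u | u != k) b u)%N.
Proof.
rewrite -sum1_card big_mkcond (sum_group (fun o => if Some k != o then 1 else 0)%N) /= muln1.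
congr (_ + _)%N; rewrite [RHS]big_mkcond; apply: eq_bigr => u _.
by rewrite (inj_eq (@Some_inj _)) eq_sym; case: ifP => _; rewrite ?muln1 ?muln0.
Qed.
 
Lemma sum1_neq (k : 'I_3) : (\sum_(j | j != k) 1 = 2)%N.
Proof. by rewrite sum1_card -[X in X = _]/(#|predC (pred1 k)|) cardC1 card_ord. Qed.

Lemma card_members g :
  (\sum_k member absent g k = if absent g is Some u then 2 else 3)%N.
Proof.
rewrite /member; case: (absent g) => [u|]; last by rewrite sum1_card card_ord.
rewrite -[RHS](sum1_neq u) [RHS]big_mkcond; apply: eq_bigr => k _.
by rewrite (inj_eq (@Some_inj _)); case: ifP.
Qed.

Lemma card_stream : #|stream absent| = (3 * a + 2 * \sum_u b u)%N.
Proof.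
rewrite card_sig -sum1_card big_mkcond /=.
rewrite -(pair_bigA _ (fun g k => if member absent g k then 1 else 0)%N) /=.
under eq_bigr => g _.
  have -> : (\sum_k (if member absent g k then 1 else 0) = if absent g is Some u then 2 else 3)%N.
    by rewrite -card_members; apply: eq_bigr => k _; case: ifP.
  over.
rewrite (sum_group (fun o => if o is Some _ then 2 else 3)%N) mulnC big_distrr /=.
by congr (_ + _)%N; apply: eq_bigr => u _; rewrite mulnC.
Qed.

(** Each group has one more stream than basis vectors, namely that of its pivot. *)
Lemma card_relay_basis : #|relay_basis absent| = (2 * a + \sum_u b u)%N.
Proof.
have : (#|stream absent| = #|group| + #|relay_basis absent|)%N.
  rewrite card_sig -[in RHS]sum1_card -(sum1_card (relay_basis absent)).
  rewrite -sum1_card big_mkcond [X in (_ + X)%N]big_mkcond /=.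
  rewrite -(pair_bigA _ (fun g k => if member absent g k then 1 else 0)%N) /=.
  rewrite -(pair_bigA _ (fun g k => if (g, k) \in relay_basis absent then 1 else 0)%N) /=.
  rewrite -big_split /=; apply: eq_bigr => g _.
  rewrite (bigD1 (pivot absent g))//= member_pivot; congr (_ + _)%N.
  rewrite [LHS]big_mkcond; apply: eq_bigr => k _; rewrite unfold_in /relay_basis /=.
  by rewrite andbC; case: (k != _).
rewrite card_stream -sum1_card (sum_group (fun=> 1%N)) muln1.
rewrite -big_distrl /= muln1.
lia.
Qed.
End GroupCounts.

Section Generic.
Context {R : realType} (M N : nat).
Local Notation C := R[i].
Local Notation idx := (chan_idx 3 M N).

Lemma mxcpoly_chanH k : mxcpoly (fun x : idx -> R => chanH x k).
Proof.
move=> i j; split.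
  by apply: (rpoly_ext (f := fun x => x (false, k, i, j, false)));
    [move=> x; rewrite mxE|exact: rpoly_var].
by apply: (rpoly_ext (f := fun x => x (false, k, i, j, true)));
  [move=> x; rewrite mxE|exact: rpoly_var].
Qed.

Lemma mxcpoly_chanG k : mxcpoly (fun x : idx -> R => chanG x k).
Proof.
move=> j i; split.
  by apply: (rpoly_ext (f := fun x => x (true, k, i, j, false)));
    [move=> x; rewrite mxE|exact: rpoly_var].
by apply: (rpoly_ext (f := fun x => x (true, k, i, j, true)));
  [move=> x; rewrite mxE|exact: rpoly_var].
Qed.

Lemma generic_dof_achievable (Gam : finType) (tau : Gam -> option 'I_3) (sigma2 : R) :
  (0 < M)%N -> (0 < N)%N -> 0 < sigma2 ->
  (#|relay_basis tau| <= N)%N -> (forall k, (#|[pred g | member tau g k]| <= M)%N) ->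
  exists A : set (idx -> R), lebesgue_null A /\ forall x, ~ A x ->
    dof_user_achievable (chanH x) (chanG x) sigma2 (#|stream tau|%:R / 3).
Proof.
move=> M0 N0 s0 bN nM.
pose B k : 'M[C]_(N, M) := (relay_proj tau N)^T *m witness_mx tau M k.
(* The reference channel is reciprocal, so one construction serves the uplink and the transposed
   downlink. *)
pose x0 (i : idx) : R := let: (_, k, i, j, p) := i in cpart p (B k i j).
have H0 k : chanH x0 k = B k.
  by apply/matrixP => i j; rewrite mxE /x0 /=; case: (B k i j).
have G0 k : (chanG x0 k)^T = B k.
  by apply/matrixP => i j; rewrite [LHS]mxE [LHS]mxE /x0 /=; case: (B k i j).
have [v [Q [pQ Q0 vE]]] := alignment bN nM mxcpoly_chanH H0.
have [u [P [pP P0 uE]]] :=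
  alignment (H := fun k x => (chanG x k)^T) bN nM (fun k => mxcpoly_tr (mxcpoly_chanG k)) G0.
(* A real polynomial that vanishes exactly where one of the two alignments degenerates. *)
pose f x := nsq (\det (Q x) * \det (P x)).
have pf : rpoly f by apply: rpoly_nsq; apply: cpolyM; exact: cpoly_det.
have f0 : f x0 != 0 by rewrite /f Q0 P0 !det1 mulr1 /nsq /= expr1n expr0n addr0 oner_eq0.
exists [set x | f x = 0]; split.
  exact: (rpoly_zero_null (false, ord0, Ordinal N0, Ordinal M0, false) pf f0).
move=> x fx; have [Qx Px] : \det (Q x) != 0 /\ \det (P x) != 0.
  split; apply/eqP => e; apply: fx => /=; rewrite /f e ?mul0r ?mulr0;
    by rewrite /nsq /= expr0n addr0.
apply: (@dof_achievable R 3 M N (chanH x) (chanG x) (stream tau)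
  (@stream_src _ tau) (@stream_dst _ tau) (fun s => v (val s).1 (stream_src s) x)
  (fun s => (u (val s).1 (stream_dst s) x)^T) (relay_fwd N (Q x) (P x))) => //.
  exact: stream_src_dst.
apply: (@stream_zero_forcing R Gam tau N M (chanH x) (chanG x)
  (fun g k => v g k x) (fun g k => u g k x)).
- by rewrite unitmxE unitfE.
- by rewrite unitmxE unitfE.
- by move=> g k; exact: vE.
- by move=> g k; exact: uE.
Qed.
End Generic.

(** Each stream takes one transmit antenna; a group of three spends 2 relay dimensions on 3 streams,
    a group of two only 1 on 2. Groups of three are used alone when [2 * M <= N], mixed up to
    [3 * M < 2 * N] so as to fill all antennas, and absent when the relay is the bottleneck. *)
Lemma stream_allocation (M N : nat) : exists (a : nat) (b : 'I_3 -> nat),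
  [/\ (2 * a + \sum_u b u <= N)%N, forall k, (a + \sum_(u | u != k) b u <= M)%N &
    (3 * a + 2 * \sum_u b u = if 3 * M < 2 * N then 3 * M else 2 * N)%N].
Proof.
pose s3 (x y z : nat) (u : 'I_3) : nat := nth 0%N [:: x; y; z] u.
have E x y z : (\sum_u s3 x y z u = x + y + z)%N.
  by rewrite !big_ord_recl big_ord0 /s3 /= addn0 addnA.
have E' x y z k : (\sum_(u | u != k) s3 x y z u = x + y + z - s3 x y z k)%N.
  by rewrite -E [in RHS](bigD1 k)//= addKn.
have allocate a x y z : (2 * a + (x + y + z) <= N)%N ->
    (a + (x + y) <= M)%N -> (a + (x + z) <= M)%N -> (a + (y + z) <= M)%N ->
    (3 * a + 2 * (x + y + z) = if 3 * M < 2 * N then 3 * M else 2 * N)%N ->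
    exists (a : nat) (b : 'I_3 -> nat),
    [/\ (2 * a + \sum_u b u <= N)%N, forall k, (a + \sum_(u | u != k) b u <= M)%N &
    (3 * a + 2 * \sum_u b u = if 3 * M < 2 * N then 3 * M else 2 * N)%N].
  move=> h1 h2 h3 h4 h5; exists a, (s3 x y z); rewrite E; split=> // k; rewrite E'.
  by case: k => [[|[|[|?]]] ?] //; rewrite /s3 /=; lia.
case: ltnP => MN in allocate *.
  have [M2N|NM2] := leqP (2 * M) N; first by apply: (allocate M 0 0 0)%N; lia.
  by apply: (allocate (2 * N - 3 * M) (2 * M - N) (2 * M - N) (2 * M - N))%N; lia.
by apply: (allocate 0 (N %/ 3 + (1 <= N %% 3)) (N %/ 3 + (2 <= N %% 3)) (N %/ 3))%N; lia.
Qed.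

Theorem theorem1 (R : realType) (M N : nat) (sigma2 : R) :
  (0 < M)%N -> (0 < N)%N -> 0 < sigma2 ->
  exists A : set (chan_idx 3 M N -> R),
    lebesgue_null A /\
    forall x : chan_idx 3 M N -> R, ~ A x ->
      dof_user_achievable (chanH x) (chanG x) sigma2 (dstar R M N) /\
      (forall d : R, dof_user_achievable (chanH x) (chanG x) sigma2 d ->
         d <= dstar R M N).
Proof.
move=> M0 N0 s0; have [a [b [bN nM card_s]]] := stream_allocation M N.
have [||A [An hA]] := generic_dof_achievable (tau := @absent a b) M0 N0 s0.
- by rewrite card_relay_basis.
- by move=> k; rewrite card_member.
exists A; split=> // x /hA; rewrite card_stream card_s /dstar; case: ifP => MN.
  rewrite natrM mulrC mulKf ?pnatr_eq0// => ach; split=> // d; exact: dof_le_user_antennas.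
by move=> ach; split=> // d; exact: dof_le_relay_antennas.
Qed.
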